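(* Let $G$ be a simple graph on $n$ nodes with degeneracy $d$, and let $H$ be a graph on $k$ nodes obtained from the complete graph $K_k$ by removing $\epsilon$ edges. Then one can compute $\hom(H,G)$, $\mathrm{sub}(H,G)$ and $\mathrm{ind}(H,G)$ in time $f(d,k)\cdot\tilde{O}\big(n^{\lceil \frac12+\sqrt{\epsilon/2}\,\rceil}\big)$, for some computable function $f$.
   Context: The degeneracy of $G$ is the smallest $d$ such that $G$ admits an acyclic orientation in which every node has out-degree at most $d$. $\hom(H,G)$ is the number of homomorphisms from $H$ to $G$; $\mathrm{sub}(H,G)$ the number of subgraphs of $G$ isomorphic to $H$; $\mathrm{ind}(H,G)$ the number of induced subgraphs of $G$ isomorphic to $H$. Conventions: $k=O(1)$, asymptotic notation hides $\mathrm{poly}(k)$ factors, and $\tilde O(\cdot)$ additionally hides $\mathrm{polylog}(ndk)$ factors. *)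

(* Defs.v *)
From HB Require Import structures.
From mathcomp Require Import all_boot all_order all_algebra.
From mathcomp Require Import reals Rstruct.

Set Implicit Arguments.
Unset Strict Implicit.
Unset Printing Implicit Defensive.

Local Open Scope nat_scope.

(** * Simple graphs *)

Record sgraph (V : finType) := SGraph {
  adj :> rel V;
  adj_sym : symmetric adj;
  adj_irrefl : irreflexive adj }.

Definition edges (V : finType) (G : sgraph V) : {set {set V}} :=
  [set e | [exists x, exists y, G x y && (e == [set x; y])]].

Definition complete_rel (V : finType) : rel V := [rel x y | x != y].

Lemma complete_sym (V : finType) : symmetric (@complete_rel V).
Proof. by move=> x y; rewrite /complete_rel /= eq_sym. Qed.

Lemma complete_irrefl (V : finType) : irreflexive (@complete_rel V).
Proof. by move=> x; rewrite /complete_rel /= eqxx. Qed.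

Definition complete (V : finType) : sgraph V :=
  SGraph (@complete_sym V) (@complete_irrefl V).

Definition remove_edges_rel (V : finType) (G : sgraph V)
  (F : {set {set V}}) : rel V :=
  [rel x y | G x y && ([set x; y] \notin F)].

Lemma remove_edges_sym (V : finType) (G : sgraph V) (F : {set {set V}}) :
  symmetric (remove_edges_rel G F).
Proof. by move=> x y; rewrite /remove_edges_rel /= adj_sym setUC. Qed.

Lemma remove_edges_irrefl (V : finType) (G : sgraph V) (F : {set {set V}}) :
  irreflexive (remove_edges_rel G F).
Proof. by move=> x; rewrite /remove_edges_rel /= adj_irrefl. Qed.

Definition remove_edges (V : finType) (G : sgraph V) (F : {set {set V}}) :
  sgraph V :=
  SGraph (remove_edges_sym G F) (remove_edges_irrefl G F).

(** * Degeneracy *)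

(* Every edge gets exactly one of its two directions. *)
Definition orientation (V : finType) (G : sgraph V) (D : rel V) : Prop :=
  forall x y, (G x y = D x y || D y x) /\ ~~ (D x y && D y x).

Definition acyclic (V : finType) (D : rel V) : Prop :=
  forall c : seq V, cycle D c -> c = [::].

Definition outdegree (V : finType) (D : rel V) (x : V) : nat := #|[set y | D x y]|.

Definition degenerate (V : finType) (G : sgraph V) (d : nat) : Prop :=
  exists D : rel V,
    [/\ orientation G D, acyclic D & forall x, outdegree D x <= d].

Definition is_degeneracy (V : finType) (G : sgraph V) (d : nat) : Prop :=
  degenerate G d /\ forall d', degenerate G d' -> d <= d'.

(** * Counting homomorphisms, subgraphs and induced subgraphs *)

Definition hom (U V : finType) (H : sgraph U) (G : sgraph V) : nat :=
  #|[set phi : {ffun U -> V} | [forall x, forall y, H x y ==> G (phi x) (phi y)]]|.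

(* H is isomorphic to the graph with vertex set W and adjacency relation e
   restricted to W. *)
Definition isomorphic_to (U V : finType) (H : sgraph U) (W : {set V}) (e : rel V) :
  bool :=
  [exists phi : {ffun U -> V},
    [&& injectiveb phi, phi @: [set: U] == W
      & [forall x, forall y, H x y == e (phi x) (phi y)]]].

(* A subgraph of G is a pair of a vertex set and an edge set. *)
Definition is_subgraph (V : finType) (G : sgraph V)
  (S : {set V} * {set {set V}}) : bool :=
  (S.2 \subset edges G) && [forall e in S.2, e \subset S.1].

Definition sub (U V : finType) (H : sgraph U) (G : sgraph V) : nat :=
  #|[set S : {set V} * {set {set V}} |
      is_subgraph G S && isomorphic_to H S.1 [rel x y | [set x; y] \in S.2]]|.

(* Induced subgraphs of G correspond to vertex sets. *)
Definition ind (U V : finType) (H : sgraph U) (G : sgraph V) : nat :=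
  #|[set W : {set V} | isomorphic_to H W G]|.

(** * Random access machines with logarithmic cost *)

(* The RAM of Cook and Reckhow (also Aho, Hopcroft and Ullman), with jumps
   replaced by structured control flow.  A program uses a fixed finite number
   of registers and an unbounded memory addressed indirectly through
   registers; every cell holds a natural number.  An instruction is charged
   the total bit length of the values and addresses it handles, so that large
   numbers give no unrealistic power. *)

Inductive op := Add | Sub | Mul | Div.

(* Subtraction is truncated, and division by zero gives zero. *)
Definition op_sem (o : op) : nat -> nat -> nat :=
  match o with
  | Add => addn | Sub => subn | Mul => muln | Div => divn
  end.

Inductive prog :=
  | Skip
  | Const (r a : nat)             (* r := a *)
  | Op (o : op) (r r1 r2 : nat)   (* r := r1 o r2 *)
  | Read (r r1 : nat)             (* r := M[r1] *)
  | Write (r r1 : nat)            (* M[r] := r1 *)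
  | Seq (p q : prog)
  | If (r : nat) (p q : prog)     (* p when r is nonzero, else q *)
  | While (r : nat) (p : prog).   (* repeat p as long as r is nonzero *)

Record state := State { reg : nat -> nat; mem : nat -> nat }.

Definition upd (m : nat -> nat) (i a : nat) : nat -> nat :=
  fun j => if j == i then a else m j.

Definition set_reg (s : state) (r a : nat) : state := State (upd (reg s) r a) (mem s).
Definition set_mem (s : state) (i a : nat) : state := State (reg s) (upd (mem s) i a).

Definition bitlen (a : nat) : nat := (trunc_log 2 a).+1.

(* exec p s t s': started in s, p halts in s' after time t. *)
Inductive exec : prog -> state -> nat -> state -> Prop :=
  | exec_skip s : exec Skip s 1 s
  | exec_const s r a :
      exec (Const r a) s (bitlen a) (set_reg s r a)
  | exec_op s o r r1 r2 :
      exec (Op o r r1 r2) s (bitlen (reg s r1) + bitlen (reg s r2))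
        (set_reg s r (op_sem o (reg s r1) (reg s r2)))
  | exec_read s r r1 :
      exec (Read r r1) s (bitlen (reg s r1) + bitlen (mem s (reg s r1)))
        (set_reg s r (mem s (reg s r1)))
  | exec_write s r r1 :
      exec (Write r r1) s (bitlen (reg s r) + bitlen (reg s r1))
        (set_mem s (reg s r) (reg s r1))
  | exec_seq p q s s1 s2 t1 t2 :
      exec p s t1 s1 -> exec q s1 t2 s2 -> exec (Seq p q) s (t1 + t2) s2
  | exec_if_true r p q s s' t :
      reg s r != 0 -> exec p s t s' -> exec (If r p q) s (bitlen (reg s r) + t) s'
  | exec_if_false r p q s s' t :
      reg s r = 0 -> exec q s t s' -> exec (If r p q) s (bitlen (reg s r) + t) s'
  | exec_while_true r p s s1 s2 t1 t2 :
      reg s r != 0 -> exec p s t1 s1 -> exec (While r p) s1 t2 s2 ->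
      exec (While r p) s (bitlen (reg s r) + t1 + t2) s2
  | exec_while_false r p s :
      reg s r = 0 -> exec (While r p) s (bitlen (reg s r)) s.

(* The input is written at the beginning of the memory; all other cells and
   all registers are initially zero. *)
Definition init (input : seq nat) : state := State (fun _ => 0) (nth 0 input).

(* The output is the final content of register 0. *)
Definition computes_in (p : prog) (input : seq nat) (output t : nat) : Prop :=
  exists2 s, exec p (init input) t s & reg s 0 = output.

Definition computes_within (p : prog) (input : seq nat) (output T : nat) : Prop :=
  exists2 t, t <= T & computes_in p input output t.

Definition computable2 (f : nat -> nat -> nat) : Prop :=
  exists p : prog, forall a b, exists t, computes_in p [:: a; b] (f a b) t.

(** * Adjacency list representation *)

(* The neighbours of a vertex may be listed in any order. *)
Definition adjacency_lists (n : nat) (G : sgraph 'I_n) (L : 'I_n -> seq 'I_n) : Prop :=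
  forall x, uniq (L x) /\ forall y, (y \in L x) = G x y.

(* The number of vertices, then for each vertex its degree followed by its
   neighbours. *)
Definition encode_lists (n : nat) (L : 'I_n -> seq 'I_n) : seq nat :=
  n :: flatten [seq size (L x) :: [seq val y | y <- L x] | x <- enum 'I_n].

(** * Time bounds *)

(* ceil(1/2 + sqrt(eps/2)) *)
Definition clique_exponent (eps : nat) : nat :=
  absz (Num.ceil (2%:R^-1 + Num.sqrt (eps%:R / 2%:R) : Rdefinitions.R)%R).

(* The factors hidden by the soft-O notation: a constant times poly(k) times
   polylog(n d k).  The shifts only matter when one of n, d, k is at most 1,
   where they keep the factors from vanishing. *)
Definition soft_factor (c n d k : nat) : nat :=
  c * k.+1 ^ c * trunc_log 2 (n.+2 * d.+2 * k.+2) ^ c.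

(* Main.v *)
(** Repeatedly peeling off the vertices that have at most [4 d] remaining
    neighbours orients the host graph with out-degrees at most [4 d] in
    logarithmically many rounds. By inclusion-exclusion the numbers of
    homomorphisms, injective homomorphisms and induced embeddings (the last
    two being |Aut H| times the numbers of copies) are signed sums over
    labellings of the pairs of pattern vertices (no constraint, an arc in
    either direction, or equality) of the number of maps satisfying the
    labels. In a labelling with nonzero sign every edge of H is an arc.
    Greedily deleting the vertices that have an arc coming from a remaining
    vertex leaves s pairwise nonadjacent roots, so s (s - 1) / 2 <= eps, and
    every vertex can be reached from a root along arcs. Split the roots in two
    sides of at most r = ceil(s / 2) roots: for each side the partial maps on
    the vertices reachable from it are enumerated by the n^r choices for the
    roots and one of at most [4 d] out-neighbours for each other vertex. Each
    constraint lies within one side, so the solutions are the pairs of partial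
    maps that agree on the common vertices; they are counted with a table
    indexed by the restriction to these. *)

Require Import Defs.
From Stdlib Require Import FunctionalExtensionality.
From mathcomp Require Import all_boot all_order ssralg ssrnum ssrint archimedean.
From mathcomp Require Import reals Rstruct zify lra.

Set Implicit Arguments.
Unset Strict Implicit.
Unset Printing Implicit Defensive.

Local Open Scope nat_scope.
Local Notation smem := Defs.mem.

(** * A functional language over the machine *)

(** The exponent is 1 for a complete pattern, so the orientation has to be found in nearly linear
    time, and without [d], which the input does not contain: thresholds are tried upwards from 0,
    and [4 * d] suffices because the subgraph on any set of vertices has average degree at most
    [2 * d]. An equality label acts as a pair of opposite arcs, so identified vertices are reached
    from a common side as well. The exponent arises thus: more than [j] roots on a side mean at
    least [2 * j + 1] roots in all, hence [j * (2 * j + 1) <= eps], which forces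
    [j < 1/2 + sqrt (eps / 2)]. A partial map is stored as one number below [(n + 1) ^ k] and serves
    directly as an address. Tables may be that large although the time is about [n ^ r], because
    memory is initially zero and only accesses are paid for; under logarithmic cost such numbers add
    [O(k ^ 2 log (n d k))] per instruction. The time bounds come from a small language with a
    verified compiler: Hoare triples count instructions, and a global bound [M] on all values prices
    each of them. *)

(* Variables are numbered from the outermost binder. *)
Inductive expr :=
  | EVar (i : nat)
  | ENum (a : nat)
  | EBin (o : op) (e1 e2 : expr)
  | EGet (e : expr)
  | ELet (e1 e2 : expr)
  | ECond (e e1 e2 : expr)
  | EIter (en e0 body : expr)
  | ECall (n : nat) (args : nat -> expr) (body : expr).

Inductive cmd :=
  | CSkip
  | CStore (ea ev : expr)
  | CSeq (c1 c2 : cmd)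
  | CLet (e : expr) (c : cmd)
  | CIf (e : expr) (c : cmd)
  | CFor (en : expr) (c : cmd).

(** Truncated subtraction and division never exceed their first operand, so only sums and products
    can leave the range. *)
Definition op_bounded (M : nat) (o : op) (a b : nat) : bool :=
  match o with Add => a + b <= M | Mul => a * b <= M | _ => true end.

(* [evals M X m env e v]: in memory [m], [e] has value [v], no intermediate
   result exceeds [M], and no iteration is longer than [X]. *)
Inductive evals (M X : nat) (m : nat -> nat) : seq nat -> expr -> nat -> Prop :=
  | EvVar env i : evals M X m env (EVar i) (nth 0 env i)
  | EvNum env a : a <= M -> evals M X m env (ENum a) a
  | EvBin env o e1 e2 v1 v2 :
      evals M X m env e1 v1 -> evals M X m env e2 v2 -> op_bounded M o v1 v2 ->
      evals M X m env (EBin o e1 e2) (op_sem o v1 v2)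
  | EvGet env e v : evals M X m env e v -> evals M X m env (EGet e) (m v)
  | EvLet env e1 e2 v1 v2 :
      evals M X m env e1 v1 -> evals M X m (rcons env v1) e2 v2 ->
      evals M X m env (ELet e1 e2) v2
  | EvCond env e e1 e2 v v' :
      evals M X m env e v ->
      (v != 0 -> evals M X m env e1 v') -> (v = 0 -> evals M X m env e2 v') ->
      evals M X m env (ECond e e1 e2) v'
  | EvIter env en e0 body n (A : nat -> nat) :
      evals M X m env en n -> n <= X -> evals M X m env e0 (A 0) ->
      (forall i, i < n ->
         evals M X m (rcons (rcons env i) (A i)) body (A i.+1)) ->
      evals M X m env (EIter en e0 body) (A n)
  | EvCall env n args body vs v :
      size vs = n -> (forall i, i < n -> evals M X m env (args i) (nth 0 vs i)) ->
      evals M X m vs body v -> evals M X m env (ECall n args body) v.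

(** The instruction set has no move. Wherever this is used the two registers are distinct, so [r1]
    survives the clearing of [r]. *)
Definition copy_reg (r r1 : nat) : prog := Seq (Const r 0) (Op Add r r r1).

(* Variable [i] lives in register [nth 0 rho i]; the value is left in
   register [p], and registers below [p] are preserved. *)
Fixpoint ecomp (e : expr) (rho : seq nat) (p : nat) : prog :=
  match e with
  | EVar i => if i < size rho then copy_reg p (nth 0 rho i) else Const p 0
  | ENum a => Const p a
  | EBin o e1 e2 => Seq (ecomp e1 rho p) (Seq (ecomp e2 rho p.+1) (Op o p p p.+1))
  | EGet e => Seq (ecomp e rho p) (Read p p)
  | ELet e1 e2 =>
      Seq (ecomp e1 rho p) (Seq (ecomp e2 (rcons rho p) p.+1) (copy_reg p p.+1))
  | ECond e e1 e2 => Seq (ecomp e rho p) (If p (ecomp e1 rho p) (ecomp e2 rho p))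
  | EIter en e0 body =>
      Seq (ecomp e0 rho p) (Seq (ecomp en rho p.+1) (Seq (Const p.+2 0)
        (While p.+1
           (Seq (ecomp body (rcons (rcons rho p.+2) p) p.+3)
           (Seq (copy_reg p p.+3)
           (Seq (Const p.+3 1)
           (Seq (Op Add p.+2 p.+2 p.+3) (Op Defs.Sub p.+1 p.+1 p.+3))))))))
  | ECall n args body =>
      Seq (foldr (fun i q => Seq (ecomp (args i) rho (p.+1 + i)) q) Skip (iota 0 n))
        (Seq (ecomp body (iota p.+1 n) (p.+1 + n)) (copy_reg p (p.+1 + n)))
  end.

Fixpoint ccomp (c : cmd) (rho : seq nat) (p : nat) : prog :=
  match c with
  | CSkip => Skip
  | CStore ea ev => Seq (ecomp ea rho p) (Seq (ecomp ev rho p.+1) (Write p p.+1))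
  | CSeq c1 c2 => Seq (ccomp c1 rho p) (ccomp c2 rho p)
  | CLet e c => Seq (ecomp e rho p) (ccomp c (rcons rho p) p.+1)
  | CIf e c => Seq (ecomp e rho p) (If p (ccomp c rho p.+1) Skip)
  | CFor en c =>
      Seq (ecomp en rho p) (Seq (Const p.+1 0)
        (While p
           (Seq (ccomp c (rcons rho p.+1) p.+2)
           (Seq (Const p.+2 1)
           (Seq (Op Add p.+1 p.+1 p.+2) (Op Defs.Sub p p p.+2))))))
  end.

(** A syntactic bound on the number of instructions: both branches of a conditional are added, and
    every iteration is charged for [X] rounds whatever its actual length. *)
Fixpoint ecost (X : nat) (e : expr) : nat :=
  match e with
  | EVar _ => 2
  | ENum _ => 1
  | EBin _ e1 e2 => ecost X e1 + ecost X e2 + 1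
  | EGet e => ecost X e + 1
  | ELet e1 e2 => ecost X e1 + ecost X e2 + 2
  | ECond e e1 e2 => ecost X e + ecost X e1 + ecost X e2 + 1
  | EIter en e0 body => ecost X e0 + ecost X en + X * (ecost X body + 6) + 2
  | ECall n args body =>
      foldr (fun i c => ecost X (args i) + c) 1 (iota 0 n) + ecost X body + 2
  end.

(** The expressions in the programs are fixed and [X] will depend on [d] and [k] only, so all
    evaluation costs go into the factor [f]. *)
Lemma ecost_poly (e : expr) :
  exists a b, forall X, ecost X e <= a * X.+1 ^ b.
Proof.
have up x y c X : x <= y -> c * X.+1 ^ x <= c * X.+1 ^ y.
  by move=> xy; rewrite leq_mul2l leq_pexp2l ?orbT.
have one c X b : c <= c * X.+1 ^ b by rewrite leq_pmulr // expn_gt0.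
have pw a b X : b.+1 <= a -> X * X.+1 ^ b <= X.+1 ^ a.
  move=> h; apply: (@leq_trans (X.+1 ^ b.+1)); last by rewrite leq_pexp2l.
  by rewrite expnS leq_mul2r leqnSn orbT.
elim: e => [i|a|o e1 [a1 [b1 h1]] e2 [a2 [b2 h2]]|e [a [b h]]
  |e1 [a1 [b1 h1]] e2 [a2 [b2 h2]]|e [a [b h]] e1 [a1 [b1 h1]] e2 [a2 [b2 h2]]
  |en [a [b h]] e0 [a1 [b1 h1]] body [a2 [b2 h2]]|n args hargs body [a [b h]]] /=.
- by exists 2, 0 => X; rewrite expn0.
- by exists 1, 0 => X; rewrite expn0.
- exists (a1 + a2 + 1), (b1 + b2) => X.
  rewrite !mulnDl; apply: leq_add; last exact: one.
  apply: leq_add; [apply: leq_trans (h1 X) _|apply: leq_trans (h2 X) _]; apply: up; lia.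
- exists (a + 1), b => X; rewrite !mulnDl; apply: leq_add; [exact: h|exact: one].
- exists (a1 + a2 + 2), (b1 + b2) => X.
  rewrite !mulnDl; apply: leq_add; last exact: one.
  apply: leq_add; [apply: leq_trans (h1 X) _|apply: leq_trans (h2 X) _]; apply: up; lia.
- exists (a + a1 + a2 + 1), (b + b1 + b2) => X.
  rewrite !mulnDl; apply: leq_add; last exact: one.
  apply: leq_add; last by apply: leq_trans (h2 X) _; apply: up; lia.
  apply: leq_add; [apply: leq_trans (h X) _|apply: leq_trans (h1 X) _]; apply: up; lia.
- exists (a1 + a + (a2 + 6) + 2), (b + b1 + b2.+1) => X.
  rewrite [in X in _ <= X]mulnDl; apply: leq_add; last exact: one.
  rewrite [in X in _ <= X]mulnDl; apply: leq_add.
    rewrite [in X in _ <= X]mulnDl.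
    apply: leq_add; [apply: leq_trans (h1 X) _|apply: leq_trans (h X) _]; apply: up; lia.
  apply: (@leq_trans (X * ((a2 + 6) * X.+1 ^ b2))).
    rewrite leq_mul2l mulnDl; apply/orP; right; apply: leq_add => //; exact: one.
  rewrite mulnCA leq_mul2l; apply/orP; right; apply: pw; lia.
- have [a' [b' h']] : exists a b, forall X,
      foldr (fun i c => ecost X (args i) + c) 1 (iota 0 n) <= a * X.+1 ^ b.
    elim: (iota 0 n) => [|i s [a1 [b1 h1]]] /=; first by exists 1, 0 => X; rewrite expn0.
    have [a2 [b2 h2]] := hargs i.
    exists (a2 + a1), (b1 + b2) => X; rewrite mulnDl.
    apply: leq_add; [apply: leq_trans (h2 X) _|apply: leq_trans (h1 X) _]; apply: up; lia.
  exists (a' + a + 2), (b + b') => X.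
  rewrite !mulnDl; apply: leq_add; last exact: one.
  apply: leq_add; [apply: leq_trans (h' X) _|apply: leq_trans (h X) _]; apply: up; lia.
Qed.

Lemma bitlen_mono (a b : nat) : a <= b -> bitlen a <= bitlen b.
Proof. by move=> ab; rewrite /bitlen ltnS leq_trunc_log. Qed.

Lemma updE (m : nat -> nat) (i a j : nat) : upd m i a j = if j == i then a else m j.
Proof. by []. Qed.

(** * Correctness and cost of compiled code *)

Section Compiler.

Variables (M X : nat).
Hypothesis M_gt0 : 0 < M.

(** An instruction is charged for at most two numbers, each at most [M]. *)
Definition unit_cost : nat := 2 * bitlen M.

Definition bounded (m : nat -> nat) : Prop := forall a, m a <= M.

Definition holds_env (s : state) (rho env : seq nat) (p : nat) : Prop :=
  size rho = size env /\ forall i, i < size env ->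
    [/\ nth 0 rho i < p, reg s (nth 0 rho i) = nth 0 env i & nth 0 env i <= M].

Lemma evals_le m env e v : bounded m -> all (geq M) env ->
  evals M X m env e v -> v <= M.
Proof.
move=> bm + ev; elim: ev => {env e v}.
- move=> env i /allP h; case: (ltnP i (size env)) => hi; last by rewrite nth_default.
  by apply: h; rewrite mem_nth.
- by move=> env a ha _.
- move=> env o e1 e2 v1 v2 _ h1 _ h2 + /[dup] /h1 {}h1 /h2 {}h2.
  case: o => //= _; first by apply: leq_trans (leq_subr _ _) h1.
  exact: leq_trans (leq_div _ _) h1.
- by move=> env e v _ _ _.
- move=> env e1 e2 v1 v2 _ h1 _ h2 henv; apply: h2.
  by rewrite all_rcons /= h1.
- move=> env e e1 e2 v v' _ _ _ h1 _ h2 henv.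
  by case: (eqVneq v 0) => [/h2|/h1]; apply.
- move=> env en e0 body n A _ hn _ _ h0 _ h henv.
  have {}hn := hn henv; have {}h0 := h0 henv.
  elim: {-2}n (leqnn n) => // i IH hi; apply: h => //.
  rewrite !all_rcons /= IH ?(ltnW hi) // henv.
  lia.
- move=> env n args body vs v sz _ h _ hb henv; apply: hb.
  by apply/(all_nthP 0) => i; rewrite sz => hi; apply: h.
Qed.

Lemma holds_env_all s rho env p : holds_env s rho env p -> all (geq M) env.
Proof. by case=> _ h; apply/(all_nthP 0) => i /h[]. Qed.

Lemma holds_env_frame s s' rho env p p' : holds_env s rho env p -> p <= p' ->
  (forall q, q < p -> reg s' q = reg s q) -> holds_env s' rho env p'.
Proof.
case=> sz h pp' e; split=> // i /h[h1 h2 h3]; split=> //; first exact: leq_trans pp'.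
by rewrite e.
Qed.

Lemma holds_env_rcons s rho env p q v : holds_env s rho env p -> q < p ->
  reg s q = v -> v <= M -> holds_env s (rcons rho q) (rcons env v) p.
Proof.
case=> sz h qp e vM; split; first by rewrite !size_rcons sz.
move=> i; rewrite size_rcons ltnS !nth_rcons sz.
rewrite leq_eqVlt => /orP[/eqP->|lt]; first by rewrite ltnn eqxx.
by rewrite lt; apply: h.
Qed.

Definition runs (q : prog) (s : state) (C : nat) (s' : state) : Prop :=
  exists2 t, t <= C * unit_cost & exec q s t s'.

Lemma unit_ge a b : a <= M -> b <= M -> bitlen a + bitlen b <= unit_cost.
Proof. by move=> /bitlen_mono ? /bitlen_mono ?; rewrite /unit_cost; lia. Qed.

Lemma unit_ge1 a : a <= M -> bitlen a <= unit_cost.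
Proof. by move=> /bitlen_mono ?; rewrite /unit_cost; lia. Qed.

Lemma runs_le q s C C' s' : C <= C' -> runs q s C s' -> runs q s C' s'.
Proof. by move=> h [t ht e]; exists t => //; apply: leq_trans ht _; rewrite leq_mul2r h orbT. Qed.

Lemma runs_seq q1 q2 s s1 s2 C1 C2 :
  runs q1 s C1 s1 -> runs q2 s1 C2 s2 -> runs (Seq q1 q2) s (C1 + C2) s2.
Proof.
move=> [t1 h1 e1] [t2 h2 e2]; exists (t1 + t2); last exact: exec_seq e1 e2.
by rewrite mulnDl leq_add.
Qed.

Lemma runs_skip s : runs Skip s 1 s.
Proof. by exists 1; rewrite ?mul1n; [rewrite /unit_cost /bitlen; lia | exact: exec_skip]. Qed.

Lemma runs_const s r a : a <= M -> runs (Const r a) s 1 (set_reg s r a).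
Proof. by move=> h; exists (bitlen a); [rewrite mul1n unit_ge1|exact: exec_const]. Qed.

Lemma runs_op s o r r1 r2 : reg s r1 <= M -> reg s r2 <= M ->
  runs (Op o r r1 r2) s 1 (set_reg s r (op_sem o (reg s r1) (reg s r2))).
Proof. by move=> h h'; exists (bitlen (reg s r1) + bitlen (reg s r2)); [rewrite mul1n unit_ge|exact: exec_op]. Qed.

Lemma runs_read s r r1 : bounded (smem s) -> reg s r1 <= M ->
  runs (Read r r1) s 1 (set_reg s r (smem s (reg s r1))).
Proof. by move=> b h; eexists; [rewrite mul1n; apply: unit_ge|exact: exec_read]. Qed.

Lemma runs_write s r r1 : reg s r <= M -> reg s r1 <= M ->
  runs (Write r r1) s 1 (set_mem s (reg s r) (reg s r1)).
Proof. by move=> h h'; eexists; [rewrite mul1n; apply: unit_ge|exact: exec_write]. Qed.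

Lemma runs_copy s r r1 : r != r1 -> reg s r1 <= M ->
  exists s', [/\ runs (copy_reg r r1) s 2 s', smem s' = smem s &
    forall q, reg s' q = if q == r then reg s r1 else reg s q].
Proof.
move=> hr h; set s1 := set_reg s r 0.
have h1 : reg s1 r1 = reg s r1 by rewrite /s1 /= updE eq_sym (negPf hr).
exists (set_reg s1 r (op_sem Add (reg s1 r) (reg s1 r1))); split=> //.
  rewrite -[2]/(1 + 1); apply: runs_seq; first exact: runs_const.
  by apply: runs_op; rewrite ?h1 // /s1 /= updE eqxx.
move=> q; rewrite [LHS](_ : _ = if q == r then reg s1 r + reg s1 r1 else reg s1 q) // h1.
by rewrite /s1 /= !updE eqxx add0n; case: eqP.
Qed.

Lemma runs_if_true s s' C r q1 q2 : reg s r <= M -> reg s r != 0 ->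
  runs q1 s C s' -> runs (If r q1 q2) s (C + 1) s'.
Proof.
move=> h hr [t ht e]; exists (bitlen (reg s r) + t); last exact: exec_if_true e.
by rewrite mulnDl addnC leq_add // mul1n unit_ge1.
Qed.

Lemma runs_if_false s s' C r q1 q2 : reg s r = 0 ->
  runs q2 s C s' -> runs (If r q1 q2) s (C + 1) s'.
Proof.
move=> h [t ht e]; exists (bitlen (reg s r) + t); last exact: exec_if_false e.
by rewrite mulnDl addnC leq_add // mul1n unit_ge1 // h.
Qed.

Lemma runs_while_true s s1 s2 C1 C2 r q : reg s r <= M -> reg s r != 0 ->
  runs q s C1 s1 -> runs (While r q) s1 C2 s2 ->
  runs (While r q) s (1 + C1 + C2) s2.
Proof.
move=> h hr [t1 h1 e1] [t2 h2 e2].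
exists (bitlen (reg s r) + t1 + t2); last exact: exec_while_true e1 e2.
by rewrite !mulnDl !leq_add // mul1n unit_ge1.
Qed.

Lemma runs_while_false s r q : reg s r = 0 -> runs (While r q) s 1 s.
Proof.
move=> h; exists (bitlen (reg s r)); last exact: exec_while_false.
by rewrite h mul1n unit_ge1.
Qed.

Lemma ecomp_runs m env e v : bounded m -> evals M X m env e v ->
  forall rho p s, smem s = m -> holds_env s rho env p ->
  exists s', [/\ runs (ecomp e rho p) s (ecost X e) s', smem s' = smem s, reg s' p = v &
    forall q, q < p -> reg s' q = reg s q].
Proof.
move=> bm ev; elim: ev => {env e v}.
- move=> env i rho p s ms henv /=; have [sz h] := henv; rewrite sz; case: ifP => hi.
    have [h1 h2 h3] := h _ hi.
    have [] := @runs_copy s p (nth 0 rho i); rewrite ?h2 //; first by rewrite neq_ltn h1 orbT.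
    move=> s' [r ms' es]; exists s'; split=> //; first by rewrite es eqxx.
    by move=> q qp; rewrite es; case: eqP qp => // ->; rewrite ltnn.
  exists (set_reg s p 0); split=> //.
  + by apply: runs_le (runs_const _ _ _).
  + by rewrite /= updE eqxx nth_default // leqNgt hi.
  + by move=> q qp; rewrite /= updE; case: eqP qp => // ->; rewrite ltnn.
- move=> env a ha rho p s ms henv /=.
  exists (set_reg s p a); split=> //.
  + exact: runs_const.
  + by rewrite /= updE eqxx.
  + by move=> q qp; rewrite /= updE; case: eqP qp => // ->; rewrite ltnn.
- move=> env o e1 e2 v1 v2 ev1 IH1 ev2 IH2 ob rho p s ms henv /=.
  have le1 := evals_le bm (holds_env_all henv) ev1.
  have le2 := evals_le bm (holds_env_all henv) ev2.
  have [s1 [r1 m1 g1 f1]] := IH1 _ _ _ ms henv.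
  have henv1 := holds_env_frame henv (leqnSn p) f1.
  have [s2 [r2 m2 g2 f2]] := IH2 _ _ _ (etrans m1 ms) henv1.
  have gp : reg s2 p = v1 by rewrite f2.
  exists (set_reg s2 p (op_sem o (reg s2 p) (reg s2 p.+1))); split.
  + rewrite -addnA; apply: runs_seq r1 _; apply: runs_seq r2 _.
    by apply: runs_op; rewrite ?gp ?g2.
  + by rewrite /= m2.
  + by rewrite /= updE eqxx gp g2.
  + move=> q qp; rewrite /= updE; case: eqP qp => [->|_ qp]; first by rewrite ltnn.
    by rewrite f2 ?f1 // ltnS ltnW.
- move=> env e v ev IH rho p s ms henv /=.
  have le1 := evals_le bm (holds_env_all henv) ev.
  have [s1 [r1 m1 g1 f1]] := IH _ _ _ ms henv.
  exists (set_reg s1 p (smem s1 (reg s1 p))); split.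
  + by apply: runs_seq r1 _; apply: runs_read; rewrite ?g1 // m1 ms.
  + by [].
  + by rewrite /= updE eqxx m1 ms g1.
  + move=> q qp; rewrite /= updE; case: eqP qp => [->|_ qp]; first by rewrite ltnn.
    exact: f1.
- move=> env e1 e2 v1 v2 ev1 IH1 ev2 IH2 rho p s ms henv /=.
  have le1 := evals_le bm (holds_env_all henv) ev1.
  have [s1 [r1 m1 g1 f1]] := IH1 _ _ _ ms henv.
  have henv1 := holds_env_rcons (holds_env_frame henv (leqnSn p) f1) (leqnn p.+1) g1 le1.
  have le2 := evals_le bm (holds_env_all henv1) ev2.
  have [s2 [r2 m2 g2 f2]] := IH2 _ _ _ (etrans m1 ms) henv1.
  have [] := @runs_copy s2 p p.+1; rewrite ?g2 //; first by rewrite neq_ltn leqnn.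
  move=> s3 [r3 m3 g3]; exists s3; split.
  + rewrite -addnA; apply: runs_seq r1 _; exact: runs_seq r2 _.
  + by rewrite m3 m2.
  + by rewrite g3 eqxx.
  + move=> q qp; rewrite g3; case: eqP qp => [->|_ qp]; first by rewrite ltnn.
    by rewrite f2 ?f1 // ltnS ltnW.
- move=> env e e1 e2 v v' ev IH ev1 IH1 ev2 IH2 rho p s ms henv /=.
  have le := evals_le bm (holds_env_all henv) ev.
  have [s1 [r1 m1 g1 f1]] := IH _ _ _ ms henv.
  have henv1 := holds_env_frame henv (leqnn p) f1.
  have [v0|vn0] := eqVneq v 0.
    have [s2 [r2 m2 g2 f2]] := IH2 v0 _ _ _ (etrans m1 ms) henv1.
    exists s2; split=> //; [|by rewrite m2|by move=> q qp; rewrite f2 // f1].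
    rewrite -addnA -addnA; apply: runs_seq r1 _.
    apply: (@runs_le _ _ (ecost X e2 + 1)); first lia.
    by apply: runs_if_false; rewrite ?g1.
  have [s2 [r2 m2 g2 f2]] := IH1 vn0 _ _ _ (etrans m1 ms) henv1.
  exists s2; split=> //; [|by rewrite m2|by move=> q qp; rewrite f2 // f1].
  rewrite -addnA -addnA; apply: runs_seq r1 _.
  apply: (@runs_le _ _ (ecost X e1 + 1)); first lia.
  by apply: runs_if_true; rewrite ?g1.
- move=> env en e0 body n A evn IHn nX ev0 IH0 evb IHb rho p s ms henv /=.
  have len := evals_le bm (holds_env_all henv) evn.
  have le0 := evals_le bm (holds_env_all henv) ev0.
  have [s1 [r1 m1 g1 f1]] := IH0 _ _ _ ms henv.
  have henv1 := holds_env_frame henv (leqnSn p) f1.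
  have [s2 [r2 m2 g2 f2]] := IHn _ _ _ (etrans m1 ms) henv1.
  set s3 := set_reg s2 p.+2 0.
  set W := While _ _.
  (* Register [p] holds the accumulator, [p.+1] the rounds left and [p.+2] the current index; the
     induction is on the rounds left, so the index reads [n - i]. *)
  have loop i : i <= n -> forall s', smem s' = m -> reg s' p.+1 = i -> reg s' p.+2 = n - i ->
      reg s' p = A (n - i) -> A (n - i) <= M -> (forall q, q < p -> reg s' q = reg s q) ->
      exists s'', [/\ runs W s' (i * (ecost X body + 6) + 1) s'', smem s'' = m,
        reg s'' p = A n & forall q, q < p -> reg s'' q = reg s q].
    elim: i => [|i IH] lei s' ms' e1 e2 e3 le3 f.
      exists s'; split=> //; first exact: runs_while_false.
      by rewrite e3 subn0.
    have lti : n - i.+1 < n by lia.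
    have henv' : holds_env s' (rcons (rcons rho p.+2) p) (rcons (rcons env (n - i.+1)) (A (n - i.+1))) p.+3.
      apply: holds_env_rcons => //; last by lia.
      apply: holds_env_rcons => //; last by lia.
      by apply: holds_env_frame henv _ f; lia.
    have [s4 [r4 m4 g4 f4]] := IHb _ lti _ _ _ ms' henv'.
    have le4 := evals_le bm (holds_env_all henv') (evb _ lti).
    have [] := @runs_copy s4 p p.+3; rewrite ?g4 //; first by rewrite neq_ltn; lia.
    move=> s5 [r5 m5 g5].
    set s6 := set_reg s5 p.+3 1.
    have g6 q : reg s6 q = if q == p.+3 then 1 else reg s5 q by [].
    set s7 := set_reg s6 p.+2 (op_sem Add (reg s6 p.+2) (reg s6 p.+3)).
    have g7 q : reg s7 q = if q == p.+2 then reg s6 p.+2 + reg s6 p.+3 else reg s6 q by [].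
    set s8 := set_reg s7 p.+1 (op_sem Defs.Sub (reg s7 p.+1) (reg s7 p.+3)).
    have g8 q : reg s8 q = if q == p.+1 then reg s7 p.+1 - reg s7 p.+3 else reg s7 q by [].
    have v2 : reg s5 p.+2 = n - i.+1 by rewrite g5 (f4 p.+2) // e2; case: eqP => //; lia.
    have v1 : reg s5 p.+1 = i.+1 by rewrite g5 (f4 p.+1) // e1; case: eqP => //; lia.
    have eqf a b : a < b -> (a == b) = false by lia.
    have eqf' a b : a < b -> (b == a) = false by lia.
    have w2 : reg s8 p.+2 = n - i.
      rewrite g8 eqf' // g7 eqxx g6 g6 eqxx v2 eqf //; lia.
    have w1 : reg s8 p.+1 = i.
      by rewrite g8 eqxx !g7 !g6 !eqxx eqf // eqf // eqf' // v1 subn1.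
    have w0 : reg s8 p = A (n - i).
      by rewrite g8 eqf // g7 eqf // g6 eqf; [rewrite g5 eqxx subnSK|lia].
    have w q : q < p -> reg s8 q = reg s q.
      move=> qp; rewrite g8 eqf; last by lia.
      rewrite g7 eqf; last by lia.
      rewrite g6 eqf; last by lia.
      by rewrite g5 eqf // f4 ?f //; lia.
    have ms8 : smem s8 = m by rewrite /s8 /s7 /s6 /= m5 m4.
    have le8 : A (n - i) <= M by rewrite -subnSK.
    have [s9 [r9 m9 g9 f9]] := IH (ltnW lei) s8 ms8 w1 w2 w0 le8 w.
    exists s9; split=> //.
    apply: (@runs_le _ _ (1 + (ecost X body + (2 + (1 + (1 + 1)))) + (i * (ecost X body + 6) + 1))).
      by rewrite mulSn; lia.
    apply: runs_while_true r9; rewrite ?e1 //; first by lia.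
    apply: runs_seq r4 _; apply: runs_seq r5 _.
    apply: (@runs_seq _ _ _ s6); first exact: runs_const.
    apply: (@runs_seq _ _ _ s7).
      by apply: runs_op; rewrite !g6 ?eqxx // eqf // v2; lia.
    apply: runs_op; first by rewrite g7 eqf // g6 eqf // v1; lia.
    by rewrite g7 eqf' // g6 eqxx.
  have ms3 : smem s3 = m by rewrite /s3 /= m2 m1.
  have g3 q : reg s3 q = if q == p.+2 then 0 else reg s2 q by [].
  have [||||q qp|s4 [r4 m4 g4 f4]] := loop n (leqnn n) s3 ms3.
  + by rewrite g3; case: eqP => //; lia.
  + by rewrite g3 eqxx subnn.
  + by rewrite g3 subnn f2 // g1; case: eqP => //; lia.
  + by rewrite subnn.
  + by rewrite g3 f2 1?ltnW // f1 //; case: eqP => //; lia.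
  exists s4; split=> //; last by rewrite m4.
  apply: (@runs_le _ _ (ecost X e0 + (ecost X en + (1 + (n * (ecost X body + 6) + 1))))).
    have : n * (ecost X body + 6) <= X * (ecost X body + 6) by rewrite leq_mul2r nX orbT.
    lia.
  apply: runs_seq r1 _; apply: runs_seq r2 _; apply: runs_seq _ r4; exact: runs_const.
- move=> env n args body vs v sz eva IHa evb IHb rho p s ms henv /=.
  have les i : i < n -> nth 0 vs i <= M.
    by move=> hi; apply: evals_le bm (holds_env_all henv) (eva _ hi).
  have [s1 [r1 m1 g1 f1]] : exists s1,
     [/\ runs (foldr (fun i q => Seq (ecomp (args i) rho (p.+1 + i)) q) Skip (iota 0 n)) s
           (foldr (fun i c => ecost X (args i) + c) 1 (iota 0 n)) s1,
         smem s1 = smem s, (forall i, i < n -> reg s1 (p.+1 + i) = nth 0 vs i)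
       & forall q, q < p.+1 -> reg s1 q = reg s q].
    (* [i] arguments are already in place and [j] remain. All are evaluated in the caller's
       registers [rho], each above the results of the previous ones. *)
    suff gen j i s0 : i + j = n -> smem s0 = smem s -> (forall i', i' < i -> reg s0 (p.+1 + i') = nth 0 vs i') ->
       (forall q, q < p.+1 -> reg s0 q = reg s q) -> exists s1,
     [/\ runs (foldr (fun i q => Seq (ecomp (args i) rho (p.+1 + i)) q) Skip (iota i j)) s0
           (foldr (fun i c => ecost X (args i) + c) 1 (iota i j)) s1,
         smem s1 = smem s, (forall i, i < n -> reg s1 (p.+1 + i) = nth 0 vs i)
       & forall q, q < p.+1 -> reg s1 q = reg s q].
      by apply: gen.
    elim: j i s0 => [|j IH] i s0 eij m0 g0 f0 /=.
      exists s0; split=> //; first exact: runs_skip.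
      by move: g0; rewrite -eij addn0.
    have hi : i < n by lia.
    have henv0 : holds_env s0 rho env (p.+1 + i).
      apply: holds_env_frame henv _ _ => [|q qp]; first by lia.
      by apply: f0; lia.
    have [s2 [r2 m2 g2 f2]] := IHa _ hi rho (p.+1 + i) s0 (etrans m0 ms) henv0.
    have [|||q qp|s3 [r3 m3 g3 f3]] := IH i.+1 s2.
    + lia.
    + by rewrite m2.
    + move=> i'; rewrite ltnS leq_eqVlt => /orP[/eqP->|lt] //.
      by rewrite f2 ?g0 // ltn_add2l.
    + by rewrite f2 ?f0 //; lia.
    by exists s3; split=> //; apply: runs_seq r2 r3.
  have henv1 : holds_env s1 (iota p.+1 n) vs (p.+1 + n).
    split; first by rewrite size_iota sz.
    move=> i; rewrite sz => hi; rewrite nth_iota // g1 //; split=> //; [lia|exact: les].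
  have [s2 [r2 m2 g2 f2]] := IHb _ _ _ (etrans m1 ms) henv1.
  have le2 := evals_le bm (holds_env_all henv1) evb.
  have [] := @runs_copy s2 p (p.+1 + n); rewrite ?g2 //; first by rewrite neq_ltn; lia.
  move=> s3 [r3 m3 g3]; exists s3; split.
  + rewrite -addnA; apply: runs_seq r1 _; exact: runs_seq r2 _.
  + by rewrite m3 m2 m1.
  + by rewrite g3 eqxx.
  + move=> q qp; rewrite g3; case: eqP qp => [->|_ qp]; first by rewrite ltnn.
    by rewrite f2 ?f1 //; lia.
Qed.

(* Total correctness of a command in environment [env], with at most [C]
   instructions. *)
Definition hoare (env : seq nat) (P : (nat -> nat) -> Prop) (c : cmd) (C : nat)
    (Q : (nat -> nat) -> Prop) : Prop :=
  forall rho p s, holds_env s rho env p -> bounded (smem s) -> P (smem s) ->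
  exists s', [/\ runs (ccomp c rho p) s C s', bounded (smem s'), Q (smem s') &
    forall q, q < p -> reg s' q = reg s q].

Lemma hoare_skip env (P Q : (nat -> nat) -> Prop) :
  (forall m, bounded m -> P m -> Q m) -> hoare env P CSkip 1 Q.
Proof. by move=> h rho p s he bm pm; exists s; split=> //; [exact: runs_skip|exact: h]. Qed.

Lemma hoare_conseq env (P P' Q Q' : (nat -> nat) -> Prop) c C C' :
  hoare env P' c C' Q' -> C' <= C ->
  (forall m, bounded m -> all (geq M) env -> P m -> P' m) ->
  (forall m, bounded m -> Q' m -> Q m) ->
  hoare env P c C Q.
Proof.
move=> h hC hP hQ rho p s he bm pm.
have [s' [r b q f]] := h _ _ _ he bm (hP _ bm (holds_env_all he) pm).
by exists s'; split=> //; [exact: runs_le r|exact: hQ].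
Qed.

(** Fixing the initial memory [m] lets later assertions mention it; this replaces ghost
    variables. *)
Lemma hoare_pre env (P Q : (nat -> nat) -> Prop) c C :
  (forall m, bounded m -> all (geq M) env -> P m -> hoare env (eq m) c C Q) ->
  hoare env P c C Q.
Proof.
by move=> h rho p s he bm pm; exact: (h _ bm (holds_env_all he) pm _ _ _ he bm erefl).
Qed.

Lemma hoare_store env (P Q : (nat -> nat) -> Prop) ea ev :
  (forall m, bounded m -> P m -> exists a v,
     [/\ evals M X m env ea a, evals M X m env ev v & Q (upd m a v)]) ->
  hoare env P (CStore ea ev) (ecost X ea + ecost X ev + 1) Q.
Proof.
move=> h rho p s he bm pm; have [a [v [e1 e2 q]]] := h _ bm pm.
have le1 := evals_le bm (holds_env_all he) e1.
have le2 := evals_le bm (holds_env_all he) e2.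
have [s1 [r1 m1 g1 f1]] := ecomp_runs bm e1 erefl he.
have he1 := holds_env_frame he (leqnSn p) f1.
have [s2 [r2 m2 g2 f2]] := ecomp_runs bm e2 m1 he1.
have g1' : reg s2 p = a by rewrite f2.
exists (set_mem s2 (reg s2 p) (reg s2 p.+1)); split.
- rewrite -addnA /=; apply: runs_seq r1 _; apply: runs_seq r2 _.
  by apply: runs_write; rewrite ?g1' ?g2.
- by move=> b; rewrite /= updE; case: eqP; rewrite ?g2 // m2 m1.
- by rewrite /= g1' g2 m2 m1.
- by move=> q' hq; rewrite /= f2 ?f1 // ltnW // ltnS.
Qed.

Lemma hoare_seq env P R Q c1 c2 C1 C2 :
  hoare env P c1 C1 R -> hoare env R c2 C2 Q -> hoare env P (CSeq c1 c2) (C1 + C2) Q.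
Proof.
move=> h1 h2 rho p s he bm pm.
have [s1 [r1 b1 q1 f1]] := h1 _ _ _ he bm pm.
have [s2 [r2 b2 q2 f2]] := h2 _ _ _ (holds_env_frame he (leqnn p) f1) b1 q1.
by exists s2; split=> // [|q qp]; [exact: runs_seq r1 r2|rewrite f2 ?f1].
Qed.

Lemma hoare_let env (P Q : (nat -> nat) -> Prop) e c C v :
  (forall m, bounded m -> P m -> evals M X m env e v) ->
  hoare (rcons env v) P c C Q -> hoare env P (CLet e c) (ecost X e + C) Q.
Proof.
move=> h h2 rho p s he bm pm; have e1 := h _ bm pm.
have le1 := evals_le bm (holds_env_all he) e1.
have [s1 [r1 m1 g1 f1]] := ecomp_runs bm e1 erefl he.
have he1 := holds_env_rcons (holds_env_frame he (leqnSn p) f1) (leqnn p.+1) g1 le1.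
rewrite -m1 in bm pm.
have [s2 [r2 b2 q2 f2]] := h2 _ _ _ he1 bm pm.
by exists s2; split=> // [|q qp]; [exact: runs_seq r1 r2|rewrite f2 ?f1 // ltnW].
Qed.

Lemma hoare_if env (P Q : (nat -> nat) -> Prop) (v : (nat -> nat) -> nat) e c C :
  (forall m, bounded m -> P m -> evals M X m env e (v m)) ->
  (forall m, bounded m -> P m -> v m = 0 -> Q m) ->
  hoare env (fun m => P m /\ v m != 0) c C Q ->
  hoare env P (CIf e c) (ecost X e + (C + 2)) Q.
Proof.
move=> h v0 h2 rho p s he bm pm; have e1 := h _ bm pm.
have le1 := evals_le bm (holds_env_all he) e1.
have [s1 [r1 m1 g1 f1]] := ecomp_runs bm e1 erefl he.
have [vz|vn] := eqVneq (v (smem s)) 0.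
  exists s1; split=> //; rewrite ?m1 //; last exact: v0.
  apply: runs_seq r1 _; rewrite -[2]/(1 + 1) addnA.
  apply: (@runs_le _ _ (1 + 1)); first lia.
  by apply: runs_if_false; rewrite ?g1 //; exact: runs_skip.
have he1 := holds_env_frame he (leqnSn p) f1.
rewrite -m1 in bm.
have [|s2 [r2 b2 q2 f2]] := h2 _ _ _ he1 bm; first by rewrite m1.
exists s2; split=> // [|q qp]; last by rewrite f2 ?f1 // ltnW.
apply: runs_seq r1 _; apply: (@runs_le _ _ (C + 1)); first lia.
by apply: runs_if_true; rewrite ?g1.
Qed.

(** The cost of the body may depend on the index, because visiting a vertex costs its degree and
    only the sum over a whole pass is small. *)
Lemma hoare_for env (I : nat -> (nat -> nat) -> Prop) en c n (C : nat -> nat) :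
  (forall m, bounded m -> I 0 m -> evals M X m env en n) ->
  (forall i, i < n -> hoare (rcons env i) (I i) c (C i) (I i.+1)) ->
  hoare env (I 0) (CFor en c) (ecost X en + 2 + \sum_(i < n) (C i + 4)) (I n).
Proof.
move=> h h2 rho p s he bm pm; have e1 := h _ bm pm.
have len := evals_le bm (holds_env_all he) e1.
have [s1 [r1 m1 g1 f1]] := ecomp_runs bm e1 erefl he.
set s2 := set_reg s1 p.+1 0.
have g2 q : reg s2 q = if q == p.+1 then 0 else reg s1 q by [].
rewrite /=; set W := While _ _.
have eqf a b : a < b -> (a == b) = false by lia.
have eqf' a b : a < b -> (b == a) = false by lia.
have loop j : forall i s', i + j = n -> bounded (smem s') -> I i (smem s') ->
    reg s' p = j -> reg s' p.+1 = i -> (forall q, q < p -> reg s' q = reg s q) ->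
    exists s'', [/\ runs W s' (\sum_(i <= i' < n) (C i' + 4) + 1) s'', bounded (smem s''),
      I n (smem s'') & forall q, q < p -> reg s'' q = reg s q].
  elim: j => [|j IH] i s' eij bs' Is' e1' e2' f'.
    exists s'; split=> //; last by rewrite -eij addn0.
    by apply: (@runs_le _ _ 1); [lia|exact: runs_while_false].
  have hi : i < n by lia.
  have he' : holds_env s' (rcons rho p.+1) (rcons env i) p.+2.
    apply: holds_env_rcons => //; last by lia.
    by apply: holds_env_frame he _ f'; lia.
  have [s3 [r3 b3 q3 f3]] := h2 _ hi _ _ _ he' bs' Is'.
  set s4 := set_reg s3 p.+2 1.
  have g4 q : reg s4 q = if q == p.+2 then 1 else reg s3 q by [].
  set s5 := set_reg s4 p.+1 (op_sem Add (reg s4 p.+1) (reg s4 p.+2)).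
  have g5 q : reg s5 q = if q == p.+1 then reg s4 p.+1 + reg s4 p.+2 else reg s4 q by [].
  set s6 := set_reg s5 p (op_sem Defs.Sub (reg s5 p) (reg s5 p.+2)).
  have g6 q : reg s6 q = if q == p then reg s5 p - reg s5 p.+2 else reg s5 q by [].
  have v1 : reg s3 p.+1 = i by rewrite f3.
  have v0 : reg s3 p = j.+1 by rewrite f3 // ltnW.
  have w0 : reg s6 p = j.
    by rewrite g6 eqxx !g5 !g4 eqxx eqf // eqf // eqf' // v0 subn1.
  have w1 : reg s6 p.+1 = i.+1.
    by rewrite g6 eqf' // g5 eqxx !g4 eqxx eqf // v1 addn1.
  have w q : q < p -> reg s6 q = reg s q.
    move=> qp; rewrite g6 eqf // g5 eqf; last by lia.
    by rewrite g4 eqf ?f3 ?f' //; lia.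
  have eij' : i.+1 + j = n by lia.
  have [s7 [r7 b7 q7 f7]] := IH i.+1 s6 eij' b3 q3 w0 w1 w.
  exists s7; split=> //.
  apply: (@runs_le _ _ (1 + (C i + (1 + (1 + 1))) + (\sum_(i.+1 <= i' < n) (C i' + 4) + 1))).
    by rewrite [in X in _ <= X]big_ltn //; lia.
  apply: runs_while_true r7; rewrite ?e1' //; first by lia.
  apply: runs_seq r3 _; apply: (@runs_seq _ _ _ s4); first exact: runs_const.
  apply: (@runs_seq _ _ _ s5).
    by apply: runs_op; rewrite !g4 ?eqxx // eqf // v1; lia.
  apply: runs_op; first by rewrite g5 eqf // g4 eqf // v0; lia.
  by rewrite g5 eqf' // g4 eqxx.
have b2 : bounded (smem s2) by rewrite /= m1.
have i2 : I 0 (smem s2) by rewrite /= m1.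
have v0 : reg s2 p = n by rewrite g2 eqf.
have v1 : reg s2 p.+1 = 0 by rewrite g2 eqxx.
have f2 q : q < p -> reg s2 q = reg s q.
  by move=> qp; rewrite g2 eqf ?f1 //; lia.
have [s3 [r3 b3 q3 f3]] := loop n 0 s2 (add0n n) b2 i2 v0 v1 f2.
exists s3; split=> //; rewrite -addnA; apply: runs_seq r1 _.
apply: (@runs_le _ _ (1 + (\sum_(0 <= i' < n) (C i' + 4) + 1))).
  by rewrite big_mkord addnA addnC addnA.
by apply: runs_seq r3; apply: runs_const.
Qed.

End Compiler.

Definition whole (c : cmd) (e : expr) : prog := Seq (ccomp c [::] 0) (ecomp e [::] 0).

Lemma whole_computes (M X : nat) (c : cmd) (e : expr) (C v : nat) (input : seq nat)
    (Q : (nat -> nat) -> Prop) :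
  0 < M -> (forall a, nth 0 input a <= M) ->
  hoare M [::] (eq (nth 0 input)) c C Q ->
  (forall m, bounded M m -> Q m -> evals M X m [::] e v) ->
  computes_within (whole c e) input v ((C + ecost X e) * unit_cost M).
Proof.
move=> M0 bi h he.
have h0 s : holds_env M s [::] [::] 0 by split.
have [s1 [r1 b1 q1 _]] := h [::] 0 (init input) (h0 _) bi erefl.
have ev := he _ b1 q1.
have [s2 [r2 _ g2 _]] := ecomp_runs M0 b1 ev erefl (h0 s1).
by have [t ht e'] := runs_seq r1 r2; exists t => //; exists s2.
Qed.

(** * Positional notation *)

Definition digit (B c v : nat) : nat := c %/ B ^ v %% B.

Lemma digit_lt B c v : 0 < B -> digit B c v < B.
Proof. by move=> h; rewrite ltn_mod. Qed.

Lemma digit0 B v : digit B 0 v = 0.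
Proof. by rewrite /digit div0n mod0n. Qed.

(** The digit at place [v] is zero, so adding [x < B] there causes no carry. All codes below are
    built by filling empty places in this way. *)
Lemma digit_set B c v x w : 0 < B -> x < B -> digit B c v = 0 ->
  digit B (c + B ^ v * x) w = if w == v then x else digit B c w.
Proof.
move=> B0 xB; rewrite /digit => /eqP/dvdnP[h eh].
have p0 e : 0 < B ^ e by rewrite expn_gt0 B0.
have [wv|vw|->] := ltngtP w v.
- rewrite -(subnKC (ltnW wv)) expnD -mulnA addnC [B ^ w * _]mulnC divnMDl //.
  by rewrite -(subnSK wv) expnS -mulnA -modnDml modnMr add0n.
- rewrite -(subnKC (ltnW vw)) expnD !divnMA addnC [B ^ v * _]mulnC divnMDl // eh.
  rewrite -(subnSK vw) expnS !divnMA addnC mulnK // divnMDl //.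
  by rewrite (divn_small xB) addn0.
- by rewrite addnC [B ^ v * _]mulnC divnMDl // eh addnC -modnDml modnMl add0n modn_small.
Qed.

Lemma digit_set_lt B k c v x : 0 < B -> x < B -> digit B c v = 0 ->
  v < k -> c < B ^ k -> c + B ^ v * x < B ^ k.
Proof.
move=> B0 xB; rewrite /digit => /eqP/dvdnP[h eh] vk ck.
have p0 e : 0 < B ^ e by rewrite expn_gt0 B0.
have ek : B ^ k = B ^ v * (B * B ^ (k - v.+1)).
  by rewrite -expnS -expnD; congr (_ ^ _); lia.
have hlt : h < B ^ (k - v.+1).
  rewrite -(ltn_pmul2r B0) -eh ltn_divLR //.
  by rewrite ek in ck; move: ck; rewrite mulnC [_ * B]mulnC.
have elt : c < B ^ v * (h * B).+1.
  by rewrite -eh mulnC -ltn_divLR.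
rewrite ek.
have : B ^ v * (h * B + B) <= B ^ v * (B * B ^ (k - v.+1)).
  by rewrite leq_mul2l -mulSnr mulnC leq_mul2l hlt !orbT.
have : B ^ v * (h * B).+1 + B ^ v * x <= B ^ v * (h * B + B).
  by rewrite -mulnDr leq_mul2l; apply/orP; right; lia.
lia.
Qed.

Lemma digitS B c v : digit B c v.+1 = digit B (c %/ B) v.
Proof. by rewrite /digit expnS divnMA. Qed.

Lemma digit_inj B k c c' : 0 < B -> c < B ^ k -> c' < B ^ k ->
  (forall v, v < k -> digit B c v = digit B c' v) -> c = c'.
Proof.
move=> B0; elim: k c c' => [|k IH] c c'; first by rewrite expn0; lia.
rewrite expnS mulnC -ltn_divLR // -(ltn_divLR _ _ B0) => h h' e.
rewrite (divn_eq c B) (divn_eq c' B); congr (_ * _ + _).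
  by apply: IH => // v vk; rewrite -!digitS e.
by have := e 0 isT; rewrite /digit expn0 !divn1.
Qed.

Lemma digit_exists B k (g : nat -> nat) : (forall v, v < k -> g v < B) ->
  exists2 c, c < B ^ k & forall v, v < k -> digit B c v = g v.
Proof.
elim: k g => [|k IH] g h; first by exists 0.
have [|c ck e] := IH (fun v => g v.+1); first by move=> v vk; apply: h.
have h0 := h 0 isT; have B0 : 0 < B by lia.
exists (c * B + g 0).
  by rewrite expnS [B * _]mulnC -ltn_divLR // divnMDl // divn_small // addn0.
case=> [|v] vk; first by rewrite /digit expn0 divn1 addnC -modnDmr modnMl addn0 modn_small.
by rewrite digitS divnMDl // divn_small // addn0 e.
Qed.

(** * Basic functions *)

Definition ecall (body : expr) (args : seq expr) : expr :=
  ECall (size args) (nth (ENum 0) args) body.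

Inductive evals_seq (M X : nat) (m : nat -> nat) (env : seq nat) :
    seq expr -> seq nat -> Prop :=
  | EvNil : evals_seq M X m env [::] [::]
  | EvCons e s v vs : evals M X m env e v -> evals_seq M X m env s vs ->
      evals_seq M X m env (e :: s) (v :: vs).

Lemma ev_call M X m env body args vs v :
  evals_seq M X m env args vs -> evals M X m vs body v ->
  evals M X m env (ecall body args) v.
Proof.
move=> h; apply: EvCall; first by elim: h => //= *; congr _.+1.
elim: h => // e s v' vs' h1 _ IH [|i] //=; exact: IH.
Qed.

Lemma ev_cond M X m env e e1 e2 v v1 v2 :
  evals M X m env e v -> (v != 0 -> evals M X m env e1 v1) ->
  (v = 0 -> evals M X m env e2 v2) ->
  evals M X m env (ECond e e1 e2) (if v != 0 then v1 else v2).
Proof.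
move=> h h1 h2; apply: (EvCond h) => hv; first by rewrite hv; apply: h1.
by rewrite hv; apply: h2.
Qed.

Lemma ev_iter M X m env en e0 body n F v0 :
  evals M X m env en n -> n <= X -> evals M X m env e0 v0 ->
  (forall i, i < n -> evals M X m (rcons (rcons env i) (iteri i F v0)) body
     (F i (iteri i F v0))) ->
  evals M X m env (EIter en e0 body) (iteri n F v0).
Proof.
by move=> h1 h2 h3 h4; exact: (EvIter (A := fun i => iteri i F v0) h1 h2 h3 h4).
Qed.

Lemma ev_eq M X m env e v v' : evals M X m env e v -> v = v' -> evals M X m env e v'.
Proof. by move=> h <-. Qed.

(* Hook for the specifications of called functions. *)
Ltac ev_spec := idtac.

Ltac ev :=
  lazymatch goal with
  | |- evals_seq _ _ _ _ [::] _ => apply: EvNil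
  | |- evals_seq _ _ _ _ (_ :: _) _ => eapply EvCons; [ev | ev]
  | |- evals _ _ _ _ (EVar _) _ => apply: EvVar
  | |- evals _ _ _ _ (ENum _) _ => apply: EvNum; try lia
  | |- evals _ _ _ _ (EBin _ _ _) _ =>
      eapply EvBin; [ev | ev | try exact: isT; rewrite /op_bounded /=; try lia]
  | |- evals _ _ _ _ (EGet _) _ => eapply EvGet; ev
  | |- evals _ _ _ _ (ELet _ _) _ => eapply EvLet; [ev | rewrite /=; ev]
  | |- evals _ _ _ _ (ECond _ _ _) _ =>
      eapply ev_cond; [ev | let h := fresh "cnd" in move=> /= h; ev
                          | let h := fresh "cnd" in move=> /= h; ev]
  | |- evals _ _ _ _ (ecall _ _) _ =>
      eapply ev_call; [ev | rewrite /=; ev_spec; rewrite /=; try lia]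
  | |- _ => idtac
  end.

Definition e_eq : expr :=
  ECond (EBin Defs.Sub (EVar 0) (EVar 1)) (ENum 0)
    (ECond (EBin Defs.Sub (EVar 1) (EVar 0)) (ENum 0) (ENum 1)).
Definition e_lt : expr := ECond (EBin Defs.Sub (EVar 1) (EVar 0)) (ENum 1) (ENum 0).
Definition e_mod : expr :=
  EBin Defs.Sub (EVar 0) (EBin Mul (EBin Div (EVar 0) (EVar 1)) (EVar 1)).
Definition e_pow : expr := EIter (EVar 1) (ENum 1) (EBin Mul (EVar 3) (EVar 0)).
Definition e_digit : expr :=
  ecall e_mod [:: EBin Div (EVar 1) (ecall e_pow [:: EVar 0; EVar 2]); EVar 0].

Section Basic.

Variables (M X : nat) (m : nat -> nat).
Hypothesis M_ge : 256 <= M.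

Lemma evals_eqn a b : evals M X m [:: a; b] e_eq (a == b).
Proof. by rewrite /e_eq; eapply ev_eq; [ev|rewrite /=; do ![case: eqP => /=]; lia]. Qed.

Lemma evals_ltn a b : evals M X m [:: a; b] e_lt (a < b).
Proof. by rewrite /e_lt; eapply ev_eq; [ev|rewrite /=; do ![case: eqP => /=]; lia]. Qed.

Lemma evals_mod a b : a <= M -> evals M X m [:: a; b] e_mod (a %% b).
Proof.
move=> aM; rewrite /e_mod; eapply ev_eq; [ev; apply: leq_trans (leq_trunc_div _ _) aM|].
by rewrite /= [in X in X - _](divn_eq a b) addKn.
Qed.

Lemma evals_pow a b : a ^ b <= M -> b <= X -> evals M X m [:: a; b] e_pow (a ^ b).
Proof.
move=> ab bX; have e i : iteri i (fun _ acc => acc * a) 1 = a ^ i.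
  by elim: i => //= i ->; rewrite expnSr.
rewrite -e; apply: ev_iter => //; [by ev|by ev|].
move=> i hi; ev; rewrite e -expnSr; apply: leq_trans ab.
by case: (posnP a) => [->|a0]; [rewrite exp0n; lia|rewrite leq_pexp2l].
Qed.

Lemma evals_digit B c v : B ^ v <= M -> c <= M -> v <= X ->
  evals M X m [:: B; c; v] e_digit (digit B c v).
Proof.
move=> BM cM vX; rewrite /e_digit.
apply: (ev_call (vs := [:: c %/ B ^ v; B])); last first.
  exact: evals_mod (leq_trans (leq_div _ _) cM).
by ev; apply: evals_pow.
Qed.

End Basic.

(** * Splitting a constraint graph into two halves *)

Lemma iteri_foldl (T : Type) (f : nat -> T -> T) (a : T) n :
  iteri n f a = foldl (fun acc i => f i acc) a (iota 0 n).
Proof. by elim: n => // n IH; rewrite -[in RHS]addn1 iotaD foldl_cat -IH. Qed.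

Lemma iteri_count (p : pred nat) n :
  iteri n (fun i acc => if p i then acc.+1 else acc) 0 = count p (iota 0 n).
Proof.
elim: n => // n IH; rewrite [LHS]/= IH -[in RHS]addn1 iotaD count_cat /= addn0.
by case: (p n); rewrite ?addn1 ?addn0.
Qed.

Lemma iteri_has (p : pred nat) n :
  iteri n (fun i acc => if p i then 1 else acc) 0 = has p (iota 0 n).
Proof.
elim: n => // n IH; rewrite [LHS]/= IH -[in RHS]addn1 iotaD has_cat /= orbF.
by case: (p n); rewrite ?orbT ?orbF.
Qed.

(** A search in which 0 means failure and [u.+1] a hit at [u], the form of an option that fits into
    a register. *)
Lemma iteri_last (p : pred nat) n (r := iteri n (fun i acc => if p i then i.+1 else acc) 0) :
  if r is u.+1 then u < n /\ p u else forall u, u < n -> ~~ p u.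
Proof.
rewrite {}/r; elim: n => // n; rewrite [iteri n.+1 _ _]/=.
case: ifP => [pn _|pn]; first by split.
case: (iteri n _ _) => [h u|u [h1 h2]]; last by split=> //; apply: ltnW.
by rewrite ltnS leq_eqVlt => /orP[/eqP->|/h//]; rewrite pn.
Qed.

Section Plan.

Variables (k n : nat) (arc : nat -> nat -> bool).
Hypothesis arc_irr : forall v, arc v v = false.

(* A vertex is deleted when a vertex remaining at that time, possibly deleted
   later, has an arc to it. *)
Definition del_step (v acc : nat) : nat :=
  if has (fun u => (digit 2 acc u == 0) && arc u v) (iota 0 k) then acc + 2 ^ v else acc.
Definition deleted : nat := iteri k del_step 0.

Lemma deleted_inv i : i <= k ->
  iteri i del_step 0 < 2 ^ k /\ forall v, i <= v -> digit 2 (iteri i del_step 0) v = 0.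
Proof.
elim: i => [|i IH] ik; first by split=> [|v _]; rewrite ?expn_gt0 ?digit0.
have [h1 h2] := IH (ltnW ik); rewrite [iteri i.+1 _ _]/= {1 3}/del_step.
case: ifP => _; last by split=> // v /ltnW; apply: h2.
rewrite -[2 ^ i]muln1; split=> [|v iv]; first by apply: digit_set_lt => //; exact: h2.
rewrite digit_set ?(h2 i) //; case: eqP => [e|_]; last exact: h2 (ltnW iv).
by rewrite e ltnn in iv.
Qed.

Lemma deleted_stable i j v : i <= j -> j <= k -> v < i ->
  digit 2 (iteri j del_step 0) v = digit 2 (iteri i del_step 0) v.
Proof.
move=> ij jk vi; rewrite -(subnKC ij) in jk *.
elim: (j - i) jk => [|e IH]; rewrite ?addn0 // addnS => jk.
rewrite [iteri _.+1 _ _]/= {1}/del_step -(IH (ltnW jk)); case: ifP => // _.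
have [_ h] := deleted_inv (ltnW jk).
rewrite -[2 ^ _]muln1 digit_set // ?(h _ (leqnn _)) //; case: eqP => // e'; lia.
Qed.

Lemma deleted_step v : v < k ->
  (digit 2 deleted v != 0) =
  has (fun u => (digit 2 (iteri v del_step 0) u == 0) && arc u v) (iota 0 k).
Proof.
move=> vk; rewrite /deleted (@deleted_stable v.+1 k) // [iteri _.+1 _ _]/= {1}/del_step.
have [_ h] := deleted_inv (ltnW vk).
by case: ifP => _; rewrite ?h // -[2 ^ _]muln1 digit_set // ?h ?eqxx.
Qed.

(** When [v] is processed, [u] counts as remaining: for [u < v] its bit is already final, for
    [u >= v] it is not yet set. An arc from [u] would therefore have deleted [v]. *)
Lemma remaining_indep u v : u < k -> v < k -> digit 2 deleted u = 0 ->
  digit 2 deleted v = 0 -> ~~ arc u v.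
Proof.
move=> uk vk du dv; apply/negP => a; move/eqP: dv; apply/negP.
rewrite deleted_step //; apply/hasP; exists u; rewrite ?mem_iota // a andbT.
have [uv|vu] := ltnP u v.
  by rewrite -(@deleted_stable v k u) ?du // ltnW.
by have [_ ->] := deleted_inv (ltnW vk).
Qed.

(** The vertex [u] remained when [v] was processed: either its own turn had passed and it was kept
    for good, or its turn was still to come and [v < u]. *)
Lemma deleted_parent v : v < k -> digit 2 deleted v != 0 ->
  exists u, [/\ u < k, arc u v & (v < u) || (digit 2 deleted u == 0)].
Proof.
move=> vk; rewrite deleted_step // => /hasP[u]; rewrite mem_iota => /= uk /andP[du a].
exists u; split=> //; case: ltngtP => //= [uv|e]; last by rewrite e arc_irr in a.
by rewrite /deleted (@deleted_stable v k u) ?du // ltnW.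
Qed.

Definition rank (v : nat) : nat := count (fun u => digit 2 deleted u == 0) (iota 0 v).

Lemma rank_mono u v : u < v -> digit 2 deleted u = 0 -> rank u < rank v.
Proof.
move=> uv du; rewrite /rank -(subnKC (ltnW uv)) iotaD count_cat -addn1 leq_add2l.
by rewrite -(subnSK uv) /= du eqxx.
Qed.

(** Roots alternate between the sides by the parity of their rank, so the sides are balanced and
    [rank v %/ 2] numbers the roots of one side consecutively. *)
Definition is_root (side v : nat) : bool :=
  (digit 2 deleted v == 0) && (rank v %% 2 == side).

Lemma is_root_inj side u v : is_root side u -> is_root side v ->
  rank u %/ 2 = rank v %/ 2 -> u = v.
Proof.
move=> /andP[/eqP du /eqP ru] /andP[/eqP dv /eqP rv] e.
have {}e : rank u = rank v by rewrite (divn_eq (rank u) 2) (divn_eq (rank v) 2) e ru rv.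
have [uv|vu|//] := ltngtP u v.
  by have := rank_mono uv du; rewrite e ltnn.
by have := rank_mono vu dv; rewrite e ltnn.
Qed.

Let N := n.+1.

(* Partial maps to [0..n-1] are coded in base [n+1]; digit 0 means undefined. *)
Definition init_step (side : nat) (alpha : nat -> nat) (v acc : nat) : nat :=
  if is_root side v then acc + N ^ v * (alpha (rank v %/ 2)).+1 else acc.
Definition init_code (side : nat) (alpha : nat -> nat) : nat :=
  iteri k (init_step side alpha) 0.

Definition parent (c v : nat) : nat :=
  iteri k (fun u acc => if (digit N c u != 0) && arc u v then u.+1 else acc) 0.

(** [nb x j] is the [j]-th candidate for the image of a vertex whose parent is sent to [x], and
    [beta v] is the choice made at [v]. A vertex without a defined parent stays undefined. *)
Definition sweep_step (nb : nat -> nat -> nat) (beta : nat -> nat) (c v : nat) : nat :=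
  if digit N c v != 0 then c
  else if parent c v is u.+1 then c + N ^ v * (nb (digit N c u).-1 (beta v)).+1 else c.

Definition sweep_order : seq nat := [seq k.-1 - t | t <- iota 0 k].
Definition sweep nb beta c := foldl (sweep_step nb beta) c sweep_order.
(** One sweep already reaches every vertex from some side. The second one adds the heads of all arcs
    leaving the vertices reached, so that both ends of each arc are defined on a common side. *)
Definition gen nb side alpha beta := sweep nb beta (sweep nb beta (init_code side alpha)).

Lemma mem_sweep_order v : (v \in sweep_order) = (v < k).
Proof.
apply/mapP/idP => [[t]|vk]; first by rewrite mem_iota => /= tk ->; lia.
by exists (k.-1 - v); [rewrite mem_iota|]; lia.
Qed.

Lemma init_inv side alpha i : (forall j, alpha j < n) -> i <= k ->
  iteri i (init_step side alpha) 0 < N ^ k /\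
  forall v, digit N (iteri i (init_step side alpha) 0) v =
    if (v < i) && is_root side v then (alpha (rank v %/ 2)).+1 else 0.
Proof.
move=> ha; elim: i => [|i IH] ik; first by split=> [|v]; rewrite ?expn_gt0 ?digit0.
have [h1 h2] := IH (ltnW ik); rewrite [iteri i.+1 _ _]/= {1 3}/init_step.
have z : digit N (iteri i (init_step side alpha) 0) i = 0 by rewrite h2 ltnn.
have e v : (v < i.+1) = (v == i) || (v < i) by rewrite ltnS leq_eqVlt.
case: ifP => ri; last first.
  split=> // v; rewrite h2 e; case: eqP => [->|//].
  by rewrite ltnn ri.
split=> [|v]; first by apply: digit_set_lt => //; exact: ha.
rewrite digit_set //; last exact: ha.
by rewrite h2 e; case: eqP => [->|//]; rewrite ri.
Qed.

Lemma init_good side alpha : (forall j, alpha j < n) -> init_code side alpha < N ^ k.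
Proof. by move=> h; have [] := init_inv side h (leqnn k). Qed.

Lemma digit_init side alpha v : (forall j, alpha j < n) -> v < k ->
  digit N (init_code side alpha) v = if is_root side v then (alpha (rank v %/ 2)).+1 else 0.
Proof. by move=> h vk; have [_ ->] := init_inv side h (leqnn k); rewrite vk. Qed.

Variable nb : nat -> nat -> nat.
Hypothesis nb_lt : forall x j, x < n -> nb x j < n.

Lemma digit_pred_lt c u : digit N c u != 0 -> (digit N c u).-1 < n.
Proof. by have := @digit_lt N c u isT; rewrite /N; lia. Qed.

Lemma parentP c v :
  if parent c v is u.+1 then [/\ u < k, digit N c u != 0 & arc u v]
  else forall u, u < k -> digit N c u != 0 -> ~~ arc u v.
Proof.
have := iteri_last (fun u => (digit N c u != 0) && arc u v) k; rewrite -/(parent c v).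
case: (parent c v) => [h u uk du|u [uk /andP[]]] //.
by have := h u uk; rewrite du.
Qed.

Lemma sweep_step_digit beta c v w : digit N (sweep_step nb beta c v) w =
  if (w == v) && (digit N c v == 0) then
    if parent c v is u.+1 then (nb (digit N c u).-1 (beta v)).+1 else 0
  else digit N c w.
Proof.
rewrite /sweep_step; case: eqP => [e|/eqP ne] /=; last by rewrite andbF.
have := parentP c v; case: (parent c v) => [_|u [uk du a]].
  by case: eqP => // ->.
by rewrite digit_set ?andbT // ?ltnS ?nb_lt // digit_pred_lt.
Qed.

Lemma sweep_step_good beta c v : v < k -> c < N ^ k -> sweep_step nb beta c v < N ^ k.
Proof.
move=> vk ck; rewrite /sweep_step; case: eqP => //= dv.
have := parentP c v; case: (parent c v) => [_|u [uk du a]] //.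
by apply: digit_set_lt => //; rewrite ltnS nb_lt // digit_pred_lt.
Qed.

Lemma sweep_good beta c : c < N ^ k -> sweep nb beta c < N ^ k.
Proof.
rewrite /sweep; have : all (gtn k) sweep_order by apply/allP => v; rewrite mem_sweep_order.
elim: sweep_order c => //= v s IH c /andP[vk sk] ck; apply: IH => //.
exact: sweep_step_good.
Qed.

Lemma gen_lt side alpha beta : (forall j, alpha j < n) -> gen nb side alpha beta < N ^ k.
Proof. by move=> h; do 2!apply: sweep_good; apply: init_good. Qed.

(* Which vertices are defined does not depend on the values. *)
Definition same_dom (c c' : nat) : Prop :=
  forall v, v < k -> (digit N c v != 0) = (digit N c' v != 0).

Lemma parent_dom c c' v : same_dom c c' -> parent c v = parent c' v.
Proof.
move=> h; rewrite /parent; elim: {-2}k (leqnn k) => // i IH ik.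
by rewrite [LHS]/= [RHS]/= IH 1?ltnW // h.
Qed.

Lemma sweep_step_dom beta beta' c c' v : v < k -> same_dom c c' ->
  same_dom (sweep_step nb beta c v) (sweep_step nb beta' c' v).
Proof.
move=> vk h w wk; rewrite !sweep_step_digit -(parent_dom v h).
have -> : (digit N c v == 0) = (digit N c' v == 0) by apply: negb_inj; exact: h.
by case: ifP => _; [case: parent|exact: h].
Qed.

Lemma sweep_dom beta beta' c c' : same_dom c c' ->
  same_dom (sweep nb beta c) (sweep nb beta' c').
Proof.
rewrite /sweep; have : all (gtn k) sweep_order by apply/allP => v; rewrite mem_sweep_order.
elim: sweep_order c c' => //= v s IH c c' /andP[vk sk] h; apply: IH => //.
exact: sweep_step_dom.
Qed.

Lemma gen_dom side alpha alpha' beta beta' :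
  (forall j, alpha j < n) -> (forall j, alpha' j < n) ->
  same_dom (gen nb side alpha beta) (gen nb side alpha' beta').
Proof.
move=> h h'; do 2!apply: sweep_dom; move=> v vk.
by rewrite !digit_init //; case: ifP.
Qed.

Lemma sweep_keep beta c s v : digit N c v != 0 ->
  digit N (foldl (sweep_step nb beta) c s) v = digit N c v.
Proof.
elim: s c => //= w s IH c h.
have e : digit N (sweep_step nb beta c w) v = digit N c v.
  by rewrite sweep_step_digit; case: (v =P w) => //= <-; rewrite (negPf h).
by rewrite IH e.
Qed.

(** At the turn of [v] at least [u] qualifies as a parent; the value of [v] may come from another
    one. *)
Lemma sweep_extend beta c u v : u < k -> v < k -> digit N c u != 0 -> arc u v ->
  digit N (sweep nb beta c) v != 0.
Proof.
move=> uk vk du a; rewrite /sweep.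
have vo : v \in sweep_order by rewrite mem_sweep_order.
case/splitPr: vo => s1 s2; rewrite foldl_cat /=.
set c1 := foldl _ c s1.
have du1 : digit N c1 u != 0 by rewrite sweep_keep.
suff h : digit N (sweep_step nb beta c1 v) v != 0 by rewrite sweep_keep.
rewrite sweep_step_digit eqxx /=; case: ifP => [_|/negbT//].
by have := parentP c1 v; case: (parent c1 v) => [h|? _ //]; move: (h u uk du1); rewrite a.
Qed.

(* Each vertex is reached in one descending sweep, as parents are either
   roots or larger. *)
Lemma sweep_cover v : v < k -> exists2 side, side < 2 & forall alpha beta,
  (forall j, alpha j < n) -> digit N (sweep nb beta (init_code side alpha)) v != 0.
Proof.
have [m hm] := ubnP (k - v); elim: m v hm => // m IH v hm vk.
have [dv|dv] := eqVneq (digit 2 deleted v) 0.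
  exists (rank v %% 2); first by rewrite ltn_mod.
  move=> alpha beta ha; have h : digit N (init_code (rank v %% 2) alpha) v != 0.
    by rewrite digit_init // /is_root dv !eqxx.
  by rewrite /sweep sweep_keep.
have [u [uk a /orP[vu|/eqP du]]] := deleted_parent vk dv; last first.
  exists (rank u %% 2); first by rewrite ltn_mod.
  move=> alpha beta ha; apply: (sweep_extend _ uk vk _ a).
  by rewrite digit_init // /is_root du !eqxx.
have [side s2 h] := IH u ltac:(lia) uk; exists side => // alpha beta ha.
have {h} := h alpha beta ha; rewrite /sweep /sweep_order.
have -> : iota 0 k = iota 0 (k.-1 - v) ++ iota (k.-1 - v) v.+1.
  by rewrite -iotaD; congr iota; lia.
rewrite /= map_cat foldl_cat /= subKn; last by lia.
set c1 := foldl _ _ [seq _ | _ <- iota 0 _]; set s := [seq _ | _ <- _] => h.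
(* What is left of the sweep handles only vertices at most [v]. If [u > v] were undefined here it
   would stay so, against the induction hypothesis. *)
have du1 : digit N c1 u != 0.
  have low s' c' : all (geq v) s' -> digit N c' u = 0 ->
      digit N (foldl (sweep_step nb beta) c' s') u = 0.
    elim: s' c' => //= w s' IH' c' /andP[wv sv] d0; apply: IH' => //.
    by rewrite sweep_step_digit; case: (u =P w) => //= e; lia.
  apply/negP => /eqP d0; move/negP: h; apply; apply/eqP.
  apply: (low (v :: s)) => //=; rewrite leqnn /=.
  by apply/allP => w /mapP[t]; rewrite mem_iota => ? ->; rewrite /=; lia.
suff h1 : digit N (sweep_step nb beta c1 v) v != 0 by rewrite sweep_keep.
rewrite sweep_step_digit eqxx /=; case: ifP => [_|/negbT//].
by have := parentP c1 v; case: (parent c1 v) => [h0|? _ //]; move: (h0 u uk du1); rewrite a.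
Qed.

Lemma gen_cover v : v < k -> exists2 side, side < 2 & forall alpha beta,
  (forall j, alpha j < n) -> digit N (gen nb side alpha beta) v != 0.
Proof.
move=> /sweep_cover[side s2 h]; exists side => // alpha beta ha.
by have {}h := h alpha beta ha; rewrite /gen {1}/sweep sweep_keep.
Qed.

Lemma gen_cover_arc u v : u < k -> v < k -> arc u v ->
  exists2 side, side < 2 & forall alpha beta, (forall j, alpha j < n) ->
  digit N (gen nb side alpha beta) u != 0 /\ digit N (gen nb side alpha beta) v != 0.
Proof.
move=> uk vk a; have [side s2 h] := sweep_cover uk; exists side => // alpha beta ha.
have {}h := h alpha beta ha; split; first by rewrite /gen {1}/sweep sweep_keep.
exact: sweep_extend h a.
Qed.

Lemma sweep_step_beta beta beta' c v : beta v = beta' v ->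
  sweep_step nb beta c v = sweep_step nb beta' c v.
Proof. by rewrite /sweep_step => ->. Qed.

Lemma sweep_unused beta v j c s : digit N c v != 0 ->
  foldl (sweep_step nb (fun w => if w == v then j else beta w)) c s =
  foldl (sweep_step nb beta) c s.
Proof.
elim: s c => //= w s IH c h.
have e : sweep_step nb (fun w0 => if w0 == v then j else beta w0) c w =
         sweep_step nb beta c w.
  by have [->|/negPf ne] := eqVneq w v; [rewrite /sweep_step h|apply: sweep_step_beta; rewrite ne].
rewrite e IH // sweep_step_digit; case: (v =P w) => //= <-.
by rewrite (negPf h).
Qed.

(** The choices are fixed along the sweep: when [v] receives a value through its parent [u], take
    the [j] that leads from the target value of [u] to that of [v]. A defined vertex never consults
    its choice again, so overriding [beta] at [v] does not disturb the rest. *)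
Lemma foldl_complete B c target s : 0 < B ->
  (forall u v, u < k -> v < k -> digit N target u != 0 -> digit N target v != 0 -> arc u v ->
     exists2 j, j < B & nb (digit N target u).-1 j = (digit N target v).-1) ->
  all (gtn k) s ->
  (forall v, v < k -> digit N c v != 0 -> digit N c v = digit N target v) ->
  (forall v beta, v < k -> digit N (foldl (sweep_step nb beta) c s) v != 0 -> digit N target v != 0) ->
  exists2 beta, forall v, beta v < B & forall v, v < k ->
    let d := digit N (foldl (sweep_step nb beta) c s) v in d != 0 -> d = digit N target v.
Proof.
move=> B0 harc; elim: s c => [|v s IH] c /= => [_ hc _|/andP[vk sk] hc hd].
  by exists (fun=> 0).
have [[e|e]|[dv pv]] : (digit N c v != 0 \/ parent c v = 0) \/
    (digit N c v = 0 /\ parent c v != 0) by case: eqP; case: eqP; auto.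
- have e' beta : sweep_step nb beta c v = c by rewrite /sweep_step e.
  have [|beta bB hb] := IH c sk hc; first by move=> w beta wk h; apply: (hd w beta); rewrite ?e'.
  by exists beta => // w; rewrite e'; apply: hb.
- have e' beta : sweep_step nb beta c v = c by rewrite /sweep_step e; case: ifP.
  have [|beta bB hb] := IH c sk hc; first by move=> w beta wk h; apply: (hd w beta); rewrite ?e'.
  by exists beta => // w; rewrite e'; apply: hb.
have := parentP c v; case E: (parent c v) pv => [|u] // _ [uk du a].
have def_now beta : digit N (sweep_step nb beta c v) v != 0.
  by rewrite sweep_step_digit E dv eqxx.
have tv : digit N target v != 0.
  by apply: (hd v (fun=> 0)) => //; rewrite sweep_keep.
have tu : digit N target u = digit N c u by rewrite hc.
have tu0 : digit N target u != 0 by rewrite tu.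
have [j jB ej] := harc u v uk vk tu0 tv a.
pose over beta w := if w == v then j else beta w.
have e beta : sweep_step nb (over beta) c v = sweep_step nb (fun=> j) c v.
  by apply: sweep_step_beta; rewrite /over eqxx.
have [||beta bB hb] := IH (sweep_step nb (fun=> j) c v) sk.
- move=> w wk; rewrite sweep_step_digit E dv eqxx andbT.
  case: (w =P v) => [-> _|_]; last exact: hc.
  by rewrite -tu ej; move: tv; case: digit.
- move=> w beta wk h; apply: (hd w (over beta)) => //.
  by rewrite e sweep_unused.
exists (over beta) => [w|w]; first by rewrite /over; case: ifP.
by rewrite e sweep_unused //; apply: hb.
Qed.

Lemma gen_complete B side target : 0 < B -> 0 < n -> target < N ^ k ->
  same_dom target (gen nb side (fun=> 0) (fun=> 0)) ->
  (forall u v, u < k -> v < k -> digit N target u != 0 -> digit N target v != 0 -> arc u v ->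
     exists2 j, j < B & nb (digit N target u).-1 j = (digit N target v).-1) ->
  exists alpha beta, [/\ forall j, alpha j < n, forall v, beta v < B &
    gen nb side alpha beta = target].
Proof.
move=> B0 n0 tk td harc.
have z0 : forall j : nat, (fun=> 0) j < n by [].
(* [alpha j] reads [target] at the root of index [j]. If there is none, [nth] falls back to its
   default and the value is still below [n], since [n] is positive. *)
pose alpha j := (digit N target
  (nth 0 (iota 0 k) (find (fun v => is_root side v && (rank v %/ 2 == j)) (iota 0 k)))).-1.
have ha j : alpha j < n by have := @digit_lt N target (nth 0 (iota 0 k) (find (fun v => is_root side v && (rank v %/ 2 == j)) (iota 0 k))) isT; rewrite /alpha /N; lia.
have root_in v : v < k -> is_root side v -> digit N target v != 0.
  move=> vk rv; have h0 : digit N (init_code side (fun=> 0)) v != 0 by rewrite digit_init ?rv.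
  by rewrite td // /gen /sweep !sweep_keep.
have hinit v : v < k -> digit N (init_code side alpha) v != 0 ->
    digit N (init_code side alpha) v = digit N target v.
  move=> vk; rewrite digit_init //; case: ifP => // rv _.
  set q := fun w => is_root side w && (rank w %/ 2 == rank v %/ 2).
  have hq : has q (iota 0 k) by apply/hasP; exists v; rewrite ?mem_iota // /q rv eqxx.
  have /andP[r1 /eqP r2] := nth_find 0 hq.
  have e := is_root_inj r1 rv r2.
  by rewrite /alpha -/q e prednK // lt0n root_in.
have [|||beta bB hb] := @foldl_complete B (init_code side alpha) target (sweep_order ++ sweep_order) B0 harc.
- by rewrite all_cat andbb; apply/allP => v; rewrite mem_sweep_order.
- exact: hinit.
- move=> v beta vk; rewrite foldl_cat -/(sweep nb beta _) -/(sweep nb beta _) => h.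
  rewrite td // -(@gen_dom side alpha (fun=> 0) beta (fun=> 0)) //.
exists alpha, beta; split=> //.
apply: (@digit_inj N k) => // [|v vk]; first exact: gen_lt.
have := hb v vk; rewrite foldl_cat -/(sweep nb beta _) -/(sweep nb beta _).
rewrite -/(gen nb side alpha beta) => h.
have [d0|dn] := eqVneq (digit N (gen nb side alpha beta) v) 0; last exact: h.
have := @gen_dom side alpha (fun=> 0) beta (fun=> 0) ha z0 v vk.
by rewrite -td // d0 eqxx => /esym/negbFE/eqP->.
Qed.

End Plan.

(** * Joining the two halves *)

Definition mkcode (B k : nat) (g : nat -> nat) : nat :=
  iteri k (fun v acc => acc + B ^ v * g v) 0.

Lemma mkcode_inv B k g i : 0 < B -> (forall v, g v < B) -> i <= k ->
  iteri i (fun v acc => acc + B ^ v * g v) 0 < B ^ k /\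
  forall v, digit B (iteri i (fun v acc => acc + B ^ v * g v) 0) v =
    if v < i then g v else 0.
Proof.
move=> B0 hg; elim: i => [|i IH] ik; first by split=> [|v]; rewrite ?expn_gt0 ?B0 ?digit0.
have [h1 h2] := IH (ltnW ik); rewrite [iteri i.+1 _ _]/=.
have z : digit B (iteri i (fun v acc => acc + B ^ v * g v) 0) i = 0 by rewrite h2 ltnn.
split=> [|v]; first by apply: digit_set_lt.
rewrite digit_set // h2.
have -> : (v < i.+1) = (v == i) || (v < i) by rewrite ltnS leq_eqVlt.
by case: eqP => [->|].
Qed.

Lemma mkcode_lt B k g : 0 < B -> (forall v, g v < B) -> mkcode B k g < B ^ k.
Proof. by move=> B0 h; have [] := mkcode_inv B0 h (leqnn k). Qed.

Lemma digit_mkcode B k g v : 0 < B -> (forall v, g v < B) -> v < k ->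
  digit B (mkcode B k g) v = g v.
Proof. by move=> B0 h vk; have [_ ->] := mkcode_inv B0 h (leqnn k); rewrite vk. Qed.

Definition restrict (B k : nat) (p : nat -> bool) (c : nat) : nat :=
  mkcode B k (fun v => if p v then digit B c v else 0).

Lemma restrict_lt B k p c : 0 < B -> restrict B k p c < B ^ k.
Proof. by move=> B0; apply: mkcode_lt => // v; case: ifP => // _; apply: digit_lt. Qed.

Lemma digit_restrict B k p c v : 0 < B -> v < k ->
  digit B (restrict B k p c) v = if p v then digit B c v else 0.
Proof. by move=> B0 vk; rewrite digit_mkcode // => w; case: ifP => // _; apply: digit_lt. Qed.

Section Join.

Variables (k n : nat) (R : nat -> nat -> bool) (lab : nat -> nat -> nat).
Variable sat : nat -> nat -> nat -> bool.
Let N := n.+1.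
Let P := N ^ k.

Hypothesis sat0 : forall x y, sat 0 x y.
Hypothesis R_cover : forall v, v < k -> R 0 v || R 1 v.
Hypothesis R_pair : forall u v, u < v -> v < k -> lab u v != 0 ->
  (R 0 u && R 0 v) || (R 1 u && R 1 v).

Definition consistent (c : nat) : bool :=
  [forall u : 'I_k, forall v : 'I_k,
     [&& u < v, digit N c u != 0 & digit N c v != 0] ==>
     sat (lab u v) (digit N c u).-1 (digit N c v).-1].

Definition half_ok (side c : nat) : bool :=
  [forall v : 'I_k, (digit N c v != 0) == R side v] && consistent c.

Definition solution (phi : {ffun 'I_k -> 'I_n}) : bool :=
  [forall u : 'I_k, forall v : 'I_k, (u < v) ==> sat (lab u v) (phi u) (phi v)].

Let val_of (side : nat) (phi : {ffun 'I_k -> 'I_n}) (v : nat) : nat :=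
  if insub v is Some v' then if R side v then (phi v').+1 else 0 else 0.

Let val_lt side phi v : val_of side phi v < N.
Proof. by rewrite /val_of; case: insubP => [v' _ _|] //; case: ifP => // _; rewrite ltnS. Qed.

Let code_of side phi : 'I_P := Ordinal (mkcode_lt k (ltn0Sn n) (val_lt side phi)).

Let digit_code side phi (v : 'I_k) :
  digit N (code_of side phi) v = if R side v then (phi v).+1 else 0.
Proof.
rewrite -[nat_of_ord _]/(mkcode N k (val_of side phi)) digit_mkcode //.
by rewrite /val_of; case: insubP => [v' _ /val_inj->|]; rewrite ?ltn_ord.
Qed.

(** A map corresponds to the pair of its restrictions: [R_cover] makes this injective, and by
    [R_pair] two agreeing halves glue to a map satisfying every constraint. Agreement on the overlap
    is tested by cutting each half down to the domain of the other, which leaves both supported on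
    the intersection. *)
Lemma join_halves :
  #|[set phi | solution phi]| =
  \sum_(c1 < P | half_ok 0 c1)
    #|[set c2 : 'I_P | half_ok 1 c2 && (restrict N k (R 0) c2 == restrict N k (R 1) c1)]|.
Proof.
transitivity #|[set c : 'I_P * 'I_P | [&& half_ok 0 c.1, half_ok 1 c.2 &
    restrict N k (R 0) c.2 == restrict N k (R 1) c.1]]|; last first.
  rewrite -sum1_card (eq_bigl _ _ (fun c => in_set _ c)) /=.
  rewrite [LHS](_ : _ = \sum_(c1 < P | half_ok 0 c1) \sum_(c2 < P | half_ok 1 c2 &&
     (restrict N k (R 0) c2 == restrict N k (R 1) c1)) 1); last first.
    by rewrite pair_big_dep.
  by apply: eq_bigr => c1 _; rewrite -sum1_card; apply: eq_bigl => c2; rewrite inE.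
rewrite -(card_in_imset (f := fun phi => (code_of 0 phi, code_of 1 phi))); last first.
  move=> phi psi _ _ [e0 e1]; apply/ffunP => v; apply: val_inj.
  have /orP[Rv|Rv] := R_cover (ltn_ord v).
    have := congr1 (fun c => digit N c v) e0.
    by rewrite -![mkcode _ _ _]/(val (code_of _ _)) !digit_code Rv => -[].
  have := congr1 (fun c => digit N c v) e1.
  by rewrite -![mkcode _ _ _]/(val (code_of _ _)) !digit_code Rv => -[].
apply: eq_card => -[c1 c2]; rewrite inE /=; apply/imsetP/and3P.
  case=> phi; rewrite inE => /forallP sphi [-> ->].
  have hf side : half_ok side (code_of side phi).
    apply/andP; split; first by apply/forallP => v; rewrite digit_code; case: (R side v).
    apply/forallP => u; apply/forallP => v; apply/implyP; rewrite !digit_code.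
    case: (R side u); case: (R side v); rewrite ?andbF // => /and3P[uv _ _] /=.
    by have /forallP/(_ v)/implyP := sphi u; apply.
  split=> //; apply/eqP/(@digit_inj N k) => //; try exact: restrict_lt.
  move=> v vk; rewrite !digit_restrict //.
  by rewrite -[v]/(val (Ordinal vk)) !digit_code; case: (R 0 _); case: (R 1 _).
move=> [/andP[/forallP d0 /forallP s0] /andP[/forallP d1 /forallP s1] /eqP e].
have e' (v : 'I_k) : R 0 v -> R 1 v -> digit N c1 v = digit N c2 v.
  move=> r0 r1; have := congr1 (fun c => digit N c v) e.
  by rewrite !digit_restrict // r0 r1.
pose g (v : 'I_k) := (if R 0 v then digit N c1 v else digit N c2 v).-1.
have g0 (v : 'I_k) : R 0 v -> (g v).+1 = digit N c1 v.
  by move=> r; rewrite /g r prednK // lt0n (eqP (d0 v)).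
have g1 (v : 'I_k) : R 1 v -> (g v).+1 = digit N c2 v.
  move=> r; rewrite /g; case: ifP => r0; first by rewrite e' // prednK // lt0n (eqP (d1 v)).
  by rewrite prednK // lt0n (eqP (d1 v)).
have glt v : g v < n.
  have /orP[/g0|/g1] := R_cover (ltn_ord v).
    by have := @digit_lt N c1 v isT; rewrite /N; lia.
  by have := @digit_lt N c2 v isT; rewrite /N; lia.
pose phi : {ffun 'I_k -> 'I_n} := [ffun v => Ordinal (glt v)].
exists phi; last first.
  congr (_, _); apply: val_inj; apply: (@digit_inj N k) => //; try exact: ltn_ord;
    move=> v vk; rewrite -[v]/(val (Ordinal vk)) digit_code ffunE; case: ifP => r /=.
  - by rewrite g0.
  - by apply/eqP; rewrite -[_ == _]negbK (eqP (d0 (Ordinal vk))) r.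
  - by rewrite g1.
  - by apply/eqP; rewrite -[_ == _]negbK (eqP (d1 (Ordinal vk))) r.
rewrite inE; apply/forallP => u; apply/forallP => v; apply/implyP => uv; rewrite !ffunE /=.
have [->//|l0] := eqVneq (lab u v) 0.
have /orP[/andP[ru rv]|/andP[ru rv]] := R_pair uv (ltn_ord v) l0.
  have /forallP/(_ v) := s0 u; rewrite uv (eqP (d0 _)) (eqP (d0 _)) ru rv /=.
  by rewrite -(g0 u) // -(g0 v).
have /forallP/(_ v) := s1 u; rewrite uv (eqP (d1 _)) (eqP (d1 _)) ru rv /=.
by rewrite -(g1 u) // -(g1 v).
Qed.

End Join.

(** * Inclusion-exclusion over labellings *)

Import GRing.Theory Num.Theory.

(** Numbers below [B ^ m] enumerate the functions from [m] places to [B] digits, so this is the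
    distributive law. *)
Lemma sum_prod_digits (B m : nat) (F : nat -> nat -> int) : 0 < B ->
  (\sum_(c < B ^ m) \prod_(j < m) F j (digit B c j) =
   \prod_(j < m) \sum_(l < B) F j l)%R.
Proof.
move=> B0; rewrite bigA_distr_bigA /=.
pose dec (c : 'I_(B ^ m)) : {ffun 'I_m -> 'I_B} := [ffun j : 'I_m => Ordinal (digit_lt c j B0)].
have dinj : injective dec.
  move=> c c' /ffunP e; apply: val_inj; apply: (@digit_inj B m) => // [||v vm]; try exact: ltn_ord.
  by have := congr1 val (e (Ordinal vm)); rewrite !ffunE.
rewrite (reindex dec) /=; last by apply: onW_bij; apply: inj_card_bij; rewrite // card_ffun !card_ord.
by apply: eq_bigr => c _; apply: eq_bigr => j _; rewrite ffunE.
Qed.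

Section InclusionExclusion.

Variables (k n : nat) (H D : nat -> nat -> bool) (mode : nat).
Hypothesis D_excl : forall x y, ~~ (D x y && D y x).

Definition label (lam u v : nat) : nat := digit 4 lam (u * k + v).

Definition sat (l x y : nat) : bool :=
  match l with 0 => true | 1 => D x y | 2 => D y x | _ => x == y end.

(* [mode] 0 counts homomorphisms, 1 injective ones, 2 induced ones. *)
Definition weight (e : bool) (l : nat) : int :=
  if e then Posz ((l == 1) || (l == 2))
  else match mode with
       | 0 => Posz (l == 0)
       | 1 => ((l == 0)%:Z - (l == 3)%:Z)%R
       | _ => ((l == 0)%:Z - (l != 0)%:Z)%R
       end.

(** A place that does not stand for a pair [u < v] has weight only for the digit 0, so every
    labelling of the pairs is counted exactly once. *)
Definition label_weight (j l : nat) : int :=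
  if j %/ k < j %% k then weight (H (j %/ k) (j %% k)) l else Posz (l == 0).

Definition coef (lam : nat) : int :=
  (\prod_(j < k * k) label_weight j (digit 4 lam j))%R.

Definition pair_target (u v x y : nat) : bool :=
  if H u v then D x y || D y x
  else match mode with
       | 0 => true
       | 1 => x != y
       | _ => (x != y) && ~~ (D x y || D y x)
       end.

Definition target (phi : {ffun 'I_k -> 'I_n}) : bool :=
  [forall u : 'I_k, forall v : 'I_k, (u < v) ==> pair_target u v (phi u) (phi v)].

Hypothesis D_irr : forall x, ~~ D x x.

(** The events [D x y], [D y x] and [x == y] exclude each other, so indicators are signed sums of
    them: an edge is the sum of the two arcs, distinctness is 1 minus equality, and an induced
    non-edge is 1 minus all three. *)
Lemma weight_pair u v x y :
  (\sum_(l < 4) weight (H u v) l * (sat l x y)%:Z = (pair_target u v x y)%:Z)%R.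
Proof.
rewrite !big_ord_recl big_ord0 /= /bump /= /pair_target /weight.
have h : x == y -> D x y = false by move/eqP->; apply/negbTE.
have h' : x == y -> D y x = false by move/eqP->; apply/negbTE.
move: h h' (D_excl x y); case: (D x y); case: (D y x); case: (x == y) => // h h' _;
  try (by have := h isT); try (by have := h' isT);
  by case: (H u v); case: mode => [|[|?]].
Qed.

Lemma prod_bool (I : finType) (b : I -> bool) :
  (\prod_(i : I) ((b i)%:Z : int) = ([forall i, b i])%:Z)%R.
Proof.
case: forallP => [h|h]; first by rewrite big1 // => i _; rewrite h.
have [i hi] : exists i, ~~ b i.
  by apply/existsP; rewrite -negb_forall; apply/forallP.
by rewrite (bigD1 i) //= (negPf hi) mul0r.
Qed.

(** For each map, multiply the identity [weight_pair] over all pairs and expand the product into a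
    sum over labellings; then exchange the two sums. *)
Lemma inclusion_exclusion :
  (\sum_(lam < 4 ^ (k * k)) coef lam *
     #|[set phi : {ffun 'I_k -> 'I_n} | solution (label lam) sat phi]|%:Z =
   #|[set phi | target phi]|%:Z)%R.
Proof.
pose at_ (phi : {ffun 'I_k -> 'I_n}) (v : nat) : nat :=
  if insub v is Some v' then phi v' else 0.
have at_E phi (v : 'I_k) : at_ phi v = phi v.
  rewrite /at_; case: insubP => [v' _ /val_inj->//|]; by rewrite ltn_ord.
have flat (Q : nat -> nat -> bool) :
    [forall u : 'I_k, forall v : 'I_k, Q u v] = [forall j : 'I_(k * k), Q (j %/ k) (j %% k)].
  apply/forallP/forallP => [h j|h u].
    have k0 : 0 < k by case: k j => // -[].
    have h1 : j %/ k < k by rewrite ltn_divLR.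
    by have /forallP/(_ (Ordinal (ltn_pmod j k0))) := h (Ordinal h1).
  apply/forallP => v; have k0 : 0 < k by case: k u => // -[].
  have hj : u * k + v < k * k.
    have := ltn_ord u; have := ltn_ord v.
    have : (u.+1 * k <= k * k) by rewrite leq_mul2r ltn_ord orbT.
    by rewrite mulSn; lia.
  have := h (Ordinal hj); rewrite /= divnMDl // modnMDl divn_small // modn_small //.
  by rewrite addn0.
have card_sum (Q : pred {ffun 'I_k -> 'I_n}) : (#|[set phi | Q phi]|%:Z = \sum_phi (Q phi)%:Z)%R.
  have -> : #|[set phi | Q phi]| = \sum_phi Q phi.
    by rewrite -sum1dep_card big_mkcond; apply: eq_bigr => phi _; case: (Q phi).
  by rewrite -natz natr_sum; apply: eq_bigr => phi _; rewrite natz.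
under eq_bigr => lam _ do rewrite card_sum mulr_sumr.
rewrite exchange_big /= card_sum; apply: eq_bigr => phi _.
pose F j l := (label_weight j l * ((j %/ k < j %% k)%N ==> sat l (at_ phi (j %/ k)) (at_ phi (j %% k)))%:Z)%R.
transitivity (\sum_(lam < 4 ^ (k * k)) \prod_(j < k * k) F j (digit 4 lam j))%R.
  apply: eq_bigr => lam _; rewrite big_split /= -/(coef lam); congr (_ * _)%R.
  rewrite prod_bool; congr (Posz (nat_of_bool _)).
  rewrite /solution.
  transitivity [forall u : 'I_k, forall v : 'I_k,
      (u < v) ==> sat (label lam u v) (at_ phi u) (at_ phi v)].
    by apply: eq_forallb => u; apply: eq_forallb => v; rewrite !at_E.
  rewrite (flat (fun u v => (u < v) ==> sat (label lam u v) (at_ phi u) (at_ phi v))).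
  by apply: eq_forallb => j; rewrite /label -divn_eq.
rewrite sum_prod_digits // /target.
transitivity (\prod_(j < k * k) ((j %/ k < j %% k)%N ==>
   pair_target (j %/ k) (j %% k) (at_ phi (j %/ k)) (at_ phi (j %% k)))%:Z)%R.
  apply: eq_bigr => j _; rewrite /F /label_weight; case: (j %/ k < j %% k) => /=.
    by rewrite -weight_pair.
  by rewrite !big_ord_recl big_ord0.
rewrite prod_bool; congr (Posz (nat_of_bool _)).
rewrite -(flat (fun u v => (u < v) ==> pair_target u v (at_ phi u) (at_ phi v))).
by apply: eq_forallb => u; apply: eq_forallb => v; rewrite !at_E.
Qed.

End InclusionExclusion.

(** * Copies and automorphisms *)

Definition embeds (U V : finType) (H : rel U) (E : rel V) (phi : {ffun U -> V}) : bool :=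
  injectiveb phi && [forall x, forall y, H x y == E (phi x) (phi y)].

Definition num_aut (U : finType) (H : rel U) : nat :=
  #|[set s : {ffun U -> U} | embeds H H s]|.

Lemma num_aut_gt0 (U : finType) (H : rel U) : 0 < num_aut H.
Proof.
apply/card_gt0P; exists [ffun x => x]; rewrite inE; apply/andP; split.
  by apply/injectiveP => x y; rewrite !ffunE.
by apply/forallP => x; apply/forallP => y; rewrite !ffunE.
Qed.

(* Two embeddings with the same image differ by an automorphism. *)
Lemma card_fibre (U V : finType) (H : rel U) (E : rel V) (phi0 : {ffun U -> V}) :
  embeds H E phi0 ->
  #|[set phi : {ffun U -> V} | embeds H E phi && (phi @: setT == phi0 @: setT)]| = num_aut H.
Proof.
move=> /andP[/injectiveP inj0 /forallP e0].
have e0' x y : H x y = E (phi0 x) (phi0 y) by have /forallP/(_ y)/eqP := e0 x.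
rewrite /num_aut -(card_imset (f := fun s : {ffun U -> U} => [ffun x => phi0 (s x)])); last first.
  by move=> s s' /ffunP e; apply/ffunP => x; apply: inj0; have := e x; rewrite !ffunE.
apply: eq_card => phi; rewrite inE; apply/andP/imsetP.
  case=> /andP[/injectiveP inj /forallP e] /eqP im.
  have ex x : exists y, phi0 y == phi x.
    have : phi x \in phi0 @: setT by rewrite -im imset_f.
    by case/imsetP => y _ ->; exists y.
  have sE x := eqP (xchooseP (ex x)).
  exists [ffun x => xchoose (ex x)]; last by apply/ffunP => x; rewrite !ffunE sE.
  rewrite inE; apply/andP; split.
    apply/injectiveP => x y; rewrite !ffunE => exy; apply: inj.
    by rewrite -(sE x) -(sE y) exy.
  apply/forallP => x; apply/forallP => y; rewrite !ffunE [X in _ == X]e0' !sE.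
  by have /forallP/(_ y) := e x.
case=> s; rewrite inE => /andP[/injectiveP injs /forallP es] ->; split.
  apply/andP; split.
    by apply/injectiveP => x y; rewrite !ffunE => /inj0/injs.
  apply/forallP => x; apply/forallP => y; rewrite !ffunE -e0'.
  by have /forallP/(_ y) := es x.
rewrite eqEcard !card_imset //; last by move=> x y; rewrite !ffunE => /inj0/injs.
rewrite leqnn andbT; apply/subsetP => _ /imsetP[x _ ->]; rewrite !ffunE; exact: imset_f.
Qed.

Lemma adj_pair (V : finType) (G : sgraph V) a b x y :
  [set x; y] = [set a; b] -> G a b -> G x y.
Proof.
move=> e g.
have : (x == a) || (x == b) by rewrite -in_set2 -e set21.
have : (y == a) || (y == b) by rewrite -in_set2 -e set22.
have : (a == x) || (a == y) by rewrite -in_set2 e set21.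
have : (b == x) || (b == y) by rewrite -in_set2 e set22.
have nab : (a == b) = false by apply/eqP => ab; rewrite ab adj_irrefl in g.
have [->|xa] := eqVneq x a; have [->|yb] := eqVneq y b => //=.
- by rewrite eq_sym nab.
- by rewrite nab.
- by rewrite !orbF => _ _ /eqP-> /eqP->; rewrite adj_sym.
Qed.

Definition inj_hom (U V : finType) (H : rel U) (G : rel V) (phi : {ffun U -> V}) : bool :=
  injectiveb phi && [forall x, forall y, H x y ==> G (phi x) (phi y)].

Lemma card_image_set (A B : finType) (f : A -> B) (S : {set A}) c :
  (forall a, a \in S -> #|[set a' in S | f a' == f a]| = c) ->
  #|S| = c * #|f @: S|.
Proof.
move=> h; rewrite -sum1_card (partition_big_imset f) /= mulnC -sum_nat_const.
apply: eq_bigr => b /imsetP[a aS ->]; rewrite -(h a aS) -sum1_card.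
by apply: eq_bigl => a'; rewrite inE.
Qed.

Lemma card_ind (U V : finType) (H : sgraph U) (G : sgraph V) :
  #|[set phi : {ffun U -> V} | embeds H G phi]| = num_aut H * ind H G.
Proof.
rewrite (@card_image_set _ _ (fun phi : {ffun U -> V} => phi @: setT) _ (num_aut H)); last first.
  move=> phi; rewrite inE => /card_fibre <-; by apply: eq_card => psi; rewrite !inE.
congr (_ * _); apply: eq_card => W; rewrite inE; apply/imsetP/existsP.
  case=> phi; rewrite inE => /andP[inj e] ->; exists phi; by rewrite inj eqxx e.
by case=> phi /and3P[inj /eqP<- e]; exists phi; rewrite // inE /embeds inj e.
Qed.

(** Injective homomorphisms with the same image subgraph are the embeddings into that subgraph with
    the same vertex image, so [card_fibre] applies with the edges of the image as the relation. *)
Lemma card_sub (U V : finType) (H : sgraph U) (G : sgraph V) :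
  #|[set phi : {ffun U -> V} | inj_hom H G phi]| = num_aut H * sub H G.
Proof.
pose im (phi : {ffun U -> V}) : {set V} * {set {set V}} :=
  (phi @: setT, [set e | [exists x, exists y, H x y && (e == [set phi x; phi y])]]).
have imE (phi : {ffun U -> V}) x y : injective phi ->
    ([set phi x; phi y] \in (im phi).2) = H x y.
  move=> inj; rewrite inE; apply/existsP/idP => [[x' /existsP[y' /andP[h /eqP e]]]|h]; last first.
    by exists x; apply/existsP; exists y; rewrite h eqxx.
  apply: adj_pair h; apply: (imset_inj inj).
  by rewrite !imsetU1 !imset_set1.
rewrite (@card_image_set _ _ im _ (num_aut H)); last first.
  move=> phi; rewrite inE => /andP[/injectiveP inj /forallP e].
  have em : embeds H [rel x y | [set x; y] \in (im phi).2] phi.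
    apply/andP; split; first exact/injectiveP.
    by apply/forallP => x; apply/forallP => y; rewrite /= (imE phi).
  rewrite -(card_fibre em); apply: eq_card => psi; rewrite !inE.
  apply/andP/andP.
    case=> /andP[/injectiveP injp _] /eqP ei; split; last by case: ei => -> _.
    apply/andP; split; first exact/injectiveP.
    by apply/forallP => x; apply/forallP => y; rewrite -(imE psi x y injp) ei.
  case=> /andP[/injectiveP injp /forallP ep] /eqP ei.
  have ep' x y : H x y = ([set psi x; psi y] \in (im phi).2).
    by have /forallP/(_ y)/eqP := ep x.
  have ee : (im psi).2 = (im phi).2.
    apply/eqP; rewrite eqEsubset; apply/andP; split; apply/subsetP => E.
      by rewrite inE => /existsP[x /existsP[y /andP[h /eqP->]]]; rewrite -ep'.
    move=> hE; move: (hE); rewrite inE => /existsP[x /existsP[y /andP[h /eqP eE]]].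
    have lift z : exists z', phi z = psi z'.
      have : phi z \in psi @: setT by rewrite ei imset_f.
      by case/imsetP => z' _ ->; exists z'.
    have [x' ex] := lift x; have [y' ey] := lift y.
    by rewrite eE ex ey imE // ep' -ex -ey -eE.
  split; last by rewrite /im -[[set e | _]]/((im psi).2) ee ei.
  apply/andP; split; first exact/injectiveP.
  apply/forallP => x; apply/forallP => y; apply/implyP; rewrite ep' inE.
  case/existsP => x' /existsP[y' /andP[h /eqP eE]].
  have /forallP/(_ y')/implyP/(_ h) := e x' => g.
  exact: adj_pair eE g.
congr (_ * _); apply: eq_card => -[W E]; rewrite inE; apply/imsetP/andP.
  case=> phi; rewrite inE => /andP[/injectiveP inj /forallP e] [-> ->]; split.
    apply/andP; split.
      apply/subsetP => E'; rewrite inE => /existsP[x /existsP[y /andP[h /eqP->]]].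
      rewrite inE; apply/existsP; exists (phi x); apply/existsP; exists (phi y).
      by rewrite eqxx andbT; have /forallP/(_ y)/implyP := e x; apply.
    apply/forallP => E'; apply/implyP; rewrite inE => /existsP[x /existsP[y /andP[h /eqP->]]].
    by apply/subsetP => z; rewrite in_set2 => /orP[]/eqP->; apply: imset_f.
  apply/existsP; exists phi; rewrite eqxx; apply/and3P; split=> //; first exact/injectiveP.
  by apply/forallP => x; apply/forallP => y; rewrite /= -[[set e | _]]/((im phi).2) imE.
case=> /andP[/= /subsetP sE /forallP sW] /existsP[phi /and3P[/injectiveP inj /eqP eW /forallP e]].
have e' x y : H x y = ([set phi x; phi y] \in E) by have /forallP/(_ y)/eqP := e x.
exists phi.
  rewrite inE; apply/andP; split; first exact/injectiveP.
  apply/forallP => x; apply/forallP => y; apply/implyP; rewrite e' => /sE.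
  rewrite inE => /existsP[a /existsP[b /andP[g /eqP eab]]].
  exact: adj_pair eab g.
rewrite /im eW; congr (_, _); apply/setP => E'; rewrite inE.
apply/idP/existsP => [hE|[x /existsP[y /andP[h /eqP->]]]]; last by rewrite -e'.
have := sE _ hE; rewrite inE => /existsP[a /existsP[b /andP[g /eqP eab]]].
have /implyP/(_ hE)/subsetP sub := sW E'.
have : a \in W by apply: sub; rewrite eab set21.
have : b \in W by apply: sub; rewrite eab set22.
rewrite -eW => /imsetP[y _ ey] /imsetP[x _ ex].
exists x; apply/existsP; exists y; rewrite e' -ex -ey -eab hE eqxx //.
Qed.

(** * Orienting the host graph by peeling *)

(** The body of a [CFor] is charged once: loop lengths depend on [n] and enter through the Hoare
    triples, which multiply this weight by a size. *)
Fixpoint cweight (X : nat) (c : cmd) : nat :=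
  match c with
  | CSkip => 1
  | CStore ea ev => ecost X ea + ecost X ev + 1
  | CSeq c1 c2 => cweight X c1 + cweight X c2
  | CLet e c => ecost X e + cweight X c
  | CIf e c => ecost X e + (cweight X c + 2)
  | CFor e c => ecost X e + 2 + (cweight X c + 4)
  end.

Lemma cweight_poly (c : cmd) : exists a b, forall X, cweight X c <= a * X.+1 ^ b.
Proof.
have up x y c' X : x <= y -> c' * X.+1 ^ x <= c' * X.+1 ^ y.
  by move=> xy; rewrite leq_mul2l leq_pexp2l ?orbT.
have one c' X b : c' <= c' * X.+1 ^ b by rewrite leq_pmulr // expn_gt0.
have add f g : (exists a b, forall X, f X <= a * X.+1 ^ b) ->
    (exists a b, forall X, g X <= a * X.+1 ^ b) ->
    exists a b, forall X, f X + g X <= a * X.+1 ^ b.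
  move=> [a [b h]] [a' [b' h']]; exists (a + a'), (b + b') => X; rewrite mulnDl.
  apply: leq_add; [apply: leq_trans (h X) _|apply: leq_trans (h' X) _]; apply: up; lia.
have cst a' : exists a b, forall X, a' <= a * X.+1 ^ b by exists a', 0 => X; rewrite expn0 muln1.
have ex := ecost_poly.
elim: c => [|ea ev|c1 h1 c2 h2|e c h|e c h|e c h] /=; first exact: cst.
- exact: (add _ _ (add _ _ (ex _) (ex _)) (cst _)).
- exact: (add _ _ h1 h2).
- exact: (add _ _ (ex _) h).
- exact: (add _ _ (ex _) (add _ _ h (cst _))).
- exact: (add _ _ (add _ _ (ex _) (cst _)) (add _ _ h (cst _))).
Qed.

(* Working memory consists of eight interleaved unbounded arrays above [b]. *)
Definition adr (b j i : nat) : nat := b + 8 * i + j.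

Lemma adr_inj b j i j' i' : j < 8 -> j' < 8 ->
  (adr b j i == adr b j' i') = (j == j') && (i == i').
Proof. by rewrite /adr; case: eqP; case: eqP; case: eqP => //=; lia. Qed.

Lemma upd_adr m b j i v j' i' : j < 8 -> j' < 8 ->
  upd m (adr b j i) v (adr b j' i') = if (j' == j) && (i' == i) then v else m (adr b j' i').
Proof. by move=> h h'; rewrite updE adr_inj. Qed.

Lemma upd_low m b j i v a : a < b -> upd m (adr b j i) v a = m a.
Proof. by rewrite updE /adr; case: eqP => //; lia. Qed.

Definition eadd := EBin Add.
Definition esub := EBin Defs.Sub.
Definition emul := EBin Mul.
Definition ediv := EBin Div.
Definition eadr (j : nat) (i : expr) : expr :=
  eadd (eadd (EVar 2) (emul (ENum 8) i)) (ENum j).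
Definition earr (j : nat) (i : expr) : expr := EGet (eadr j i).

(* Environments start with [k; n; b; g], where [b] is the base of the working
   memory and [g] the address of the first adjacency list of the host.
   Array 0 holds the addresses of the adjacency lists, array 1 the flags of
   the peeled vertices, array 2 the lists of out-neighbours (preceded by their
   lengths), array 3 the scalars: remaining vertices, pass budget, threshold. *)
Definition eslot (x j : expr) : expr := eadd (emul x (eadd (EVar 1) (ENum 1))) j.

Definition c_positions : cmd :=
  CSeq (CStore (eadr 0 (ENum 0)) (EVar 3))
    (CFor (EVar 1) (CStore (eadr 0 (eadd (EVar 4) (ENum 1)))
       (eadd (eadd (earr 0 (EVar 4)) (EGet (earr 0 (EVar 4)))) (ENum 1)))).

Definition c_push : cmd :=
  CLet (EGet (eadd (eadd (earr 0 (EVar 6)) (ENum 1)) (EVar 7)))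
    (CIf (esub (ENum 1) (earr 1 (EVar 8)))
       (CSeq (CStore (eadr 2 (eslot (EVar 6) (ENum 0)))
                     (eadd (earr 2 (eslot (EVar 6) (ENum 0))) (ENum 1)))
             (CStore (eadr 2 (eslot (EVar 6) (earr 2 (eslot (EVar 6) (ENum 0)))))
                     (EVar 8)))).

Definition c_collect : cmd := CFor (EGet (earr 0 (EVar 6))) c_push.

(** The unpeeled neighbours of an unpeeled [x] are written to its out-list. If there are at most [K]
    of them, [x] is peeled and the list is final; otherwise the next visit overwrites it. *)
Definition c_visit : cmd :=
  CIf (esub (ENum 1) (earr 1 (EVar 6)))
    (CSeq (CStore (eadr 2 (eslot (EVar 6) (ENum 0))) (ENum 0))
    (CSeq c_collect
    (CIf (esub (eadd (EVar 4) (ENum 1)) (earr 2 (eslot (EVar 6) (ENum 0))))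
       (CSeq (CStore (eadr 1 (EVar 6)) (ENum 1))
       (CSeq (CStore (eadr 3 (ENum 0)) (esub (earr 3 (ENum 0)) (ENum 1)))
             (CStore (eadr 3 (ENum 2)) (EVar 4))))))).

Definition c_pass : cmd := CFor (EVar 1) c_visit.

(** The pass budget starts at [n] and is halved in every round, so at most [bitlen n] of the [n]
    rounds make a pass and the others cost a constant. For a threshold of at least [4 * d] the
    number of remaining vertices stays below the budget. *)
Definition c_round : cmd :=
  CSeq (CIf (ECond (earr 3 (ENum 0)) (earr 3 (ENum 1)) (ENum 0)) c_pass)
       (CStore (eadr 3 (ENum 1)) (ediv (earr 3 (ENum 1)) (ENum 2))).

Definition c_threshold : cmd :=
  CSeq (CStore (eadr 3 (ENum 1)) (EVar 1))
       (CFor (ECond (earr 3 (ENum 0)) (EVar 1) (ENum 0)) c_round).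

(** Thresholds from 0 to [4 * n] are tried in turn. Since [d <= n], the value [4 * d] is among them,
    and everything is idle once no vertex remains. *)
Definition c_peel : cmd :=
  CSeq (CStore (eadr 3 (ENum 0)) (EVar 1))
       (CFor (eadd (emul (ENum 4) (EVar 1)) (ENum 1)) c_threshold).

Section Peel.

Variables (M X k n b g d : nat) (inp : nat -> nat) (NL : nat -> seq nat).

Definition list_pos (x : nat) : nat := g + \sum_(0 <= y < x) (size (NL y)).+1.

Hypothesis M_ge : 256 <= M.
Hypothesis M_adr : b + 8 * (n.+1 * n.+2) + 8 <= M.
Hypothesis M_n : 4 * n + 1 <= M.
Hypothesis k_le : k <= M.
Hypothesis g_le : g <= M.
Hypothesis NL_lt : forall x y, y \in NL x -> y < n.
Hypothesis NL_uniq : forall x, uniq (NL x).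
Hypothesis NL_irr : forall x, x \notin NL x.
Hypothesis NL_sym : forall x y, x < n -> y < n -> (x \in NL y) = (y \in NL x).
Hypothesis inp_size : forall x, x < n -> inp (list_pos x) = size (NL x).
Hypothesis inp_nth : forall x j, x < n -> j < size (NL x) ->
  inp (list_pos x + 1 + j) = nth 0 (NL x) j.
Hypothesis pos_le : list_pos n <= b.
Hypothesis d_le : d <= n.
Hypothesis sparse : forall p : pred nat,
  \sum_(x < n | p x) count p (NL x) <= 2 * d * count p (iota 0 n).

Implicit Types (m : nat -> nat) (x y z : nat).

Definition slot x j : nat := x * (n + 1) + j.
Definition flag m x : nat := m (adr b 1 x).
Definition cell m x j : nat := m (adr b 2 (slot x j)).
Definition remaining m : nat := m (adr b 3 0).
Definition budget m : nat := m (adr b 3 1).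
Definition threshold m : nat := m (adr b 3 2).
Definition outs m x : seq nat := [seq cell m x i.+1 | i <- iota 0 (cell m x 0)].

Lemma slot_inj x j x' j' : j <= n -> j' <= n ->
  (slot x j == slot x' j') = (x == x') && (j == j').
Proof.
clear -n.
move=> hj hj'; rewrite /slot; apply/eqP/andP => [e|[/eqP-> /eqP->]//].
have ex : x = x'.
  have := congr1 (divn^~ (n + 1)) e; rewrite /= !divnMDl ?addn1 //.
  by rewrite !divn_small ?addn0 // ltnS.
by move: e; rewrite ex eqxx => /addnI->.
Qed.

Lemma slot_adr x j : x < n -> j <= n -> b + 8 * slot x j + 8 <= M.
Proof.
move=> xn jn; apply: leq_trans M_adr.
suff : slot x j <= n.+1 * n.+2 by lia.
rewrite /slot; have : x * (n + 1) <= n * (n + 1) by rewrite leq_mul2r (ltnW xn) orbT.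
by lia.
Qed.

Lemma ev_adr m env j e v : nth 0 env 2 = b -> j < 8 -> evals M X m env e v ->
  b + 8 * v + 8 <= M -> evals M X m env (eadr j e) (adr b j v).
Proof.
clear -M X b.
move=> hb j8 he hM; rewrite /eadr /eadd /emul.
eapply ev_eq; first (ev; first [exact: he|rewrite ?hb; lia]).
by rewrite /= hb.
Qed.

Lemma ev_arr m env j e v : nth 0 env 2 = b -> j < 8 -> evals M X m env e v ->
  b + 8 * v + 8 <= M -> evals M X m env (earr j e) (m (adr b j v)).
Proof.
clear -M X b.
by move=> *; apply: EvGet; apply: ev_adr. Qed.

Lemma ev_slot m env ex ej x j : nth 0 env 1 = n -> evals M X m env ex x ->
  evals M X m env ej j -> slot x j + n + 1 <= M -> evals M X m env (eslot ex ej) (slot x j).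
Proof.
clear -M X n.
move=> hn hx hj hM; rewrite /eslot /eadd /emul; move: hM; rewrite /slot => hM.
eapply ev_eq; first (ev; first [exact: hx|exact: hj|rewrite ?hn; lia]).
by rewrite /= hn.
Qed.

Let M_gt0 : 0 < M. Proof. by lia. Qed.

Record positioned m : Prop := Positioned {
  po_in : forall a, a < b -> m a = inp a;
  po_pos : forall x, x <= n -> m (adr b 0 x) = list_pos x;
  po_zero : forall j i, 4 <= j -> j < 8 -> m (adr b j i) = 0 }.

(** Out-lists are constrained for peeled vertices only. [po_front] drives the induction: a peeled
    vertex lists all its unpeeled neighbours, so when one of these is peeled later, the edge between
    them is already listed, and [po_one] is preserved. *)
Record peel_ok m : Prop := PeelOk {
  po_base : positioned m;
  po_flag : forall x, x < n -> flag m x <= 1;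
  po_rem : remaining m = count (fun x => flag m x == 0) (iota 0 n);
  po_cnt : forall x, x < n -> flag m x = 1 -> cell m x 0 <= threshold m;
  po_cntn : forall x, x < n -> flag m x = 1 -> cell m x 0 <= n;
  po_sub : forall x y, x < n -> flag m x = 1 -> y \in outs m x -> y \in NL x;
  po_front : forall x y, x < n -> y \in NL x -> flag m x = 1 -> flag m y = 0 ->
    y \in outs m x;
  po_one : forall x y, x < n -> y \in NL x -> flag m x = 1 -> flag m y = 1 ->
    (y \in outs m x) = (x \notin outs m y) }.

Lemma list_posS x : list_pos x.+1 = list_pos x + size (NL x) + 1.
Proof. by clear -g NL; rewrite /list_pos big_nat_recr //=; lia. Qed.

Lemma list_pos_mono x y : x <= y -> list_pos x <= list_pos y.
Proof.
clear -g NL.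
move=> xy; rewrite -(subnKC xy); elim: (y - x) => [|e IH]; rewrite ?addn0 //.
by rewrite addnS list_posS; lia.
Qed.

Lemma list_pos_lt x j : x < n -> j <= size (NL x) -> list_pos x + j < b.
Proof.
move=> xn hj; apply: leq_trans pos_le; apply: leq_trans (list_pos_mono xn).
by rewrite list_posS; lia.
Qed.

Lemma positioned_upd m j i v : positioned m -> 0 < j -> j < 4 -> positioned (upd m (adr b j i) v).
Proof.
move=> [h1 h2 h3] j0 j4; have j8 : j < 8 by lia.
split=> [a ab|x xn|j' i' h h'].
- by rewrite upd_low ?h1.
- by rewrite upd_adr //; case: j j0 j4 j8 => //= *; apply: h2.
- by rewrite upd_adr //; case: eqP => [e|_]; [lia|apply: h3].
Qed.

Lemma size_NL x : size (NL x) <= n.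
Proof.
rewrite -[n in _ <= n](size_iota 0); apply: uniq_leq_size => // y /NL_lt.
by rewrite mem_iota.
Qed.

Lemma positions_hoare :
  hoare M [:: k; n; b; g] (fun m => (forall a, a < b -> m a = inp a) /\
     (forall a, b <= a -> m a = 0)) c_positions
    (cweight X c_positions * n.+1)
    (fun m => positioned m /\ forall j i, 0 < j -> j < 8 -> m (adr b j i) = 0).
Proof.
pose I x m := [/\ forall a, a < b -> m a = inp a,
  forall y, y <= x -> m (adr b 0 y) = list_pos y &
  forall j i, 0 < j -> j < 8 -> m (adr b j i) = 0].
have hM0 i : i <= n -> b + 8 * i + 8 <= M.
  move=> hi; apply: leq_trans M_adr; have : n <= n.+1 * n.+2 by rewrite mulSn; lia.
  lia.
eapply hoare_conseq with (P' := fun m => (forall a, a < b -> m a = inp a) /\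
     (forall a, b <= a -> m a = 0)) (Q' := I n).
- eapply hoare_seq with (R := I 0).
  + apply: (@hoare_store M X M_gt0 _ _ (I 0)) => m _ [h1 h2].
    exists (adr b 0 0), g; split.
    * by apply: ev_adr => //; [ev|have := hM0 0 isT].
    * exact: (EvVar _ _ _ [:: k; n; b; g] 3).
    * split.
      - by move=> a ab; rewrite upd_low ?h1.
      - move=> y; rewrite leqn0 => /eqP->.
        by rewrite upd_adr // eqxx /list_pos big_geq // addn0.
      - move=> j i j0 j8; rewrite upd_adr //; case: eqP => [|_]; first by lia.
        by rewrite h2 // /adr; lia.
  + apply: (@hoare_for M X M_gt0 _ I _ _ n ( fun=> cweight X (CStore (eadr 0 (eadd (EVar 4) (ENum 1)))
       (eadd (eadd (earr 0 (EVar 4)) (EGet (earr 0 (EVar 4)))) (ENum 1))))) => [m _ _|x xn].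
      exact: (EvVar _ _ _ [:: k; n; b; g] 1).
    apply: (@hoare_store M X M_gt0) => m _ [h1 h2 h3].
    have e1 : m (adr b 0 x) = list_pos x by apply: h2.
    have e2 : m (list_pos x) = size (NL x).
      rewrite h1 ?inp_size //; have := list_pos_lt xn (leq0n _); by rewrite addn0.
    have h := hM0 _ xn; have h4 := hM0 x (ltnW xn); have h5 := list_pos_lt xn (leqnn _).
    have evx : evals M X m [:: k; n; b; g; x] (earr 0 (EVar 4)) (m (adr b 0 x)).
      by apply: ev_arr => //; ev.
    exists (adr b 0 x.+1), (list_pos x.+1); split.
    * apply: ev_adr => //; eapply ev_eq; first (rewrite /eadd; ev => /=; lia).
      by rewrite /= addn1.
    * eapply ev_eq; first (rewrite /eadd; ev; [exact: evx|exact: evx|idtac..];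
        rewrite e1 e2 /=; lia).
      by rewrite /= e1 e2 list_posS.
    * split.
      - by move=> a ab; rewrite upd_low ?h1.
      - move=> y; rewrite upd_adr //=; case: eqP => [->//|ne yx]; apply: h2; lia.
      - move=> j i j0 j8; rewrite upd_adr //; case: eqP => [|_]; first by lia.
        exact: h3.
- rewrite sum_nat_const card_ord.
  have cw A B D N : A + (B + 2 + N * (D + 4)) <= (A + (B + 2 + (D + 4))) * N.+1.
    by rewrite mulnS mulnDl mulnDl [N * _]mulnC; lia.
  exact: cw.
- by move=> m.
- move=> m _ [h1 h2 h3]; split=> //; split=> // j i h h'; apply: h3 => //; lia.
Qed.

Lemma size_outs m x : size (outs m x) = cell m x 0.
Proof. by rewrite size_map size_iota. Qed.

Lemma cell_upd m x j v x' j' : j <= n -> j' <= n ->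
  cell (upd m (adr b 2 (slot x j)) v) x' j' =
  if (x' == x) && (j' == j) then v else cell m x' j'.
Proof.
clear -n b.
by move=> h h'; rewrite /cell upd_adr // eqxx slot_inj. Qed.

Lemma outs_upd m x j v z : j <= n -> z != x -> cell m z 0 <= n ->
  outs (upd m (adr b 2 (slot x j)) v) z = outs m z.
Proof.
clear -n b.
move=> jn zx hz; rewrite /outs cell_upd // (negPf zx) /=.
apply/eq_in_map => i; rewrite mem_iota => /= hi.
by rewrite cell_upd ?(negPf zx) //; lia.
Qed.

(** The row of an unpeeled vertex is scratch space: no clause of the invariant reads it. *)
Lemma peel_ok_slot m x j v : peel_ok m -> x < n -> flag m x = 0 -> j <= n ->
  peel_ok (upd m (adr b 2 (slot x j)) v).
Proof.
move=> [h1 h2 h3 h4 h5 h6 h7 h8] xn fx jn; set m' := upd _ _ _.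
have fE z : flag m' z = flag m z by rewrite /flag /m' upd_adr.
have zx z : flag m z = 1 -> z != x by apply: contra_eq_neq => ->; rewrite fx.
have cE z : z < n -> flag m z = 1 -> cell m' z 0 = cell m z 0.
  by move=> zn fz; rewrite cell_upd // (negPf (zx _ fz)).
have oE z : z < n -> flag m z = 1 -> outs m' z = outs m z.
  by move=> zn fz; apply: outs_upd; [|exact: zx|exact: h5].
have tE : threshold m' = threshold m by rewrite /threshold /m' upd_adr.
split.
- exact: positioned_upd.
- by move=> z zn; rewrite fE h2.
- have -> : remaining m' = remaining m by rewrite /remaining /m' upd_adr.
  by rewrite h3; apply: eq_count => z; rewrite fE.
- by move=> z zn; rewrite fE tE => fz; rewrite cE // h4.
- by move=> z zn; rewrite fE => fz; rewrite cE // h5.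
- by move=> z y zn; rewrite fE => fz; rewrite oE //; apply: h6.
- by move=> z y zn zy; rewrite !fE => fz fy; rewrite oE //; apply: h7.
- move=> z y zn zy; have yn := NL_lt zy; rewrite !fE => fz fy.
  by rewrite (oE z) // (oE y) //; apply: h8.
Qed.

Lemma outs_push m x y (c := cell m x 0) : c < n ->
  outs (upd (upd m (adr b 2 (slot x 0)) c.+1) (adr b 2 (slot x c.+1)) y) x =
  rcons (outs m x) y.
Proof.
clear -n b.
move=> cn; rewrite /outs cell_upd // andbF cell_upd // !eqxx andTb.
rewrite -[X in iota 0 X]addn1 iotaD map_cat cats1; congr rcons; last by rewrite add0n cell_upd // !eqxx.
apply/eq_in_map => i; rewrite mem_iota => /= hi.
rewrite cell_upd //; last by lia.
rewrite cell_upd //; last by lia.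
case: (i.+1 =P c.+1) => [e|_]; first by lia.
by rewrite andbF.
Qed.

Lemma count_remove (p : pred nat) (s : seq nat) z : uniq s -> z \in s -> p z ->
  count p s = (count (fun y => p y && (y != z)) s).+1.
Proof.
move=> us zs pz; rewrite (permP (perm_to_rem zs)) /= pz rem_filter // count_filter.
by congr _.+1; apply: eq_count.
Qed.

(** The list of [x] holds exactly its unpeeled neighbours, and by [po_front] its peeled neighbours
    already list [x], so each edge to a peeled neighbour is listed at exactly one end. *)
Lemma peel_ok_peel m x K : peel_ok m -> x < n -> flag m x = 0 ->
  outs m x = [seq y <- NL x | flag m y == 0] -> cell m x 0 <= K -> threshold m <= K ->
  peel_ok (upd (upd (upd m (adr b 1 x) 1) (adr b 3 0) (remaining m - 1)) (adr b 3 2) K).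
Proof.
move=> [h1 h2 h3 h4 h5 h6 h7 h8] xn fx ox cx tK; set m' := upd _ _ _.
have fE z : flag m' z = if z == x then 1 else flag m z by rewrite /flag /m' !upd_adr.
have cE z j : cell m' z j = cell m z j by rewrite /cell /m' !upd_adr.
have oE z : outs m' z = outs m z by rewrite /outs cE; apply: eq_map => j; rewrite cE.
have tE : threshold m' = K by rewrite /threshold /m' upd_adr.
have irr z y : y \in NL z -> (z == y) = false.
  by move=> zy; apply/eqP => e; move: zy; rewrite e (negPf (NL_irr y)).
split.
- by do 3!apply: positioned_upd => //.
- by move=> z zn; rewrite fE; case: eqP => // _; apply: h2.
- have -> : remaining m' = remaining m - 1 by rewrite /remaining /m' !upd_adr.
  rewrite h3 (@count_remove _ _ x) ?iota_uniq ?mem_iota ?fx // subn1 /=.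
  by apply: eq_count => z; rewrite fE; case: (z =P x); rewrite ?andbF ?andbT.
- move=> z zn; rewrite fE cE tE; case: eqP => [-> //|_ fz].
  by apply: leq_trans (h4 _ zn fz) tK.
- move=> z zn; rewrite fE cE; case: eqP => [-> _|_ fz]; last exact: h5.
  by rewrite -size_outs ox size_filter (leq_trans (count_size _ _)) // size_NL.
- move=> z y zn; rewrite fE oE; case: eqP => [-> _|_ fz]; last exact: h6.
  by rewrite ox mem_filter => /andP[].
- move=> z y zn zy; rewrite !fE oE; case: (y =P x) => // /eqP yx.
  case: eqP => [zx _|_ fz] fy; last exact: h7.
  by rewrite zx ox mem_filter fy -zx zy.
- move=> z y zn zy; rewrite !fE !oE; have yn := NL_lt zy; have nzy := irr _ _ zy.
  case: eqP => [zx _|_ fz]; case: eqP => [yx _|_ fy]; last exact: h8.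
  + by rewrite zx yx eqxx in nzy.
  + have xy : x \in NL y by rewrite NL_sym // -zx.
    rewrite zx ox mem_filter fy /=.
    by rewrite (h7 _ _ yn xy fy fx).
  + have xz : x \in NL z by rewrite -yx.
    by rewrite yx ox mem_filter fz (h7 _ _ zn xz fz fx).
Qed.

Let adr_n i : i <= n -> b + 8 * i + 8 <= M.
Proof.
move=> hi; apply: leq_trans M_adr; have : n <= n.+1 * n.+2 by rewrite mulSn; lia.
lia.
Qed.

Let slot_n x j : x < n -> j <= n -> slot x j + n + 1 <= M.
Proof.
move=> xn jn; apply: leq_trans M_adr; rewrite /slot.
have : x * (n + 1) <= n * (n + 1) by rewrite leq_mul2r (ltnW xn) orbT.
by rewrite !mulSn !mulnS; lia.
Qed.

Section Visit.

Variables (K p x : nat).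
Hypothesis x_lt : x < n.
Hypothesis K_le : K <= 4 * n.
Let env6 := [:: k; n; b; g; K; p; x].

Definition collecting m0 j m : Prop :=
  [/\ peel_ok m, forall z, flag m z = flag m0 z, threshold m = threshold m0,
      budget m = budget m0 & outs m x = [seq y <- take j (NL x) | flag m0 y == 0]].

Let ev_count m env : nth 0 env 1 = n -> nth 0 env 2 = b -> nth 0 env 6 = x ->
  evals M X m env (earr 2 (eslot (EVar 6) (ENum 0))) (cell m x 0).
Proof.
move=> e1 e2 e6; apply: ev_arr => //; last exact: slot_adr.
by apply: ev_slot => //; [rewrite -e6; ev|ev|exact: slot_n].
Qed.

Lemma collect_hoare m0 : flag m0 x = 0 ->
  hoare M env6 (collecting m0 0) c_collect
    (cweight X c_collect * (size (NL x)).+1) (collecting m0 (size (NL x))).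
Proof.
move=> fx0.
eapply hoare_conseq with (P' := collecting m0 0) (Q' := collecting m0 (size (NL x))); [| |try by []|try by []].
  apply: (@hoare_for M X M_gt0 _ (collecting m0) _ _ (size (NL x)) (fun=> cweight X c_push)) => [m _ [h1 _ _ _ _]|j jn].
    have [hin hpos _] := po_base h1.
    eapply ev_eq; first (apply: EvGet; apply: ev_arr; [by []|by []|ev|exact: adr_n (ltnW x_lt)]).
    rewrite /= hpos 1?ltnW // hin ?inp_size //.
    by have := list_pos_lt x_lt (leq0n _); rewrite addn0.
  set y := nth 0 (NL x) j.
  have yNL : y \in NL x by apply: mem_nth.
  have yn := NL_lt yNL.
  have tk : take j.+1 (NL x) = rcons (take j (NL x)) y by rewrite (take_nth 0).
  apply: (@hoare_let M X M_gt0 _ _ _ _ _ _ y) => [m _ [h1 _ _ _ _]|].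
    have [hin hpos _] := po_base h1.
    have hb := list_pos_lt x_lt jn.
    have e1 : m (adr b 0 x) = list_pos x by apply: hpos; apply: ltnW.
    have ea : evals M X m (rcons env6 j) (earr 0 (EVar 6)) (m (adr b 0 x)).
      by apply: ev_arr => //; [ev|exact: adr_n (ltnW x_lt)].
    eapply ev_eq; first (apply: EvGet; rewrite /eadd; ev; [exact: ea|rewrite e1|rewrite /= e1]; lia).
    by rewrite /= e1 hin ?inp_nth //; have := list_pos_lt x_lt jn; lia.
  rewrite [rcons _ y]/=.
  set env := [:: k, n, b, g, K, p, x, j & _].
  have evf m : evals M X m env (esub (ENum 1) (earr 1 (EVar 8))) (1 - flag m y).
    rewrite /esub; ev; apply: ev_arr => //; [ev|exact: adr_n (ltnW yn)].
  apply: (@hoare_if M X M_gt0 _ _ _ (fun m => 1 - flag m y)) => [m _ _|m _ [h1 h2 h3 h4 h5] f0|].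
  - exact: evf.
  - split=> //; rewrite tk filter_rcons h5 -h2; case: eqP => // e.
    by rewrite e in f0.
  apply: hoare_pre => m bm _ [[h1 h2 h3 h4 h5] v0].
  have fy : flag m y = 0 by lia.
  have fx : flag m x = 0 by rewrite h2.
  have cn : cell m x 0 < n.
    rewrite -size_outs h5 size_filter; apply: leq_ltn_trans (count_size _ _) _.
    rewrite size_take jn; exact: leq_trans jn (size_NL x).
  apply: (@hoare_seq _ _ _ (fun m' => m' = upd m (adr b 2 (slot x 0)) (cell m x 0).+1)).
    apply: (@hoare_store M X M_gt0) => m' _ <-; eexists; eexists; split; last first.
    - reflexivity.
    - eapply ev_eq; first (rewrite /eadd; ev; [exact: ev_count|]).
        by move=> /=; have := adr_n (leqnn n); lia.
      by rewrite /= addn1.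
    - apply: ev_adr => //; last exact: slot_adr.
      by apply: ev_slot => //; [ev|ev|exact: slot_n].
  apply: (@hoare_store M X M_gt0) => m' _ ->.
  set m1 := upd m _ _.
  have c1 : cell m1 x 0 = (cell m x 0).+1 by rewrite cell_upd // !eqxx.
  exists (adr b 2 (slot x (cell m x 0).+1)), y; split.
  - apply: ev_adr => //; last exact: slot_adr.
    apply: ev_slot => //; [ev| |exact: slot_n].
    by rewrite -c1; apply: ev_count.
  - exact: (EvVar _ _ _ env 8).
  - have fE z : flag (upd m1 (adr b 2 (slot x (cell m x 0).+1)) y) z = flag m z.
      by rewrite /flag /m1 !upd_adr.
    split.
    + apply: peel_ok_slot => //; first exact: peel_ok_slot.
      by rewrite /flag /m1 upd_adr.
    + by move=> z; rewrite fE.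
    + by rewrite -h3 /threshold /m1 !upd_adr.
    + by rewrite -h4 /budget /m1 !upd_adr.
    + by rewrite outs_push // tk filter_rcons -h2 fy h5.
rewrite sum_nat_const card_ord.
have cw A B N : A + 2 + N * (B + 4) <= (A + 2 + (B + 4)) * N.+1.
  by rewrite mulnS mulnDl [N * _]mulnC; lia.
exact: cw.
Qed.

(** [f0] holds the flags at the start of the pass. The last clause measures degrees by [f0]:
    vertices peeled during the pass only lower them, so a vertex with few neighbours at the start is
    certainly peeled. *)
Definition visited (f0 : nat -> nat) q i m : Prop :=
  [/\ peel_ok m, threshold m <= K, budget m = q,
      forall z, z < n -> f0 z = 1 -> flag m z = 1 &
      forall z, z < i -> z < n -> count (fun y => f0 y == 0) (NL z) <= K -> flag m z = 1].

Lemma visit_hoare (f0 : nat -> nat) q : (forall z, f0 z <= 1) ->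
  hoare M env6 (visited f0 q x) c_visit
    (cweight X c_visit * (size (NL x)).+1) (visited f0 q x.+1).
Proof.
move=> f01.
have evf m : evals M X m env6 (esub (ENum 1) (earr 1 (EVar 6))) (1 - flag m x).
  rewrite /esub; ev; apply: ev_arr => //; [ev|exact: adr_n (ltnW x_lt)].
have next m : flag m x = 1 -> visited f0 q x m -> visited f0 q x.+1 m.
  move=> fx [h1 h2 h3 h4 h5]; split=> // z; rewrite ltnS leq_eqVlt => /orP[/eqP->//|zx].
  exact: h5.
eapply hoare_conseq with (P' := visited f0 q x) (Q' := visited f0 q x.+1); [| |try by []|try by []].
  apply: (@hoare_if M X M_gt0 _ _ _ (fun m => 1 - flag m x)) => [m _ _|m _ hm f0x|].
  - exact: evf.
  - apply: next => //; case: hm => h1 _ _ _ _; have := po_flag h1 x_lt; lia.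
  apply: hoare_pre => m bm _ [[h1 h2 h3 h4 h5] v0].
  have fx : flag m x = 0 by lia.
  set m0 := upd m (adr b 2 (slot x 0)) 0.
  have fE z : flag m0 z = flag m z by rewrite /flag /m0 upd_adr.
  have tE : threshold m0 = threshold m by rewrite /threshold /m0 upd_adr.
  have bE : budget m0 = budget m by rewrite /budget /m0 upd_adr.
  apply: (@hoare_seq _ _ _ (collecting m0 0)).
    apply: (@hoare_store M X M_gt0) => _ _ <-; exists (adr b 2 (slot x 0)), 0; split.
    - apply: ev_adr => //; last exact: slot_adr.
      by apply: ev_slot => //; [ev|ev|exact: slot_n].
    - by ev.
    - split=> //; first exact: peel_ok_slot.
      by rewrite take0 /outs cell_upd // !eqxx.
  apply: hoare_seq; first by apply: collect_hoare; rewrite fE.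
  have cntE m' : collecting m0 (size (NL x)) m' ->
      cell m' x 0 = count (fun y => flag m y == 0) (NL x).
    case=> _ _ _ _ g5; rewrite -size_outs g5 size_filter take_size.
    by apply: eq_count => y; rewrite fE.
  have le_cnt : count (fun y => flag m y == 0) (NL x) <= count (fun y => f0 y == 0) (NL x).
    have sub y : y \in NL x -> flag m y == 0 -> f0 y == 0.
      move=> /NL_lt yn /eqP fy; have := f01 y; have := h4 y yn.
      by rewrite fy; case: (f0 y) => [|[|?]] // /(_ erefl).
    elim: (NL x) sub => //= y s IH sub; apply: leq_add; last first.
      by apply: IH => z zs; apply: sub; rewrite inE zs orbT.
    by have := sub y (mem_head _ _); case: (flag m y == 0) => // ->.
  apply: (@hoare_if M X M_gt0 _ _ _ (fun m => K + 1 - cell m x 0)) => [m' _ _|m' _ hm' c0|].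
  - rewrite /esub /eadd; ev; exact: ev_count.
  - have c' := cntE _ hm'; case: hm' => g1 g2 g3 g4 g5; split=> //.
    + by rewrite g3 tE.
    + by rewrite g4 bE.
    + by move=> z zn fz; rewrite g2 fE h4.
    + move=> z; rewrite ltnS leq_eqVlt => /orP[/eqP->|zx] zn cz; last by rewrite g2 fE h5.
      lia.
  apply: hoare_pre => m' bm' _ [hm' c0].
  have c' := cntE _ hm'; case: hm' => g1 g2 g3 g4 g5.
  have n0 : 0 < n by lia.
  have e8 : b + 8 * 2 + 8 <= M.
    apply: leq_trans M_adr; rewrite leq_add2r leq_add2l leq_mul2l mulnS; lia.
  have rem0 : 0 < remaining m'.
    rewrite (po_rem g1) -has_count; apply/hasP; exists x; first by rewrite mem_iota.
    by rewrite g2 fE fx.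
  apply: (@hoare_seq _ _ _ (fun m1 => m1 = upd m' (adr b 1 x) 1)).
    apply: (@hoare_store M X M_gt0) => _ _ <-; exists (adr b 1 x), 1; split=> //.
    - by apply: ev_adr => //; [ev|exact: adr_n (ltnW x_lt)].
    - by ev.
  apply: (@hoare_seq _ _ _ (fun m1 =>
     m1 = upd (upd m' (adr b 1 x) 1) (adr b 3 0) (remaining m' - 1))).
    apply: (@hoare_store M X M_gt0) => _ _ ->.
    exists (adr b 3 0), (remaining m' - 1); split=> //.
    - by apply: ev_adr => //; [ev|exact: adr_n].
    - eapply ev_eq; first (rewrite /esub; ev; apply: ev_arr; [by []|by []|ev|exact: adr_n]).
      by rewrite /= upd_adr.
  apply: (@hoare_store M X M_gt0) => _ _ ->.
  exists (adr b 3 2), K; split.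
  - by apply: ev_adr => //; ev.
  - exact: (EvVar _ _ _ env6 4).
  - set m1 := upd _ _ _.
    have fE' z : flag m1 z = if z == x then 1 else flag m z.
      by rewrite /flag /m1 !upd_adr //= -/(flag m' z) g2 fE.
    split.
    + apply: peel_ok_peel => //; [by rewrite g2 fE| |by lia|by rewrite g3 tE].
      by rewrite g5 take_size; apply: eq_filter => y; rewrite g2.
    + by rewrite /threshold /m1 upd_adr.
    + by rewrite -h3 -bE -g4 /budget /m1 !upd_adr.
    + by move=> z zn fz; rewrite fE'; case: eqP => // _; apply: h4.
    + move=> z; rewrite ltnS leq_eqVlt fE' => /orP[/eqP->|zx] zn cz; first by rewrite eqxx.
      by case: eqP => // _; apply: h5.
have cw A B C D N : A + (B + (C * N.+1 + D) + 2) <= (A + (B + (C + D) + 2)) * N.+1.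
  by rewrite !mulnDl !mulnS; lia.
exact: cw.
Qed.

End Visit.

(** [sparse], taken for all vertices, bounds the total length of the lists by [2 * d * n]. *)
Definition pass_size : nat := n.+1 + 2 * d * n.

Lemma pass_hoare K p q (f0 : nat -> nat) : K <= 4 * n -> (forall z, f0 z <= 1) ->
  hoare M [:: k; n; b; g; K; p] (visited K f0 q 0) c_pass
    (cweight X c_pass * pass_size) (visited K f0 q n).
Proof.
move=> Kn f01.
eapply hoare_conseq with (P' := visited K f0 q 0) (Q' := visited K f0 q n); [| |try by []|try by []].
  apply: (@hoare_for M X M_gt0 _ (visited K f0 q) _ _ _
    (fun x => cweight X c_visit * (size (NL x)).+1)) => [m _ _|x xn].
    exact: (EvVar _ _ _ [:: k; n; b; g; K; p] 1).
  exact: visit_hoare.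
have sp := sparse predT.
rewrite (eq_bigr (fun x : 'I_n => size (NL x))) in sp; last by move=> x _; rewrite count_predT.
rewrite count_predT size_iota in sp.
rewrite big_split /= -big_distrr /= sum_nat_const card_ord.
rewrite (eq_bigr (fun x : 'I_n => 1 + size (NL x))) // big_split /= sum1_card card_ord.
set S := \sum_(_ < _) _ in sp *.
have cw A B N S' T : S' <= T ->
    A + 2 + (B * (N + S') + N * 4) <= (A + 2 + (B + 4)) * (N.+1 + T).
  move=> h; rewrite mulnDl !mulnDr mulnS; have := leq_mul (leqnn B) h; lia.
exact: cw.
Qed.

Lemma peel_ok_budget m v : peel_ok m -> peel_ok (upd m (adr b 3 1) v).
Proof.
move=> [h1 h2 h3 h4 h5 h6 h7 h8]; set m' := upd _ _ _.
have fE z : flag m' z = flag m z by rewrite /flag /m' upd_adr.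
have cE z j : cell m' z j = cell m z j by rewrite /cell /m' upd_adr.
have oE z : outs m' z = outs m z by rewrite /outs cE; apply: eq_map => j; rewrite cE.
have tE : threshold m' = threshold m by rewrite /threshold /m' upd_adr.
split.
- exact: positioned_upd.
- by move=> z zn; rewrite fE h2.
- have -> : remaining m' = remaining m by rewrite /remaining /m' upd_adr.
  by rewrite h3; apply: eq_count => z; rewrite fE.
- by move=> z zn; rewrite fE cE tE; apply: h4.
- by move=> z zn; rewrite fE cE; apply: h5.
- by move=> z y zn; rewrite fE oE; apply: h6.
- by move=> z y zn zy; rewrite !fE oE; apply: h7.
- by move=> z y zn zy; rewrite !fE !oE; apply: h8.
Qed.

(** The flags in memory are known to be 0 or 1 below [n] only; this version is so everywhere, as
    [visit_hoare] requires. *)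
Definition flag_of m z : nat := flag m z != 0.

Lemma flag_ofE m z : peel_ok m -> z < n -> flag_of m z = flag m z.
Proof. by move=> h zn; rewrite /flag_of; have := po_flag h zn; case: (flag m z) => [|[]]. Qed.

(* At most half of the remaining vertices have more than [4 d] remaining
   neighbours. *)
Lemma pass_halves m m' K q : 4 * d <= K -> peel_ok m ->
  visited K (flag_of m) q n m' -> 2 * remaining m' <= remaining m.
Proof.
move=> dK hm [g1 g2 g3 g4 g5]; set p := fun z => flag_of m z == 0.
have rE : remaining m = count p (iota 0 n).
  rewrite (po_rem hm); apply: eq_in_count => z; rewrite mem_iota => /= zn.
  by rewrite /p flag_ofE.
(* A vertex that survives the pass had more than [K] remaining neighbours at its start, so it
   contributes at least [K.+1] to the degree sum bounded by [sparse]. *)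
have le : remaining m' * K.+1 <= 2 * d * remaining m.
  rewrite rE (leq_trans _ (sparse p)) // (po_rem g1).
  have -> : iota 0 n = index_iota 0 n by rewrite /index_iota subn0.
  rewrite -sum1_count big_mkord big_distrl /=.
  rewrite big_mkcond [X in _ <= X]big_mkcond /=; apply: leq_sum => z _.
  case: eqP => // fz; have pz : p z.
    rewrite /p; have := g4 z (ltn_ord z); rewrite fz /flag_of.
    by case: (flag m z) => // ? /(_ erefl).
  rewrite pz mul1n ltnNge; apply/negP => /(g5 _ (ltn_ord z) (ltn_ord z)).
  by rewrite fz.
have : remaining m' * (4 * d).+1 <= 2 * d * remaining m.
  by apply: leq_trans le; rewrite leq_mul2l ltnS dK orbT.
rewrite mulnS => h.
have : remaining m' * 2 * (4 * d).+1 <= remaining m * (4 * d).+1.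
  by rewrite !mulnS; lia.
by rewrite leq_pmul2r // mulnC.
Qed.

Definition halving K p m : Prop :=
  [/\ peel_ok m, threshold m <= K, budget m = n %/ 2 ^ p &
      4 * d <= K -> remaining m <= n %/ 2 ^ p].

Definition round_factor p : nat := if n %/ 2 ^ p != 0 then pass_size else 1.

Lemma round_hoare K p : K <= 4 * n ->
  hoare M [:: k; n; b; g; K; p] (halving K p) c_round
    (cweight X c_round * round_factor p) (halving K p.+1).
Proof.
move=> Kn; apply: hoare_pre => m bm _ [h1 h2 h3 h4]; set env := [:: k; _; _; _; _; _].
have e8 : b + 8 * 2 + 8 <= M.
  by apply: leq_trans M_adr; rewrite leq_add2r leq_add2l leq_mul2l mulnS; lia.
have ev3 i m1 : i <= 2 -> evals M X m1 env (earr 3 (ENum i)) (m1 (adr b 3 i)).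
  by move=> i2; apply: ev_arr; [by []|by []|ev|lia].
pose v m1 := if remaining m1 != 0 then budget m1 else 0.
pose mid m1 := [/\ peel_ok m1, threshold m1 <= K, budget m1 = n %/ 2 ^ p &
  4 * d <= K -> remaining m1 <= n %/ 2 ^ p.+1].
have evc m1 : evals M X m1 env (ECond (earr 3 (ENum 0)) (earr 3 (ENum 1)) (ENum 0)) (v m1).
  by apply: ev_cond; [exact: ev3|move=> _; exact: ev3|move=> _; ev].
have half_le r : 2 * r <= n %/ 2 ^ p -> r <= n %/ 2 ^ p.+1.
  by move=> h; rewrite expnSr divnMA leq_divRL // muln2 -mul2n.
have first : hoare M env (eq m)
   (CIf (ECond (earr 3 (ENum 0)) (earr 3 (ENum 1)) (ENum 0)) c_pass)
   (ecost X (ECond (earr 3 (ENum 0)) (earr 3 (ENum 1)) (ENum 0)) +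
     ((if n %/ 2 ^ p != 0 then cweight X c_pass * pass_size else 0) + 2)) mid.
  apply: (@hoare_if M X M_gt0 _ _ _ v) => [m' _ <-|m' _ <- v0|]; first exact: evc.
    (* Without a pass, either nothing remains or the budget is 0, and the budget bounds what
       remains. *)
    split=> // hK; move: v0; rewrite /v h3; case: eqP => [-> //|_ /= e].
    by have := h4 hK; rewrite e leqn0 => /eqP->.
  case: ifP => [qn|/negbFE/eqP q0]; last first.
    move=> rho r s _ _ [es]; rewrite -es /v h3 q0.
    by case: (remaining m != 0).
  eapply hoare_conseq with (P' := visited K (flag_of m) (n %/ 2 ^ p) 0)
     (Q' := visited K (flag_of m) (n %/ 2 ^ p) n).
  - by apply: pass_hoare => // z; rewrite /flag_of leq_b1.
  - by [].
  - move=> m' _ _ [<- _]; split=> // z zn; by rewrite flag_ofE.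
  - move=> m' _ vis; have [g1 g2 g3 _ _] := vis; split=> // hK.
    apply: half_le; apply: leq_trans (pass_halves hK h1 vis) _; exact: h4.
eapply hoare_conseq with (P' := eq m) (Q' := halving K p.+1); [| |try by []|try by []].
  apply: hoare_seq; first exact: first.
  apply: (@hoare_store M X M_gt0) => m' _ [g1 g2 g3 g4].
  exists (adr b 3 1), (budget m' %/ 2); split.
  - by apply: ev_adr => //; [ev|lia].
  - by rewrite /ediv; ev; exact: ev3.
  - split; first exact: peel_ok_budget.
    + by rewrite /threshold upd_adr.
    + by rewrite /budget upd_adr // -/(budget m') g3 expnSr divnMA.
    + by move=> hK; rewrite /remaining upd_adr //; apply: g4.
rewrite /round_factor; have cw A B D N : 0 < N ->
    A + ((if n %/ 2 ^ p != 0 then B * N else 0) + 2) + D <=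
    (A + (B + 2) + D) * (if n %/ 2 ^ p != 0 then N else 1).
  case: N => // N _; case: ifP => _; last by lia.
  by rewrite !mulnDl !mulnS; lia.
exact: cw.
Qed.

(** Vertices peeled at a lower threshold stay peeled. The recorded [threshold] is at most [4 * d]
    because nothing remains to be peeled at larger values of [K]. *)
Definition thresholds K m : Prop :=
  [/\ peel_ok m, threshold m <= K, threshold m <= 4 * d & 4 * d < K -> remaining m = 0].

Definition round_size : nat := n.+1 + bitlen n * pass_size.

Lemma sum_round_factor : \sum_(p < n) round_factor p <= n + bitlen n * pass_size.
Proof.
apply: (@leq_trans (\sum_(p < n) (1 + (p < bitlen n) * pass_size))).
  apply: leq_sum => p _; rewrite /round_factor; case: ifP => // hp.
  suff -> : p < bitlen n by rewrite mul1n; lia.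
  rewrite /bitlen ltnS; apply: trunc_log_max => //.
  by move: hp; rewrite -lt0n divn_gt0 // expn_gt0.
rewrite big_split /= sum1_card card_ord leq_add2l -big_distrl leq_mul2r.
apply/orP; right.
rewrite -(big_mkord xpredT (fun p => nat_of_bool (p < bitlen n))).
rewrite -[X in _ <= X]card_ord -sum1_card.
have [le|lt] := leqP n (bitlen n).
  apply: leq_trans (_ : n <= _); last by rewrite sum1_card card_ord.
  rewrite -[X in _ <= X]subn0 -[X in _ <= X]muln1 -sum_nat_const_nat.
  by apply: leq_sum => p _; rewrite leq_b1.
rewrite (big_cat_nat (n := bitlen n)) //=; last exact: ltnW.
rewrite [X in _ + X]big_nat_cond [X in _ + X]big1 ?addn0; last first.
  by move=> p /andP[/andP[h _] _]; rewrite ltnNge h.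
rewrite big_mkord; apply: leq_sum => p _; exact: leq_b1.
Qed.

Lemma threshold_hoare K : K <= 4 * n ->
  hoare M [:: k; n; b; g; K] (thresholds K) c_threshold
    (cweight X c_threshold * (if K <= 4 * d then round_size else 1)) (thresholds K.+1).
Proof.
move=> Kn; apply: hoare_pre => m bm _ [h1 h2 h3 h4]; set env := [:: k; _; _; _; _].
have e8 : b + 8 * 2 + 8 <= M.
  by apply: leq_trans M_adr; rewrite leq_add2r leq_add2l leq_mul2l mulnS; lia.
have ev3 i m1 : i <= 2 -> evals M X m1 env (earr 3 (ENum i)) (m1 (adr b 3 i)).
  by move=> i2; apply: ev_arr; [by []|by []|ev|lia].
pose m0 := upd m (adr b 3 1) n.
have r0 : remaining m0 = remaining m by rewrite /remaining /m0 upd_adr.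
have t0 : threshold m0 = threshold m by rewrite /threshold /m0 upd_adr.
have first : hoare M env (eq m) (CStore (eadr 3 (ENum 1)) (EVar 1))
    (cweight X (CStore (eadr 3 (ENum 1)) (EVar 1))) (eq m0).
  apply: (@hoare_store M X M_gt0) => _ _ <-; exists (adr b 3 1), n; split=> //.
  - by apply: ev_adr => //; [ev|lia].
  - exact: (EvVar _ _ _ env 1).
have evc m1 : evals M X m1 env (ECond (earr 3 (ENum 0)) (EVar 1) (ENum 0))
    (if remaining m1 != 0 then n else 0).
  by apply: ev_cond; [exact: ev3|move=> _; exact: (EvVar _ _ _ env 1)|move=> _; ev].
have [rz|rn] := eqVneq (remaining m) 0.
  eapply hoare_conseq with (P' := eq m) (Q' := eq m0); [| |try by []|try by []].
  - apply: hoare_seq first _.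
    apply: (@hoare_for M X M_gt0 _ (fun=> eq m0) _ _ 0 (fun=> 0)) => // m1 _ <-.
    by have := evc m0; rewrite r0 rz.
  - rewrite big_ord0; have cw A B D N : 0 < N -> A + (B + 2 + 0) <= (A + (B + 2 + (D + 4))) * N.
      by case: N => // N _; rewrite mulnS; lia.
    by apply: cw; case: ifP.
  - move=> _ _ <-; split; rewrite ?r0 ?t0 //; first exact: peel_ok_budget.
    exact: leqW.
have Kd : K <= 4 * d by rewrite leqNgt; apply/negP => /h4 e; rewrite e in rn.
(* At index 0 the invariant pins the memory, because the length of the loop is read from it. *)
pose I p m1 := if p is p'.+1 then halving K p m1 else m0 = m1.
have I_halving p m1 : I p m1 -> halving K p m1.
  case: p => // <-; split; first exact: peel_ok_budget.
  - by rewrite t0.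
  - by rewrite /budget /m0 upd_adr // expn0 divn1.
  - rewrite r0 (po_rem h1) expn0 divn1 => _.
    by rewrite (leq_trans (count_size _ _)) // size_iota.
rewrite Kd; eapply hoare_conseq with (P' := eq m) (Q' := I n); [| |try by []|try by []].
- apply: hoare_seq first _.
  apply: (@hoare_for M X M_gt0 _ I _ _ n (fun p => cweight X c_round * round_factor p)).
    by move=> m1 _ <-; have := evc m0; rewrite r0 rn.
  move=> p pn; eapply hoare_conseq with (P' := halving K p) (Q' := halving K p.+1); [| |try by []|try by []].
  + exact: round_hoare.
  + exact: leqnn.
  + by move=> m1 _ _; apply: I_halving.
- rewrite big_split /= -big_distrr /= sum_nat_const card_ord /round_size.
  have cw A B D N S T : S <= N + T ->
      A + (B + 2 + (D * S + N * 4)) <= (A + (B + 2 + (D + 4))) * (N.+1 + T).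
    by move=> h; rewrite !mulnDl !mulnDr !mulnS; have := leq_mul (leqnn D) h; rewrite mulnDr; lia.
  exact: cw sum_round_factor.
- move=> m1 _ /I_halving[g1 g2 g3 g4]; split=> //; first exact: leqW.
  + exact: leq_trans g2 Kd.
  + move=> dK; have {}dK : 4 * d <= K by rewrite -ltnS.
    (* Since [n < 2 ^ n], the bound on the remaining vertices is 0 after [n] rounds. *)
    have := g4 dK; rewrite divn_small; last exact: ltn_expl.
    by rewrite leqn0 => /eqP.
Qed.

Definition peel_size : nat := (4 * d).+1 * round_size + (4 * n).+2.

Lemma peel_hoare :
  hoare M [:: k; n; b; g]
    (fun m => positioned m /\ forall j i, 0 < j -> j < 8 -> m (adr b j i) = 0) c_peel
    (cweight X c_peel * peel_size)
    (fun m => [/\ peel_ok m, threshold m <= 4 * d & remaining m = 0]).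
Proof.
set env := [:: k; _; _; _].
have e8 : b + 8 * 2 + 8 <= M.
  by apply: leq_trans M_adr; rewrite leq_add2r leq_add2l leq_mul2l mulnS; lia.
eapply hoare_conseq with
  (P' := fun m => positioned m /\ forall j i, 0 < j -> j < 8 -> m (adr b j i) = 0)
  (Q' := thresholds (4 * n + 1)); [| |try by []|try by []].
- apply: (@hoare_seq _ _ _ (thresholds 0)).
    apply: (@hoare_store M X M_gt0) => m _ [h1 h2]; exists (adr b 3 0), n; split.
    + by apply: ev_adr => //; [ev|lia].
    + exact: (EvVar _ _ _ env 1).
    + set m' := upd _ _ _.
      have fE z : flag m' z = 0 by rewrite /flag /m' upd_adr // h2.
      have tE : threshold m' = 0 by rewrite /threshold /m' upd_adr // h2.
      split=> //; rewrite ?tE //; split; try (by move=> z; rewrite fE); try (by move=> z y; rewrite fE).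
      * exact: positioned_upd.
      * rewrite /remaining /m' upd_adr //= -[LHS](size_iota 0).
        by rewrite -(count_predT (iota 0 n)); apply: eq_count => z; rewrite /= fE.
  apply: (@hoare_for M X M_gt0 _ thresholds _ _ _
    (fun K => cweight X c_threshold * (if K <= 4 * d then round_size else 1))) => [m _ _|K Kn].
    by rewrite /eadd /emul; ev; rewrite /=; lia.
  by apply: threshold_hoare; lia.
- rewrite big_split /= -big_distrr /= sum_nat_const card_ord.
  have le : \sum_(K < 4 * n + 1) (if K <= 4 * d then round_size else 1) <=
      (4 * d).+1 * round_size + (4 * n + 1).
    apply: (@leq_trans (\sum_(K < 4 * n + 1) ((if K < (4 * d).+1 then round_size else 0) + 1))).
      by apply: leq_sum => K _; rewrite ltnS; case: ifP => _; lia.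
    rewrite big_split /= sum1_card card_ord leq_add2r.
    rewrite -(big_mkord xpredT (fun K => if K < (4 * d).+1 then round_size else 0)).
    rewrite (big_cat_nat (n := (4 * d).+1)) //=; last by lia.
    rewrite [X in _ + X]big_nat_cond [X in _ + X]big1 ?addn0; last first.
      by move=> p /andP[/andP[h _] _]; rewrite ltnNge h.
    rewrite -[X in _ <= X * _]subn0 -sum_nat_const_nat big_nat_cond [X in _ <= X]big_nat_cond.
    by apply: leq_sum => p; case: ifP.
  rewrite /peel_size; have cw A B D N S T : S <= T + N ->
      A + (B + 2 + (D * S + N * 4)) <= (A + (B + 2 + (D + 4))) * (T + N.+1).
    by move=> h; rewrite !mulnDl !mulnDr !mulnS; have := leq_mul (leqnn D) h; rewrite mulnDr; lia.
  rewrite -[(4 * n).+1]addn1; exact: cw le.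
- move=> m _ [h1 h2 h3 h4]; split=> //; apply: h4; lia.
Qed.

Definition oriented m x y : bool := (x < n) && (y \in outs m x).

Lemma all_peeled m x : peel_ok m -> remaining m = 0 -> x < n -> flag m x = 1.
Proof.
move=> hm r0 xn; have := po_flag hm xn; case E: (flag m x) => [|[|]] // _.
have := po_rem hm; rewrite r0 => /esym/eqP; rewrite -leqn0 leqNgt -has_count.
by case/hasP; exists x; rewrite ?mem_iota //= E.
Qed.

Lemma oriented_adj m x y : peel_ok m -> remaining m = 0 -> x < n -> y < n ->
  (y \in NL x) = oriented m x y || oriented m y x.
Proof.
move=> hm r0 xn yn; have fx := all_peeled hm r0 xn; have fy := all_peeled hm r0 yn.
rewrite /oriented xn yn /=; apply/idP/orP => [xy|[h|h]].
- have := po_one hm xn xy fx fy.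
  by case: (x \in outs m y) => /=; [right|left].
- exact: (po_sub hm xn fx h).
- by rewrite NL_sym //; exact: (po_sub hm yn fy h).
Qed.

Lemma oriented_excl m x y : peel_ok m -> remaining m = 0 ->
  ~~ (oriented m x y && oriented m y x).
Proof.
move=> hm r0; apply/negP => /andP[/andP[xn xy] /andP[yn yx]].
have fx := all_peeled hm r0 xn; have fy := all_peeled hm r0 yn.
by have := po_one hm xn (po_sub hm xn fx xy) fx fy; rewrite xy yx.
Qed.

Lemma cell_le m x : peel_ok m -> remaining m = 0 -> x < n -> cell m x 0 <= threshold m.
Proof. by move=> hm r0 xn; apply: (po_cnt hm) => //; apply: all_peeled. Qed.

Lemma oriented_lt m x y : peel_ok m -> remaining m = 0 -> oriented m x y -> y < n.
Proof.
move=> hm r0 /andP[xn xy].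
exact: NL_lt (po_sub hm xn (all_peeled hm r0 xn) xy).
Qed.

End Peel.

(** * Evaluating the greedy splitting *)

Ltac ev_spec ::=
  lazymatch goal with
  | |- evals _ _ _ _ e_eq _ => apply: evals_eqn
  | |- evals _ _ _ _ e_lt _ => apply: evals_ltn
  | |- evals _ _ _ _ e_mod _ => apply: evals_mod
  | |- evals _ _ _ _ e_pow _ => apply: evals_pow
  | |- evals _ _ _ _ e_digit _ => apply: evals_digit
  | |- _ => idtac
  end.

Definition dig (B c v : expr) : expr := ecall e_digit [:: B; c; v].
Definition succ (e : expr) : expr := EBin Add e (ENum 1).
Definition not_ (e : expr) : expr := ECond e (ENum 0) (ENum 1).

Definition e_label : expr :=
  dig (ENum 4) (EVar 1) (EBin Add (EBin Mul (EVar 2) (EVar 0)) (EVar 3)).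
Definition e_arc : expr :=
  ECond (ecall e_lt [:: EVar 2; EVar 3])
    (ecall e_mod [:: ecall e_label [:: EVar 0; EVar 1; EVar 2; EVar 3]; ENum 2])
    (ECond (ecall e_lt [:: EVar 3; EVar 2])
       (EBin Div (ecall e_label [:: EVar 0; EVar 1; EVar 3; EVar 2]) (ENum 2))
       (ENum 0)).
Definition e_deleted : expr :=
  EIter (EVar 0) (ENum 0)
    (ECond (EIter (EVar 0) (ENum 0)
              (ECond (ECond (dig (ENum 2) (EVar 3) (EVar 4)) (ENum 0)
                        (ecall e_arc [:: EVar 0; EVar 1; EVar 4; EVar 2]))
                 (ENum 1) (EVar 5)))
       (EBin Add (EVar 3) (ecall e_pow [:: ENum 2; EVar 2])) (EVar 3)).
Definition e_rank : expr :=
  EIter (EVar 1) (ENum 0)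
    (ECond (not_ (dig (ENum 2) (EVar 0) (EVar 2))) (succ (EVar 3)) (EVar 3)).
Definition e_is_root : expr :=
  ECond (dig (ENum 2) (EVar 0) (EVar 2)) (ENum 0)
    (ecall e_eq [:: ecall e_mod [:: ecall e_rank [:: EVar 0; EVar 2]; ENum 2]; EVar 1]).
Definition e_init : expr :=
  EIter (EVar 0) (ENum 0)
    (ECond (ecall e_is_root [:: EVar 2; EVar 3; EVar 5])
       (EBin Add (EVar 6)
          (EBin Mul (ecall e_pow [:: succ (EVar 1); EVar 5])
             (succ (dig (EVar 1) (EVar 4)
                      (EBin Div (ecall e_rank [:: EVar 2; EVar 5]) (ENum 2))))))
       (EVar 6)).
Definition e_nbr : expr :=
  ECond (EVar 4)
    (ECond (EBin Defs.Sub (EVar 4) (earr 2 (eslot (EVar 3) (ENum 0)))) (EVar 3)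
       (earr 2 (eslot (EVar 3) (EVar 4))))
    (EVar 3).
Definition e_parent : expr :=
  EIter (EVar 0) (ENum 0)
    (ECond (ECond (dig (succ (EVar 1)) (EVar 3) (EVar 5))
              (ecall e_arc [:: EVar 0; EVar 2; EVar 5; EVar 4]) (ENum 0))
       (succ (EVar 5)) (EVar 6)).
Definition e_sweep_step : expr :=
  ECond (dig (succ (EVar 1)) (EVar 6) (EVar 7)) (EVar 6)
    (ELet (ecall e_parent [:: EVar 0; EVar 1; EVar 3; EVar 6; EVar 7])
       (ECond (EVar 8)
          (EBin Add (EVar 6)
             (EBin Mul (ecall e_pow [:: succ (EVar 1); EVar 7])
                (succ (ecall e_nbr
                  [:: EVar 0; EVar 1; EVar 2;
                      EBin Defs.Sub
                        (dig (succ (EVar 1)) (EVar 6) (EBin Defs.Sub (EVar 8) (ENum 1)))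
                        (ENum 1);
                      dig (EVar 4) (EVar 5) (EVar 7)]))))
          (EVar 6))).
Definition e_sweep : expr :=
  EIter (EVar 0) (EVar 6)
    (ecall e_sweep_step [:: EVar 0; EVar 1; EVar 2; EVar 3; EVar 4; EVar 5; EVar 8;
       EBin Defs.Sub (EBin Defs.Sub (EVar 0) (ENum 1)) (EVar 7)]).
Definition e_gen : expr :=
  ecall e_sweep [:: EVar 0; EVar 1; EVar 2; EVar 3; EVar 6; EVar 8;
    ecall e_sweep [:: EVar 0; EVar 1; EVar 2; EVar 3; EVar 6; EVar 8;
      ecall e_init [:: EVar 0; EVar 1; EVar 4; EVar 5; EVar 7]]].
Definition e_out : expr :=
  EIter (earr 2 (eslot (EVar 3) (ENum 0))) (ENum 0)
    (ECond (ecall e_eq [:: earr 2 (eslot (EVar 3) (succ (EVar 5))); EVar 4])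
       (ENum 1) (EVar 6)).
Definition e_sat : expr :=
  ECond (EVar 3)
    (ECond (ecall e_eq [:: EVar 3; ENum 1])
       (ecall e_out [:: EVar 0; EVar 1; EVar 2; EVar 4; EVar 5])
       (ECond (ecall e_eq [:: EVar 3; ENum 2])
          (ecall e_out [:: EVar 0; EVar 1; EVar 2; EVar 5; EVar 4])
          (ecall e_eq [:: EVar 4; EVar 5])))
    (ENum 1).
Definition e_pair_ok : expr :=
  ECond (ecall e_lt [:: EVar 5; EVar 6])
    (ECond (dig (succ (EVar 1)) (EVar 4) (EVar 5))
       (ECond (dig (succ (EVar 1)) (EVar 4) (EVar 6))
          (ecall e_sat [:: EVar 0; EVar 1; EVar 2;
             ecall e_label [:: EVar 0; EVar 3; EVar 5; EVar 6];
             EBin Defs.Sub (dig (succ (EVar 1)) (EVar 4) (EVar 5)) (ENum 1);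
             EBin Defs.Sub (dig (succ (EVar 1)) (EVar 4) (EVar 6)) (ENum 1)])
          (ENum 1))
       (ENum 1))
    (ENum 1).
Definition e_consistent : expr :=
  EIter (EVar 0) (ENum 1)
    (EIter (EVar 0) (EVar 6)
       (ECond (ecall e_pair_ok [:: EVar 0; EVar 1; EVar 2; EVar 3; EVar 4; EVar 5; EVar 7])
          (EVar 8) (ENum 0))).
Definition e_restrict : expr :=
  EIter (EVar 0) (ENum 0)
    (EBin Add (EVar 5)
       (EBin Mul (ecall e_pow [:: succ (EVar 1); EVar 4])
          (ECond (dig (succ (EVar 1)) (EVar 3) (EVar 4))
             (dig (succ (EVar 1)) (EVar 2) (EVar 4)) (ENum 0)))).

Lemma pair_index_lt k u v : u < k -> v < k -> u * k + v < k * k.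
Proof.
move=> uk vk; have : u.+1 * k <= k * k by rewrite leq_mul2r uk orbT.
by rewrite mulSn; lia.
Qed.

Section Plan.

Variables (M X k n b lam : nat) (m : nat -> nat).
Hypothesis M_ge : 256 <= M.
Hypothesis kX : k * k + k + 2 <= X.
Hypothesis M_k : k * k + k + 2 <= M.
Hypothesis M_N : n.+1 ^ k <= M.
Hypothesis M_4 : 4 ^ (k * k) <= M.
Hypothesis M_adr : b + 8 * (n.+1 * n.+2) + 8 <= M.
Hypothesis lam_lt : lam < 4 ^ (k * k).
Hypothesis n_gt0 : 0 < n.

Local Notation evm := (evals M X m).

(** For [u < v], labels 1 and 3 give an arc from [u] to [v], labels 2 and 3 one from [v] to [u]: an
    equality can be followed in both directions. *)
Definition arc_of (u v : nat) : bool :=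
  if u < v then label k lam u v %% 2 == 1
  else if v < u then 2 <= label k lam v u else false.

Let M_pow4 i : i <= k * k -> 4 ^ i <= M.
Proof. by move=> h; apply: leq_trans M_4; rewrite leq_pexp2l. Qed.

Let k_kk : k <= k * k. Proof. by case: (k) => // k'; rewrite mulSn leq_addr. Qed.

Let M_pow2 i : i <= k -> 2 ^ i <= M.
Proof.
move=> h; apply: leq_trans (M_pow4 (leq_trans h k_kk)).
by rewrite -[4]/(2 ^ 2) -expnM leq_pexp2l // leq_pmull.
Qed.

Let M_powN i : i <= k -> n.+1 ^ i <= M.
Proof. by move=> h; apply: leq_trans M_N; rewrite leq_pexp2l. Qed.

Let n_M : n.+1 <= M.
Proof.
apply: leq_trans M_adr; have : n.+1 <= n.+1 * n.+2 by rewrite leq_pmulr.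
lia.
Qed.

Lemma evals_label u v : u < k -> v < k -> evm [:: k; lam; u; v] e_label (label k lam u v).
Proof.
move=> uk vk; have h := pair_index_lt uk vk.
rewrite /e_label /dig; ev.
by apply: M_pow4; lia.
Qed.

Lemma label_lt u v : label k lam u v < 4.
Proof. exact: digit_lt. Qed.

Ltac ev_spec ::=
  lazymatch goal with
  | |- evals _ _ _ _ e_eq _ => apply: evals_eqn
  | |- evals _ _ _ _ e_lt _ => apply: evals_ltn
  | |- evals _ _ _ _ e_mod _ => apply: evals_mod
  | |- evals _ _ _ _ e_pow _ => apply: evals_pow
  | |- evals _ _ _ _ e_digit _ => apply: evals_digit
  | |- evals _ _ _ _ e_label _ => apply: evals_label
  | |- _ => idtac
  end.

Lemma evals_arc u v : u < k -> v < k -> evm [:: k; lam; u; v] e_arc (arc_of u v).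
Proof.
move=> uk vk; have h1 := label_lt u v; have h2 := label_lt v u.
rewrite /e_arc; eapply ev_eq; first by ev.
rewrite /= /arc_of !eqb0; case: (ltngtP u v) => //= _.
  by move: h1; case: (label _ _ _ _) => [|[|[|[|]]]].
by move: h2; case: (label _ _ _ _) => [|[|[|[|]]]].
Qed.

Lemma arc_of_irr v : arc_of v v = false.
Proof. by rewrite /arc_of ltnn. Qed.

Local Notation del := (deleted k arc_of).

Lemma del_le i : i <= k -> iteri i (del_step k arc_of) 0 <= M.
Proof.
move=> ik; have [h _] := deleted_inv arc_of ik.
by apply: leq_trans (ltnW h) _; apply: M_pow2.
Qed.

Ltac ev_spec ::=
  lazymatch goal with
  | |- evals _ _ _ _ e_eq _ => apply: evals_eqn
  | |- evals _ _ _ _ e_lt _ => apply: evals_ltn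
  | |- evals _ _ _ _ e_mod _ => apply: evals_mod
  | |- evals _ _ _ _ e_pow _ => apply: evals_pow
  | |- evals _ _ _ _ e_digit _ => apply: evals_digit
  | |- evals _ _ _ _ e_label _ => apply: evals_label
  | |- evals _ _ _ _ e_arc _ => apply: evals_arc
  | |- _ => idtac
  end.

Lemma evals_deleted : evm [:: k; lam] e_deleted del.
Proof.
apply: ev_iter; [by ev|by lia|by ev|move=> v vk; rewrite /=].
set acc := iteri v _ 0; have accM : acc <= M by apply: del_le; apply: ltnW.
have step : evm [:: k; lam; v; acc]
  (EIter (EVar 0) (ENum 0)
     (ECond (ECond (dig (ENum 2) (EVar 3) (EVar 4)) (ENum 0)
               (ecall e_arc [:: EVar 0; EVar 1; EVar 4; EVar 2]))
        (ENum 1) (EVar 5)))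
  (has (fun u => (digit 2 acc u == 0) && arc_of u v) (iota 0 k)).
  rewrite -iteri_has; apply: ev_iter; [by ev|by lia|by ev|move=> u uk; rewrite /=].
  have pu : 2 ^ u <= M by apply: M_pow2; apply: ltnW.
  rewrite /dig; eapply ev_eq; first by ev.
  by rewrite /=; case: (digit 2 acc u == 0); case: (arc_of u v).
have [hb hd] := deleted_inv arc_of vk; rewrite [iteri v.+1 _ _]/= -/acc in hb.
have pv : 2 ^ v <= M by apply: M_pow2; apply: ltnW.
rewrite /del_step in hb *; eapply ev_eq.
  apply: ev_cond; [exact: step|move=> hc; ev|move=> _; ev].
  rewrite /=; move: hb; case: has hc => //= _ hb; apply: leq_trans (ltnW hb) _; exact: M_pow2.
by rewrite /=; case: has.
Qed.

Lemma digit_del_le u : u < k -> 2 ^ u <= M.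
Proof. by move=> h; apply: M_pow2; apply: ltnW. Qed.

Lemma del_leM : del <= M.
Proof. exact: del_le. Qed.

Lemma evals_rank v : v < k -> evm [:: del; v] e_rank (rank k arc_of v).
Proof.
move=> vk; rewrite /rank -iteri_count; have dM := del_leM.
apply: ev_iter; [by ev|by lia|by ev|move=> u uv; rewrite /=].
have pu : 2 ^ u <= M by apply: digit_del_le; lia.
have cu : iteri u (fun i acc => if digit 2 del i == 0 then acc.+1 else acc) 0 <= u.
  by rewrite iteri_count (leq_trans (count_size _ _)) // size_iota.
rewrite /dig /not_ /succ; eapply ev_eq; first by ev.
by rewrite /=; case: (digit 2 del u == 0); rewrite /= ?addn1.
Qed.

Lemma rank_le v : rank k arc_of v <= v.
Proof. by rewrite /rank (leq_trans (count_size _ _)) // size_iota. Qed.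

Ltac ev_spec ::=
  lazymatch goal with
  | |- evals _ _ _ _ e_eq _ => apply: evals_eqn
  | |- evals _ _ _ _ e_lt _ => apply: evals_ltn
  | |- evals _ _ _ _ e_mod _ => apply: evals_mod
  | |- evals _ _ _ _ e_pow _ => apply: evals_pow
  | |- evals _ _ _ _ e_digit _ => apply: evals_digit
  | |- evals _ _ _ _ e_label _ => apply: evals_label
  | |- evals _ _ _ _ e_arc _ => apply: evals_arc
  | |- evals _ _ _ _ e_rank _ => apply: evals_rank
  | |- _ => idtac
  end.

Lemma evals_is_root side v : v < k ->
  evm [:: del; side; v] e_is_root (is_root k arc_of side v).
Proof.
move=> vk; have dM := del_leM; have pv := digit_del_le vk; have rv := rank_le v.
rewrite /e_is_root /dig; eapply ev_eq; first by ev.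
by rewrite /= /is_root; case: (digit 2 del v == 0).
Qed.

Lemma evals_init side a : a <= M -> n ^ k <= M ->
  evm [:: k; n; del; side; a] e_init (init_code k n arc_of side (digit n a)).
Proof.
move=> aM nkM; have dM := del_leM.
apply: ev_iter; [by ev|by lia|by ev|move=> v vk; rewrite /=].
set acc := iteri v _ 0; have rv := rank_le v.
have an j : digit n a j < n by apply: digit_lt.
have [hb _] := init_inv arc_of side an vk; rewrite [iteri v.+1 _ _]/= -/acc in hb.
have pv := M_powN (ltnW vk).
have rt : evm [:: k; n; del; side; a; v; acc]
    (ecall e_is_root [:: EVar 2; EVar 3; EVar 5]) (is_root k arc_of side v).
  by eapply ev_call; [ev|apply: evals_is_root].
have pr : n ^ (rank k arc_of v %/ 2) <= M.
  by apply: leq_trans nkM; rewrite leq_pexp2l // (leq_trans (leq_div _ _)) //; lia.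
have rX : rank k arc_of v %/ 2 <= X by have := leq_div (rank k arc_of v) 2; lia.
rewrite /init_step in hb *; have hbM := leq_trans (ltnW hb) M_N.
eapply ev_eq.
  apply: ev_cond; [exact: rt|move=> hr|move=> _; ev].
  have {}hr : is_root k arc_of side v by case: is_root hr.
  rewrite hr in hbM; have da := an (rank k arc_of v %/ 2).
  have pm : n.+1 ^ v * (digit n a (rank k arc_of v %/ 2)).+1 <= M by lia.
  by rewrite /dig /succ; ev; rewrite /= ?addn1 //; lia.
by rewrite /=; case: is_root; rewrite //= !addn1.
Qed.

(** Choice 0 is the vertex itself, which is how equalities are followed. An index beyond the list
    also yields [x], so every choice leads to a vertex. *)
Definition nbr (x j : nat) : nat :=
  if (j != 0) && (j <= cell n b m x 0) then cell n b m x j else x.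

Hypothesis cell_le_n : forall x, x < n -> cell n b m x 0 <= n.

Lemma evals_nbr x j : x < n -> evm [:: k; n; b; x; j] e_nbr (nbr x j).
Proof.
move=> xn; have c0 := cell_le_n xn.
have hs i : i <= n -> b + 8 * slot n x i + 8 <= M /\ slot n x i + n + 1 <= M.
  move=> i_n; have h : slot n x i <= n * (n + 1) + n.
    rewrite /slot leq_add // leq_mul2r (ltnW xn) orbT //.
  by split; apply: leq_trans M_adr; rewrite !mulSn !mulnS; lia.
have e0 env : nth 0 env 1 = n -> nth 0 env 2 = b -> nth 0 env 3 = x ->
    evm env (earr 2 (eslot (EVar 3) (ENum 0))) (cell n b m x 0).
  move=> h1 h2 h3; have [s1 s2] := hs 0 isT; apply: ev_arr => //.
  by apply: ev_slot => //; [rewrite -h3; ev|ev].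
rewrite /e_nbr /nbr; eapply ev_eq.
  apply: ev_cond; [ev|move=> /= j0|move=> _; ev].
  apply: ev_cond; [ev; exact: e0|move=> _; ev|move=> /= jc].
  have [s1 s2] := hs j ltac:(lia).
  by apply: ev_arr; [by []|by []|apply: ev_slot => //; ev|exact: s1].
rewrite /= subn_eq0 -/(cell n b m x j).
by case: (j == 0); case: (j <= _).
Qed.

Lemma evals_parent c v : v < k -> c <= M ->
  evm [:: k; n; lam; c; v] e_parent (parent k n arc_of c v).
Proof.
move=> vk cM; apply: ev_iter; [by ev|by lia|by ev|move=> u uk; rewrite /=].
have pu := M_powN (ltnW uk).
set acc := iteri u _ 0.
rewrite /dig /succ; eapply ev_eq; first by ev; rewrite /= ?addn1 //.
by rewrite /= !addn1; case: (digit n.+1 c u == 0); case: (arc_of u v).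
Qed.

Ltac ev_spec ::=
  lazymatch goal with
  | |- evals _ _ _ _ e_eq _ => apply: evals_eqn
  | |- evals _ _ _ _ e_lt _ => apply: evals_ltn
  | |- evals _ _ _ _ e_mod _ => apply: evals_mod
  | |- evals _ _ _ _ e_pow _ => apply: evals_pow
  | |- evals _ _ _ _ e_digit _ => apply: evals_digit
  | |- evals _ _ _ _ e_label _ => apply: evals_label
  | |- evals _ _ _ _ e_arc _ => apply: evals_arc
  | |- evals _ _ _ _ e_rank _ => apply: evals_rank
  | |- evals _ _ _ _ e_nbr _ => apply: evals_nbr
  | |- evals _ _ _ _ e_parent _ => apply: evals_parent
  | |- _ => idtac
  end.

Hypothesis outs_lt : forall x y, x < n -> y \in outs n b m x -> y < n.
Hypothesis cell_le_X : forall x, x < n -> cell n b m x 0 <= X.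

Lemma nbr_lt x j : x < n -> nbr x j < n.
Proof.
move=> xn; rewrite /nbr; case: ifP => // /andP[j0 jc]; apply: (outs_lt xn).
by apply/mapP; exists j.-1; rewrite ?mem_iota prednK ?lt0n.
Qed.

Lemma evals_sweep_step B beta c v : v < k -> c < n.+1 ^ k -> beta <= M -> B ^ k <= M -> 0 < B ->
  evm [:: k; n; b; lam; B; beta; c; v] e_sweep_step
    (sweep_step k n arc_of nbr (digit B beta) c v).
Proof.
move=> vk ck bM BM B0; have cM : c <= M by apply: leq_trans (ltnW ck) M_N.
have pv := M_powN (ltnW vk).
have pB : B ^ v <= M by apply: leq_trans BM; rewrite leq_pexp2l // ltnW.
have good := sweep_step_good arc_of nbr_lt (digit B beta) vk ck.
have goodM := leq_trans (ltnW good) M_N.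
rewrite /e_sweep_step /dig /succ.
apply: (@EvCond _ _ _ _ _ _ _ (digit n.+1 c v)) => [|d|d].
- by rewrite -[in X in evals _ _ _ _ _ X]addn1; ev; rewrite ?addn1.
- by rewrite /sweep_step d; exact: (EvVar _ _ _ [:: k; n; b; lam; B; beta; c; v] 6).
apply: (@EvLet _ _ _ _ _ _ (parent k n arc_of c v)); first by ev.
rewrite /= /sweep_step d eqxx /= in good goodM *.
have := parentP k n arc_of c v; case: (parent k n arc_of c v) good goodM => [|u] good goodM hp.
  apply: (@EvCond _ _ _ _ _ _ _ 0) => // [|_].
    exact: (EvVar _ _ _ [:: k; n; b; lam; B; beta; c; v; 0] 8).
  exact: (EvVar _ _ _ [:: k; n; b; lam; B; beta; c; v; 0] 6).
have [uk du a] := hp; have pu := M_powN (ltnW uk).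
have xn := digit_pred_lt du; have yn := nbr_lt (digit B beta v) xn.
have vB := @digit_lt B beta v B0.
apply: (@EvCond _ _ _ _ _ _ _ u.+1) => // [|_].
  exact: (EvVar _ _ _ [:: k; n; b; lam; B; beta; c; v; u.+1] 8).
set w := (nbr _ _).+1; rewrite -/w in goodM.
have wM : n.+1 ^ v * w <= M by lia.
have ew : evm [:: k; n; b; lam; B; beta; c; v; u.+1]
   (EBin Add (ecall e_nbr [:: EVar 0; EVar 1; EVar 2;
      EBin Defs.Sub (ecall e_digit [:: EBin Add (EVar 1) (ENum 1); EVar 6;
         EBin Defs.Sub (EVar 8) (ENum 1)]) (ENum 1);
      ecall e_digit [:: EVar 4; EVar 5; EVar 7]]) (ENum 1)) w.
  apply: (@ev_eq _ _ _ _ _ (op_sem Add (nbr (digit n.+1 c u).-1 (digit B beta v)) 1)); last by rewrite /= addn1.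
  apply: EvBin; [|by ev|by rewrite /= addn1; lia].
  eapply ev_call; last exact: evals_nbr.
  do 3!(eapply EvCons; first by ev).
  eapply EvCons; last by ev.
  apply: (@ev_eq _ _ _ _ _ (digit (n + 1) c (u.+1 - 1) - 1)); last by rewrite addn1 !subn1.
  by ev; rewrite /= ?addn1 ?subn1.
apply: EvBin; [exact: (EvVar _ _ _ [:: k; n; b; lam; B; beta; c; v; u.+1] 6)| |exact: goodM].
apply: EvBin; [|exact: ew|exact: wM].
by apply: (@ev_eq _ _ _ _ _ ((n + 1) ^ v)); [ev; rewrite ?addn1|rewrite addn1].
Qed.

Lemma evals_sweep B beta c : c < n.+1 ^ k -> beta <= M -> B ^ k <= M -> 0 < B ->
  evm [:: k; n; b; lam; B; beta; c] e_sweep (sweep k n arc_of nbr (digit B beta) c).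
Proof.
move=> ck bM BM B0.
have e i : foldl (sweep_step k n arc_of nbr (digit B beta)) c [seq k.-1 - t | t <- iota 0 i] =
    iteri i (fun t acc => sweep_step k n arc_of nbr (digit B beta) acc (k.-1 - t)) c.
  by rewrite iteri_foldl; elim: (iota 0 i) c {ck} => //= t s IH c.
rewrite /sweep /sweep_order e; apply: ev_iter; [by ev|by lia|by ev|move=> t tk; rewrite /=].
set acc := iteri t _ c; have acck : acc < n.+1 ^ k.
  rewrite /acc; elim: (t) (tk) => //= t' IH t'k; apply: sweep_step_good; [exact: nbr_lt|lia|].
  by apply: IH; apply: ltnW.
eapply ev_call; last by apply: evals_sweep_step => //; lia.
eapply EvCons; first by ev.
eapply EvCons; first by ev.
eapply EvCons; first by ev.
eapply EvCons; first by ev.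
eapply EvCons; first by ev.
eapply EvCons; first by ev.
eapply EvCons; first by ev.
eapply EvCons; last by ev.
by rewrite -subn1; ev.
Qed.

Lemma evals_gen side B a beta : a <= M -> n ^ k <= M -> beta <= M -> B ^ k <= M -> 0 < B ->
  evm [:: k; n; b; lam; del; side; B; a; beta] e_gen
    (gen k n arc_of nbr side (digit n a) (digit B beta)).
Proof.
move=> aM nM bM BM B0; have an j : digit n a j < n by apply: digit_lt.
have i0 := init_good k arc_of side an.
have i1 := sweep_good arc_of nbr_lt (digit B beta) i0.
rewrite /e_gen; eapply ev_call; last by apply: evals_sweep; [exact: i1|..].
do 6!(eapply EvCons; first by ev).
eapply EvCons; last by ev.
eapply ev_call; last by apply: evals_sweep; [exact: i0|..].
do 6!(eapply EvCons; first by ev).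
eapply EvCons; last by ev.
eapply ev_call; last by apply: evals_init.
by ev.
Qed.

Lemma cell_bounds x j : x < n -> j <= n ->
  b + 8 * slot n x j + 8 <= M /\ slot n x j + n + 1 <= M.
Proof.
move=> xn jn; have h : slot n x j <= n * (n + 1) + n.
  by rewrite /slot leq_add // leq_mul2r (ltnW xn) orbT.
by split; apply: leq_trans M_adr; rewrite !mulSn !mulnS; lia.
Qed.

Lemma evals_out x y : x < n ->
  evm [:: k; n; b; x; y] e_out (oriented n b m x y).
Proof.
move=> xn; have cX := cell_le_X xn; have cn := cell_le_n xn.
have -> : oriented n b m x y = has (fun j => cell n b m x j.+1 == y) (iota 0 (cell n b m x 0)).
  rewrite /oriented xn /=; apply/mapP/hasP => [[j h ->]|[j h /eqP<-]]; by exists j.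
rewrite -iteri_has; apply: ev_iter.
- have [s1 s2] := cell_bounds xn (leq0n n).
  by apply: ev_arr; [by []|by []|apply: ev_slot => //; ev|exact: s1].
- exact: cX.
- by ev.
move=> j jc; rewrite /=; set acc := iteri j _ 0.
have jn : j.+1 <= n by lia.
have [s1 s2] := cell_bounds xn jn.
have es : evm [:: k; n; b; x; y; j; acc] (earr 2 (eslot (EVar 3) (succ (EVar 5)))) (cell n b m x j.+1).
  apply: ev_arr; [by []|by []|apply: ev_slot => //|exact: s1]; first by ev.
  by apply: (@ev_eq _ _ _ _ _ (j + 1)); [rewrite /succ; ev; rewrite /=; lia|rewrite addn1].
eapply ev_eq.
  apply: ev_cond; [|by move=> _; ev|by move=> _; ev].
  apply: (ev_call (vs := [:: cell n b m x j.+1; y])); last exact: evals_eqn.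
  by eapply EvCons; [exact: es|ev].
by rewrite /=; case: (_ == y).
Qed.

Ltac ev_spec ::=
  lazymatch goal with
  | |- evals _ _ _ _ e_eq _ => apply: evals_eqn
  | |- evals _ _ _ _ e_lt _ => apply: evals_ltn
  | |- evals _ _ _ _ e_mod _ => apply: evals_mod
  | |- evals _ _ _ _ e_pow _ => apply: evals_pow
  | |- evals _ _ _ _ e_digit _ => apply: evals_digit
  | |- evals _ _ _ _ e_label _ => apply: evals_label
  | |- evals _ _ _ _ e_out _ => apply: evals_out
  | |- _ => idtac
  end.

Lemma evals_sat l x y : x < n -> y < n ->
  evm [:: k; n; b; l; x; y] e_sat (sat (oriented n b m) l x y).
Proof.
move=> xn yn; rewrite /e_sat; eapply ev_eq; first by ev.
by case: l => [|[|[|l]]] //=; case: (oriented _ _ _ _ _).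
Qed.

Definition pair_ok (c u v : nat) : bool :=
  [&& u < v, digit n.+1 c u != 0 & digit n.+1 c v != 0] ==>
  sat (oriented n b m) (label k lam u v) (digit n.+1 c u).-1 (digit n.+1 c v).-1.

Lemma evals_pair_ok c u v : u < k -> v < k -> c <= M ->
  evm [:: k; n; b; lam; c; u; v] e_pair_ok (pair_ok c u v).
Proof.
move=> uk vk cM; have pu := M_powN (ltnW uk); have pv := M_powN (ltnW vk).
pose env := [:: k; n; b; lam; c; u; v].
have du : evm env (dig (succ (EVar 1)) (EVar 4) (EVar 5)) (digit n.+1 c u).
  apply: (@ev_eq _ _ _ _ _ (digit (n + 1) c u)); last by rewrite addn1.
  by rewrite /env /dig /succ; ev; rewrite ?addn1.
have dv : evm env (dig (succ (EVar 1)) (EVar 4) (EVar 6)) (digit n.+1 c v).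
  apply: (@ev_eq _ _ _ _ _ (digit (n + 1) c v)); last by rewrite addn1.
  by rewrite /env /dig /succ; ev; rewrite ?addn1.
apply: (@ev_eq _ _ _ _ _ (if u < v then if digit n.+1 c u != 0 then
   if digit n.+1 c v != 0 then
     sat (oriented n b m) (label k lam u v) (digit n.+1 c u).-1 (digit n.+1 c v).-1
   else true else true else true)); last first.
  by rewrite /pair_ok; case: (u < v); case: (digit n.+1 c u == 0); case: (digit n.+1 c v == 0).
apply: (@EvCond _ _ _ _ _ _ _ (u < v)).
- by ev.
- case: (u < v) => // _; apply: (EvCond du) => [d|->]; last by ev.
  rewrite d; apply: (EvCond dv) => [d'|->]; last by ev.
  rewrite d'; apply: (ev_call (vs := [:: k; n; b; label k lam u v;
     (digit n.+1 c u).-1; (digit n.+1 c v).-1])); last by apply: evals_sat; apply: digit_pred_lt.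
  do 3!(eapply EvCons; first by ev).
  eapply EvCons; first by ev.
  eapply EvCons.
    by apply: (@ev_eq _ _ _ _ _ (digit n.+1 c u - 1)); [apply: EvBin du _ _ => //; ev|rewrite subn1].
  eapply EvCons; last exact: EvNil.
  by apply: (@ev_eq _ _ _ _ _ (digit n.+1 c v - 1)); [apply: EvBin dv _ _ => //; ev|rewrite subn1].
- by case: (u < v) => // _; ev.
Qed.

Ltac ev_spec ::=
  lazymatch goal with
  | |- evals _ _ _ _ e_eq _ => apply: evals_eqn
  | |- evals _ _ _ _ e_lt _ => apply: evals_ltn
  | |- evals _ _ _ _ e_mod _ => apply: evals_mod
  | |- evals _ _ _ _ e_pow _ => apply: evals_pow
  | |- evals _ _ _ _ e_digit _ => apply: evals_digit
  | |- evals _ _ _ _ e_pair_ok _ => apply: evals_pair_ok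
  | |- _ => idtac
  end.

Lemma evals_consistent c : c <= M ->
  evm [:: k; n; b; lam; c] e_consistent
    (consistent k n (label k lam) (sat (oriented n b m)) c).
Proof.
move=> cM.
have -> : consistent k n (label k lam) (sat (oriented n b m)) c =
    all (fun u => all (pair_ok c u) (iota 0 k)) (iota 0 k).
  apply/forallP/allP => [h u|h u].
    rewrite mem_iota => /= uk; apply/allP => v; rewrite mem_iota => /= vk.
    by have /forallP/(_ (Ordinal vk)) := h (Ordinal uk).
  apply/forallP => v; have /allP := h u ltac:(by rewrite mem_iota ltn_ord).
  by apply; rewrite mem_iota ltn_ord.
have it (p : pred nat) i a : iteri i (fun j acc => if p j then acc else 0) a =
    if all p (iota 0 i) then a else 0.
  elim: i => // i IH; rewrite [LHS]/= IH -[in RHS]addn1 iotaD all_cat /= andbT.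
  by case: (p i); rewrite ?andbT ?andbF.
have e1 : (all (fun u => all (pair_ok c u) (iota 0 k)) (iota 0 k) : nat) =
  iteri k (fun u acc => if all (pair_ok c u) (iota 0 k) then acc else 0) 1.
  by rewrite it; case: all.
rewrite e1; apply: ev_iter; [by ev|by lia|by ev|move=> u uk; rewrite /=].
rewrite it; set acc := (if _ then 1 else 0).
rewrite -(it (pair_ok c u) k acc).
apply: ev_iter; [by ev|by lia|by ev|move=> v vk; rewrite /=].
eapply ev_eq; first by ev.
by rewrite /=; case: pair_ok.
Qed.

Lemma evals_restrict c c' : c <= M -> c' <= M ->
  evm [:: k; n; c; c'] e_restrict (restrict n.+1 k (fun v => digit n.+1 c' v != 0) c).
Proof.
move=> cM c'M; set g := fun v => _.
have gN v : (if g v then digit n.+1 c v else 0) < n.+1.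
  by case: ifP => // _; apply: digit_lt.
apply: ev_iter; [by ev|by lia|by ev|move=> v vk; rewrite /=].
set acc := iteri v _ 0; have pv := M_powN (ltnW vk).
have [hb _] := mkcode_inv (ltn0Sn n) gN vk; rewrite [iteri v.+1 _ _]/= -/acc in hb.
have hM := leq_trans (ltnW hb) M_N.
have d0 w c0 : w <= M -> evm [:: k; n; c; c'; v; acc] c0 w -> evm [:: k; n; c; c'; v; acc]
    (dig (succ (EVar 1)) c0 (EVar 4)) (digit n.+1 w v).
  move=> wM hw; apply: (@ev_eq _ _ _ _ _ (digit (n + 1) w v)); last by rewrite addn1.
  apply: (ev_call (vs := [:: n + 1; w; v])); last first.
    by apply: evals_digit => //; [rewrite addn1|lia].
  eapply EvCons; first by rewrite /succ; ev; rewrite ?addn1.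
  by eapply EvCons; [exact: hw|ev].
apply: EvBin; [exact: (EvVar _ _ _ [:: k; n; c; c'; v; acc] 5)| |exact: hM].
apply: EvBin; [|apply: (EvCond (v := digit n.+1 c' v))|rewrite /=; lia].
- by apply: (@ev_eq _ _ _ _ _ ((n + 1) ^ v)); [rewrite /succ; ev; rewrite ?addn1|rewrite addn1].
- by apply: d0 => //; ev.
- by rewrite /g => ->; apply: d0 => //; ev.
- by rewrite /g => ->; ev.
Qed.

End Plan.

(** * Reading the pattern *)

Definition e_pattern_pos : expr :=
  EIter (EVar 0) (ENum 1) (succ (EBin Add (EVar 2) (EGet (EVar 2)))).
Definition e_edge : expr :=
  ELet (ecall e_pattern_pos [:: EVar 0])
    (EIter (EGet (EVar 2)) (ENum 0)
       (ECond (ecall e_eq [:: EGet (EBin Add (succ (EVar 2)) (EVar 3)); EVar 1])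
          (ENum 1) (EVar 4))).
(* A sign in {0, 1, -1} is coded as 0, 1, 2. *)
Definition negate (s : expr) : expr := ECond s (EBin Defs.Sub (ENum 3) s) (ENum 0).
Definition e_nonedge (mode : nat) : expr :=
  match mode with
  | 0 => ECond (EVar 6) (ENum 0) (EVar 3)
  | 1 => ECond (EVar 6) (ECond (ecall e_eq [:: EVar 6; ENum 3]) (negate (EVar 3)) (ENum 0)) (EVar 3)
  | _ => ECond (EVar 6) (negate (EVar 3)) (EVar 3)
  end.
Definition e_coef (mode : nat) : expr :=
  EIter (EBin Mul (EVar 0) (EVar 0)) (ENum 1)
    (ELet (EBin Div (EVar 2) (EVar 0))
    (ELet (ecall e_mod [:: EVar 2; EVar 0])
    (ELet (dig (ENum 4) (EVar 1) (EVar 2))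
       (ECond (ecall e_lt [:: EVar 4; EVar 5])
          (ECond (ecall e_edge [:: EVar 4; EVar 5])
             (ECond (ecall e_eq [:: EVar 6; ENum 1]) (EVar 3)
                (ECond (ecall e_eq [:: EVar 6; ENum 2]) (EVar 3) (ENum 0)))
             (e_nonedge mode))
          (ECond (EVar 6) (ENum 0) (EVar 3)))))).
Definition e_missing : expr :=
  EIter (EVar 0) (ENum 0)
    (EIter (EVar 0) (EVar 2)
       (ECond (ECond (ecall e_lt [:: EVar 1; EVar 3])
                 (not_ (ecall e_edge [:: EVar 1; EVar 3])) (ENum 0))
          (succ (EVar 4)) (EVar 4))).
Definition e_exponent : expr :=
  ELet (ecall e_missing [:: EVar 0])
    (EIter (succ (EVar 0)) (ENum 0)
       (ECond (ecall e_lt [:: EVar 1; EBin Mul (EVar 2) (succ (EBin Add (EVar 2) (EVar 2)))])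
          (EVar 3) (succ (EVar 3)))).
Definition e_aut_pair : expr :=
  ELet (dig (EVar 0) (EVar 1) (EVar 2))
  (ELet (dig (EVar 0) (EVar 1) (EVar 3))
     (ECond (ecall e_eq [:: ecall e_edge [:: EVar 2; EVar 3]; ecall e_edge [:: EVar 4; EVar 5]])
        (ECond (ecall e_eq [:: EVar 4; EVar 5]) (ecall e_eq [:: EVar 2; EVar 3]) (ENum 1))
        (ENum 0))).
Definition e_aut_check : expr :=
  EIter (EVar 0) (ENum 1)
    (EIter (EVar 0) (EVar 3)
       (ECond (ecall e_aut_pair [:: EVar 0; EVar 1; EVar 2; EVar 4]) (EVar 5) (ENum 0))).
Definition e_aut : expr :=
  EIter (ecall e_pow [:: EVar 0; EVar 0]) (ENum 0)
    (ECond (ecall e_aut_check [:: EVar 0; EVar 1]) (succ (EVar 2)) (EVar 2)).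

Lemma iteri_all (p : pred nat) i a :
  iteri i (fun j acc => if p j then acc else 0) a = if all p (iota 0 i) then a else 0.
Proof.
elim: i => // i IH; rewrite [LHS]/= IH -[in RHS]addn1 iotaD all_cat /= andbT.
by case: (p i); rewrite ?andbT ?andbF.
Qed.

Lemma all_iotaP k (p : pred nat) : reflect (forall v : 'I_k, p v) (all p (iota 0 k)).
Proof.
apply: (iffP allP) => h v; first by apply: h; rewrite mem_iota ltn_ord.
by rewrite mem_iota => /= vk; apply: (h (Ordinal vk)).
Qed.

Section Pattern.

Variables (M X k : nat) (m : nat -> nat) (LH : nat -> seq nat).

Local Notation pos := (list_pos 1 LH).
Local Notation evm := (evals M X m).

Hypothesis M_ge : 256 <= M.
Hypothesis kX : k * k + k + 2 <= X.
Hypothesis kkX : k ^ k <= X.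
Hypothesis M_k : 4 * k * k + 4 * k + 2 <= M.
Hypothesis M_kk : k ^ k <= M.
Hypothesis M_4 : 4 ^ (k * k) <= M.
Hypothesis M_pos : pos k + k + 1 <= M.
Hypothesis k_gt0 : 0 < k.
Hypothesis LH_lt : forall u v, v \in LH u -> v < k.
Hypothesis LH_uniq : forall u, uniq (LH u).
Hypothesis m_size : forall u, u < k -> m (pos u) = size (LH u).
Hypothesis m_nth : forall u j, u < k -> j < size (LH u) ->
  m (pos u + 1 + j) = nth 0 (LH u) j.

Let size_LH u : size (LH u) <= k. Proof. exact: size_NL. Qed.

Let pos_leM u : u <= k -> pos u + k + 1 <= M.
Proof.
move=> uk; have h : pos u <= pos k := @list_pos_mono 1 LH u k uk.
by apply: leq_trans M_pos; rewrite !leq_add2r.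
Qed.

Lemma evals_pattern_pos u : u <= k -> evm [:: u] e_pattern_pos (pos u).
Proof.
move=> uk; have e i : i <= k -> iteri i (fun _ acc => acc + m acc + 1) 1 = pos i.
  elim: i => [|i IH] ik; first by rewrite /list_pos big_geq.
  by rewrite [LHS]/= IH 1?ltnW // m_size // list_posS.
rewrite -e //; apply: ev_iter; [by ev|by lia|by ev|move=> i iu; rewrite /=].
have ik : i < k by lia.
rewrite e 1?ltnW //; have h := pos_leM ik; have := list_posS 1 LH i.
have := m_size ik => hs hp; rewrite /succ; ev; rewrite hs; lia.
Qed.

Lemma evals_edge u v : u < k -> evm [:: u; v] e_edge (v \in LH u).
Proof.
move=> uk; have p1 := pos_leM uk; rewrite list_posS in p1.
have -> : (v \in LH u) = has (fun j => nth 0 (LH u) j == v) (iota 0 (size (LH u))).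
  apply/idP/hasP => [vu|[j]]; last by rewrite mem_iota => /= js /eqP<-; apply: mem_nth.
  by exists (index v (LH u)); rewrite ?mem_iota ?index_mem // nth_index.
apply: (@EvLet _ _ _ _ _ _ (pos u)).
  apply: (ev_call (vs := [:: u])); last by apply: evals_pattern_pos; apply: ltnW.
  by ev.
rewrite -iteri_has; apply: ev_iter.
- by rewrite /= -m_size //; ev.
- by have := size_LH u; lia.
- by ev.
move=> j js; rewrite /=; have ej := m_nth uk js.
have sk := size_LH u.
eapply ev_eq.
  apply: ev_cond; [|by move=> _; ev|by move=> _; ev].
  apply: (ev_call (vs := [:: nth 0 (LH u) j; v])); last by apply: evals_eqn.
  eapply EvCons; last by ev.
  by rewrite -ej /succ; ev.
by rewrite /=; case: (_ == v).
Qed.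

Ltac ev_spec ::=
  lazymatch goal with
  | |- evals _ _ _ _ e_eq _ => apply: evals_eqn
  | |- evals _ _ _ _ e_lt _ => apply: evals_ltn
  | |- evals _ _ _ _ e_mod _ => apply: evals_mod
  | |- evals _ _ _ _ e_pow _ => apply: evals_pow
  | |- evals _ _ _ _ e_digit _ => apply: evals_digit
  | |- evals _ _ _ _ e_edge _ => apply: evals_edge
  | |- _ => idtac
  end.

Definition edge (u v : nat) : bool := v \in LH u.

Definition sign_value (s : nat) : int :=
  match s with 0 => 0%R | 1 => 1%R | _ => (-1)%R end.

Definition neg_code (s : nat) : nat := if s != 0 then 3 - s else 0.

Definition coef_step (mode lam j s : nat) : nat :=
  let l := digit 4 lam j in
  if j %/ k < j %% k then
    if edge (j %/ k) (j %% k) then if (l == 1) || (l == 2) then s else 0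
    else match mode with
         | 0 => if l != 0 then 0 else s
         | 1 => if l != 0 then if l == 3 then neg_code s else 0 else s
         | _ => if l != 0 then neg_code s else s
         end
  else if l != 0 then 0 else s.

Definition coef_code (mode lam : nat) : nat := iteri (k * k) (coef_step mode lam) 1.

Lemma coef_code_le mode lam i : iteri i (coef_step mode lam) 1 <= 2.
Proof.
clear -k LH.
elim: i => //= i IH; rewrite /coef_step /neg_code; move: (iteri _ _ _) IH => s s2.
have s' : s != 0 -> 3 - s <= 2 by lia.
case: (i %/ k < i %% k); last by case: ifP.
case: (edge _ _); first by case: ifP.
by case: mode => [|[|mo]]; case: (digit 4 lam i != 0); case: (digit 4 lam i == 3) => //;
  case: eqP s' => // _; apply.
Qed.

Lemma coef_codeE mode lam : sign_value (coef_code mode lam) = coef k edge mode lam.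
Proof.
clear -k LH.
rewrite /coef -(big_mkord xpredT (fun j => label_weight k edge mode j (digit 4 lam j))).
rewrite /coef_code; elim: (k * k) => [|i IH]; first by rewrite big_geq.
rewrite big_nat_recr //= -{}IH; have := coef_code_le mode lam i.
move: (iteri _ _ _) => s; rewrite /coef_step /label_weight /weight /neg_code.
have := @digit_lt 4 lam i isT; move: (digit 4 lam i) => l l4.
case: (i %/ k < i %% k); last by case: l l4 => [|l] _; case: s => [|[|[]]].
case: (edge _ _); first by case: l l4 => [|[|[|[]]]] // _; case: s => [|[|[]]].
by case: mode => [|[|mo]]; case: l l4 => [|[|[|[|]]]] // _; case: s => [|[|[]]].
Qed.

Lemma evals_coef mode lam : lam <= M -> evm [:: k; lam] (e_coef mode) (coef_code mode lam).
Proof.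
move=> lM; have kk : 4 * k * k = k * k * 4 by lia.
apply: ev_iter; [by ev|by lia|by ev|move=> j jk; rewrite /=].
set s := iteri j _ 1; have s2 : s <= 2 := coef_code_le mode lam j.
clearbody s.
have jk' : j %/ k < k by rewrite ltn_divLR.
have pj : 4 ^ j <= M by apply: leq_trans M_4; rewrite leq_pexp2l // ltnW.
have lk := @digit_lt 4 lam j isT.
apply: (@EvLet _ _ _ _ _ _ (j %/ k)); first by ev.
apply: (@EvLet _ _ _ _ _ _ (j %% k)); first by rewrite /=; ev.
apply: (@EvLet _ _ _ _ _ _ (digit 4 lam j)); first by rewrite /dig /=; ev.
rewrite /= /coef_step /neg_code /=; set l := digit 4 lam j in lk *; clearbody l.
apply: (@EvCond _ _ _ _ _ _ _ (j %/ k < j %% k)) => [|c|c]; first by ev.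
- have -> : j %/ k < j %% k by case: (_ < _) c.
  apply: (@EvCond _ _ _ _ _ _ _ (edge (j %/ k) (j %% k))) => [|e|e]; first by ev.
  + have -> : edge (j %/ k) (j %% k) by case: edge e.
    eapply ev_eq; first by ev.
    by rewrite /=; case: l lk => [|[|[|[]]]].
  + have -> : edge (j %/ k) (j %% k) = false by case: edge e.
    case: mode => [|[|mo]]; rewrite /e_nonedge /negate; (eapply ev_eq; first by ev);
      by rewrite /=; case: l lk => [|[|[|[]]]].
- have -> : (j %/ k < j %% k) = false by case: (_ < _) c.
  by eapply ev_eq; first by ev.
Qed.

Definition missing : nat :=
  \sum_(0 <= u < k) \sum_(0 <= v < k) ((u < v) && ~~ edge u v).

Lemma evals_missing : evm [:: k] e_missing missing.
Proof.
pose F u v := nat_of_bool ((u < v) && ~~ edge u v).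
have it (G : nat -> nat) i a : iteri i (fun j acc => acc + G j) a = a + \sum_(0 <= j < i) G j.
  elim: i => [|i IH]; first by rewrite big_geq //= addn0.
  by rewrite [LHS]/= IH big_nat_recr //= addnA.
have Fk i u : \sum_(0 <= v < i) F u v <= i.
  rewrite -[X in _ <= X]subn0 -[X in _ <= X]muln1 -sum_nat_const_nat.
  by apply: leq_sum => v _; apply: leq_b1.
have FFk i : \sum_(0 <= u < i) \sum_(0 <= v < k) F u v <= i * k.
  rewrite -[X in _ <= X * _]subn0 -sum_nat_const_nat.
  by apply: leq_sum => v _; apply: Fk.
rewrite -[missing]add0n -(it (fun u => \sum_(0 <= v < k) F u v)).
apply: ev_iter; [by ev|by lia|by ev|move=> u uk; rewrite /=].
rewrite it add0n -[X in evals _ _ _ _ _ X](it (F u)).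
apply: ev_iter; [by ev|by lia|by ev|move=> v vk; rewrite /=].
rewrite it; have h1 := Fk v u; have h2 := FFk u.
have h3 : u * k <= k * k by rewrite leq_mul2r ltnW ?orbT.
rewrite /not_ /succ; eapply ev_eq; first by ev.
by rewrite /= /F /edge; case: (u < v); case: (v \in LH u); rewrite /= ?addn0 ?addn1.
Qed.

(** The number of roots allowed on a side, found without square roots: [j * (j + j + 1)] is
    ['C(2 * j + 1, 2)], the number of pairs among [2 * j + 1] roots, all of which are missing edges
    when the sign is nonzero. *)
Definition exponent : nat :=
  count (fun j => j * (j + j + 1) <= missing) (iota 0 (k + 1)).

Lemma missing_le : missing <= k * k.
Proof.
rewrite /missing -[X in _ <= X * _]subn0 -sum_nat_const_nat; apply: leq_sum => u _.
rewrite -[X in _ <= X]subn0 -[X in _ <= X]muln1 -sum_nat_const_nat.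
by apply: leq_sum => v _; apply: leq_b1.
Qed.

Lemma evals_exponent : evm [:: k] e_exponent exponent.
Proof.
have mk := missing_le.
apply: (@EvLet _ _ _ _ _ _ missing).
  by apply: (ev_call (vs := [:: k])); [ev|exact: evals_missing].
rewrite /exponent -iteri_count; apply: ev_iter; [by rewrite /succ /=; ev|by lia|by ev|].
move=> j jk; rewrite /=; set acc := iteri j _ 0.
have accj : acc <= j by rewrite /acc iteri_count (leq_trans (count_size _ _)) ?size_iota.
have jj : j * (j + j + 1) <= M.
  apply: leq_trans M_k; have h : j <= k by lia.
  have : j * (j + j + 1) <= k * (k + k + 1) by apply: leq_mul => //; lia.
  lia.
rewrite /succ; eapply ev_eq; first by ev.
by rewrite /=; case: (ltnP missing (j * (j + j + 1))) => _ /=; rewrite ?addn1.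
Qed.

Definition aut_ok (c u v : nat) : bool :=
  (edge u v == edge (digit k c u) (digit k c v)) &&
  ((digit k c u == digit k c v) ==> (u == v)).

Lemma evals_aut_pair c u v : u < k -> v < k -> c <= M ->
  evm [:: k; c; u; v] e_aut_pair (aut_ok c u v).
Proof.
move=> uk vk cM; have pw w : w < k -> k ^ w <= M.
  by move=> wk; apply: leq_trans M_kk; rewrite leq_pexp2l // ltnW.
have pu := pw _ uk; have pv := pw _ vk.
have du := @digit_lt k c u k_gt0; have dv := @digit_lt k c v k_gt0.
apply: (@EvLet _ _ _ _ _ _ (digit k c u)); first by rewrite /dig; ev.
apply: (@EvLet _ _ _ _ _ _ (digit k c v)); first by rewrite /dig /=; ev.
rewrite /=; eapply ev_eq; first by ev.
rewrite /= /aut_ok /edge; case: (v \in LH u); case: (digit k c v \in _) => //=;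
  by case: (digit k c u == _).
Qed.

Definition auts : nat := count (fun c => all (fun u => all (aut_ok c u) (iota 0 k)) (iota 0 k)) (iota 0 (k ^ k)).

Lemma evals_aut_check c : c <= M ->
  evm [:: k; c] e_aut_check (all (fun u => all (aut_ok c u) (iota 0 k)) (iota 0 k)).
Proof.
move=> cM.
have -> : (all (fun u => all (aut_ok c u) (iota 0 k)) (iota 0 k) : nat) =
  iteri k (fun u acc => if all (aut_ok c u) (iota 0 k) then acc else 0) 1.
  by rewrite iteri_all; case: all.
apply: ev_iter; [by ev|by lia|by ev|move=> u uk; rewrite /=].
rewrite iteri_all; set acc := (if _ then 1 else 0).
rewrite -(iteri_all (aut_ok c u) k acc).
apply: ev_iter; [by ev|by lia|by ev|move=> v vk; rewrite /=].
eapply ev_eq.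
  apply: ev_cond; [|by move=> _; ev|by move=> _; ev].
  by apply: (ev_call (vs := [:: k; c; u; v])); [ev|exact: evals_aut_pair].
by rewrite /=; case: aut_ok.
Qed.

Lemma evals_aut : evm [:: k] e_aut auts.
Proof.
rewrite /auts -iteri_count; apply: ev_iter; [by ev; lia|by []|by ev|].
move=> c ck; rewrite /=; set acc := iteri c _ 0.
have accc : acc <= c by rewrite /acc iteri_count (leq_trans (count_size _ _)) ?size_iota.
rewrite /succ; eapply ev_eq.
  apply: ev_cond; [|by move=> _; ev|by move=> _; ev].
  by apply: (ev_call (vs := [:: k; c])); [ev|apply: evals_aut_check; lia].
by rewrite /=; case: all => //=; rewrite addn1.
Qed.

End Pattern.

(** * The two halves of a labelling *)

(** The generator reads [alpha] at root indices and [beta] below [k] only, so both functions can be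
    replaced by the digits of numbers. *)
Lemma gen_ext k n arc nb side alpha alpha' beta beta' :
  (forall v, v < k -> is_root k arc side v ->
     alpha (rank k arc v %/ 2) = alpha' (rank k arc v %/ 2)) ->
  (forall v, v < k -> beta v = beta' v) ->
  gen k n arc nb side alpha beta = gen k n arc nb side alpha' beta'.
Proof.
move=> ha hb; rewrite /gen.
have sw c : sweep k n arc nb beta c = sweep k n arc nb beta' c.
  rewrite /sweep; have : all (gtn k) (sweep_order k) by apply/allP => v; rewrite mem_sweep_order.
  elim: (sweep_order k) c => //= v s IH c /andP[vk sk].
  by rewrite (@sweep_step_beta _ _ _ _ _ beta') ?hb // IH.
rewrite !sw; congr (sweep _ _ _ _ _ (sweep _ _ _ _ _ _)).
suff it i : i <= k -> iteri i (init_step k n arc side alpha) 0 = iteri i (init_step k n arc side alpha') 0.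
  exact: it.
elim: i => // i IH ik.
rewrite [LHS]/= [RHS]/= IH 1?ltnW // /init_step; case: ifP => // r.
by rewrite ha.
Qed.

(** Each pair is counted at its larger element. *)
Lemma sum_pairs (p : pred nat) k :
  \sum_(0 <= v < k) p v * count p (iota 0 v) = 'C(count p (iota 0 k), 2).
Proof.
elim: k => [|k IH]; first by rewrite big_geq.
rewrite big_nat_recr // IH -[in RHS]addn1 iotaD count_cat /= addn0.
case: (p k); rewrite ?mul1n ?mul0n ?addn0 //.
by rewrite addn1 binS bin1.
Qed.

Lemma count_downward (p : pred nat) k e :
  (forall i j, i <= j -> p j -> p i) -> e = count p (iota 0 k) -> e < k -> ~~ p e.
Proof.
move=> dw ee ek; apply/negP => pe.
have : count p (iota 0 e.+1) <= count p (iota 0 k).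
  by rewrite -(subnKC ek) iotaD count_cat leq_addr.
rewrite -ee (_ : count p (iota 0 e.+1) = e.+1) ?ltnn //.
rewrite -[RHS](size_iota 0); apply/eqP; rewrite -all_count.
apply/allP => i; rewrite mem_iota => /= ie; exact: dw pe.
Qed.

Section Halves.

Variables (k n b lam mode : nat) (m : nat -> nat) (LH : nat -> seq nat) (B : nat).

Local Notation arc := (arc_of k lam).
Local Notation N := (n.+1).
Local Notation lab := (label k lam).
Local Notation D := (oriented n b m).
Local Notation nb := (nbr n b m).

Hypothesis n_gt0 : 0 < n.
Hypothesis outs_lt : forall x y, x < n -> y \in outs n b m x -> y < n.
Hypothesis cell_lt_B : forall x, x < n -> cell n b m x 0 < B.

Let nb_lt x j : x < n -> nb x j < n. Proof. exact: nbr_lt. Qed.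

(** Domains do not depend on the choices, so the code made from zero choices shows which vertices a
    side defines. *)
Definition pattern (side : nat) : nat := gen k n arc nb side (digit n 0) (digit B 0).
Definition defined (side v : nat) : bool := digit N (pattern side) v != 0.

(** A loop index below [n ^ r * B ^ k] packs [r] root values in base [n] above [k] choices in base
    [B]. *)
Definition code_at (r side i : nat) : nat :=
  gen k n arc nb side (digit n (i %/ B ^ k)) (digit B (i %% B ^ k)).

Let B_gt0 : 0 < B. Proof. by have := cell_lt_B n_gt0; lia. Qed.

Let dn a j : digit n a j < n. Proof. exact: digit_lt. Qed.

Lemma defined_cover v : v < k -> defined 0 v || defined 1 v.
Proof.
move=> vk; have [side s2 h] := gen_cover (arc_of_irr k lam) nb_lt vk.
have := h (digit n 0) (digit B 0) (dn 0); rewrite /defined /pattern.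
by case: side s2 h => [|[|//]] _ _ ->; rewrite ?orbT.
Qed.

Lemma label_arc u v : u < v -> lab u v != 0 -> arc u v || arc v u.
Proof.
move=> uv; rewrite /arc_of uv ltnNge (ltnW uv) /=; have := label_lt k lam u v.
by case: (lab u v) => [|[|[|[|]]]].
Qed.

Lemma defined_pair u v : u < v -> v < k -> lab u v != 0 ->
  (defined 0 u && defined 0 v) || (defined 1 u && defined 1 v).
Proof.
move=> uv vk l0; have uk := ltn_trans uv vk.
have cover w w' : w < k -> w' < k -> arc w w' ->
    (defined 0 w && defined 0 w') || (defined 1 w && defined 1 w').
  move=> wk wk' a; have [side s2 h] := gen_cover_arc (arc_of_irr k lam) nb_lt wk wk' a.
  have [h1 h2] := h (digit n 0) (digit B 0) (dn 0); move: h1 h2; rewrite /defined /pattern.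
  by case: side s2 h => [|[|//]] _ _ -> ->; rewrite ?orbT.
have /orP[a|a] := label_arc uv l0; first exact: cover.
by rewrite andbC [defined 1 u && _]andbC; apply: cover.
Qed.

Lemma code_at_half r side i : consistent k n lab (sat D) (code_at r side i) ->
  half_ok k n defined lab (sat D) side (code_at r side i).
Proof.
move=> c; rewrite /half_ok c andbT; apply/forallP => v; apply/eqP.
by apply: (@gen_dom k n arc nb nb_lt side _ _ _ _ (dn _) (dn 0) v); apply: ltn_ord.
Qed.

(** Behind an arc stands either an edge of the orientation, and then [j] is one more than a position
    in the out-list, or an equality, and then [j] is 0. *)
Lemma arc_follow c u v : consistent k n lab (sat D) c -> u < k -> v < k ->
  digit N c u != 0 -> digit N c v != 0 -> arc u v ->
  exists2 j, j < B & nb (digit N c u).-1 j = (digit N c v).-1.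
Proof.
move=> /forallP hc uk vk du dv a.
have xn := digit_pred_lt du.
have follow : D (digit N c u).-1 (digit N c v).-1 \/ (digit N c u).-1 = (digit N c v).-1.
  move: a; rewrite /arc_of; case: ltnP => [uv|vu].
    have /forallP/(_ (Ordinal vk)) := hc (Ordinal uk); rewrite /= uv du dv /=.
    have := label_lt k lam u v; case: (lab u v) => [|[|[|[|]]]] //= _; first by left.
    by move/eqP; right.
  case: ifP => // {}vu; have /forallP/(_ (Ordinal uk)) := hc (Ordinal vk).
  rewrite /= vu du dv /=.
  have := label_lt k lam v u; case: (lab v u) => [|[|[|[|]]]] //= _; first by left.
  by move/eqP; right.
case: follow => [/andP[_ /mapP[j]]|e]; last by exists 0.
rewrite mem_iota => /= jc e; exists j.+1; first exact: leq_ltn_trans jc (cell_lt_B xn).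
by rewrite /nbr /= jc.
Qed.

Lemma half_code_at r side c : c < N ^ k ->
  (forall v, v < k -> is_root k arc side v -> rank k arc v %/ 2 < r) ->
  half_ok k n defined lab (sat D) side c ->
  exists2 i, i < n ^ r * B ^ k & code_at r side i = c.
Proof.
move=> ck hr /andP[/forallP hd hc].
have same : same_dom k n c (gen k n arc nb side (fun=> 0) (fun=> 0)).
  move=> v vk; rewrite (eqP (hd (Ordinal vk))) /defined /pattern.
  by apply: (@gen_dom k n arc nb nb_lt side _ _ _ _ (dn 0) (fun=> n_gt0) v).
have [alpha [beta [ha hb e]]] := gen_complete nb_lt B_gt0 n_gt0 ck same
  (fun u v uk vk du dv a => arc_follow hc uk vk du dv a).
have [a an ea] := digit_exists (fun v (_ : v < r) => ha v).
have [be bB eb] := digit_exists (fun v (_ : v < k) => hb v).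
exists (a * B ^ k + be).
  have : a.+1 * B ^ k <= n ^ r * B ^ k by rewrite leq_mul2r an orbT.
  by rewrite mulSn; lia.
rewrite /code_at divnMDl ?expn_gt0 ?B_gt0 // divn_small // addn0 modnMDl modn_small // -e.
by apply: gen_ext => v vk; [move=> rv; apply: ea; apply: hr|apply: eb].
Qed.

(* Undeleted vertices are pairwise unrelated, hence pairwise nonadjacent. *)
Lemma roots_few : coef k (edge LH) mode lam != 0%R ->
  forall v, v < k -> digit 2 (deleted k arc) v = 0 -> rank k arc v %/ 2 < exponent k LH.
Proof.
move=> c0 v vk dv; rewrite ltnNge; apply/negP => le.
set e := exponent k LH in le.
set p := fun u => digit 2 (deleted k arc) u == 0.
have wj j : j < k * k -> label_weight k (edge LH) mode j (digit 4 lam j) != 0%R.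
  move=> jk; apply: contra_neq c0 => w0.
  by rewrite /coef (bigD1 (Ordinal jk)) //= w0 GRing.mul0r.
(* No arc joins two roots, so their label is 0; on an edge of the pattern that label has weight 0
   and the whole coefficient would vanish. *)
have indep u w : u < w -> w < k -> p u -> p w -> ~~ edge LH u w.
  move=> uw wk /eqP pu /eqP pw; have uk := ltn_trans uw wk; apply/negP => euw.
  have a1 := remaining_indep uk wk pu pw.
  have a2 := remaining_indep wk uk pw pu.
  have := label_arc uw; rewrite (negPf a1) (negPf a2) /= => /implyP; rewrite implybF negbK => /eqP l0.
  have := wj _ (pair_index_lt uk wk); rewrite /label_weight -/(label k lam u w) l0.
  have k0 : 0 < k by lia.
  by rewrite divnMDl // modnMDl divn_small // modn_small // addn0 uw /weight euw.
have pairs : 'C(count p (iota 0 k), 2) <= missing k LH.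
  rewrite -sum_pairs /missing exchange_big_nat /=.
  rewrite big_nat [X in _ <= X]big_nat; apply: leq_sum => w /andP[_ wk].
  have -> : count p (iota 0 w) = \sum_(0 <= u < k) ((u < w) && p u).
    rewrite (big_cat_nat (n := w)) //=; last exact: ltnW.
    rewrite [X in _ = _ + X]big_nat_cond [X in _ = _ + X]big1 ?addn0; last first.
      by move=> u /andP[/andP[h _] _]; rewrite ltnNge h.
    rewrite -sum1_count big_mkcond /= /index_iota subn0.
    by apply: eq_big_seq => u; rewrite mem_iota => /= ->; case: (p u).
  rewrite big_distrr /= big_nat [X in _ <= X]big_nat; apply: leq_sum => u /andP[_ uk].
  case pw: (p w) => //; case: ltnP => //= uw; case pu: (p u) => //.
  by rewrite indep.
have ek : e < k + 1.
  have := rank_le k lam v; have := leq_div (rank k arc v) 2; lia.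
(* The admissible [j] form an initial segment, so their number [e] is not admissible; the pairs
   among [2 * e + 1] roots would make it so. *)
have /negP[] := @count_downward (fun j => j * (j + j + 1) <= missing k LH) _ e
    (fun i j ij h => leq_trans (leq_mul ij (leq_add (leq_add ij ij) (leqnn 1))) h) erefl ek.
apply: leq_trans pairs.
(* At least [2 * e] roots precede [v], and [v] is one more. *)
have cnt : 2 * e + 1 <= count p (iota 0 k).
  have : rank k arc v < rank k arc v + 1 by lia.
  have -> : count p (iota 0 k) = rank k arc v + count p (iota v (k - v)).
    by rewrite /rank -count_cat -iotaD subnKC // ltnW.
  have : 0 < count p (iota v (k - v)).
    by rewrite -has_count; apply/hasP; exists v; rewrite ?mem_iota /p ?dv //; lia.
  have := leq_divM (rank k arc v) 2; lia.
apply: (@leq_trans 'C(2 * e + 1, 2)); last exact: leq_bin2l.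
have -> : 'C(2 * e + 1, 2) = ((e * (e + e + 1)).*2)./2.
  by rewrite bin2 addn1 succnK; congr (_./2); rewrite -addn1 -muln2; lia.
by rewrite doubleK.
Qed.

End Halves.

(** * Counting the solutions of all labellings *)

(* Environment: k, n, b, g, exponent, branching B, number P of codes, then the
   labelling, its deleted set, the two patterns and its sign, then the loop
   index, its two parts and the code they generate.  Array 4 marks the codes
   already met, array 5 counts codes by their restriction, array 6 accumulates
   the total for each sign. *)
Definition mark_index (side : nat) : expr :=
  EBin Add (EBin Mul (EBin Add (EBin Mul (EVar 7) (ENum 2)) (ENum side)) (EVar 6)) (EVar 15).
(** Each labelling has its own block of [P] counters, just as each labelling and side has its own
    block of marks: tables of this size could not be cleared within the time bound. *)
Definition key_index (other : nat) : expr :=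
  EBin Add (EBin Mul (EVar 7) (EVar 6))
    (ecall e_restrict [:: EVar 0; EVar 1; EVar 15; EVar other]).

(** Different choices can generate the same code, for instance through indices beyond an out-list;
    the mark makes each code count once. *)
Definition c_record (side ja : nat) (etgt einc : expr) : cmd :=
  CSeq (CStore (eadr 4 (mark_index side)) (ENum 1))
       (CStore (eadr ja etgt) (EBin Add (earr ja etgt) einc)).

Definition c_try (side ja : nat) (etgt einc : expr) : cmd :=
  CLet (EBin Div (EVar 12) (ecall e_pow [:: EVar 5; EVar 0]))
  (CLet (ecall e_mod [:: EVar 12; ecall e_pow [:: EVar 5; EVar 0]])
  (CLet (ecall e_gen [:: EVar 0; EVar 1; EVar 2; EVar 7; EVar 8; ENum side; EVar 5; EVar 13; EVar 14])
  (CIf (ecall e_consistent [:: EVar 0; EVar 1; EVar 2; EVar 7; EVar 15])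
  (CIf (not_ (earr 4 (mark_index side))) (c_record side ja etgt einc))))).

Definition c_half (side ja : nat) (etgt einc : expr) : cmd :=
  CFor (EBin Mul (ecall e_pow [:: EVar 1; EVar 4]) (ecall e_pow [:: EVar 5; EVar 0]))
    (c_try side ja etgt einc).

(** Side 1 counts its codes by their restriction to the domain of side 0. Side 0 then adds, for each
    of its codes, the number of matching codes to the total of the sign. Labellings of sign 0 end up
    in entry 0 of array 6, which the result does not read. *)
Definition c_labelling (mode : nat) : cmd :=
  CLet (ecall e_deleted [:: EVar 0; EVar 7])
  (CLet (ecall e_gen [:: EVar 0; EVar 1; EVar 2; EVar 7; EVar 8; ENum 0; EVar 5; ENum 0; ENum 0])
  (CLet (ecall e_gen [:: EVar 0; EVar 1; EVar 2; EVar 7; EVar 8; ENum 1; EVar 5; ENum 0; ENum 0])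
  (CLet (ecall (e_coef mode) [:: EVar 0; EVar 7])
  (CSeq (c_half 1 5 (key_index 9) (ENum 1))
        (c_half 0 6 (EVar 11) (earr 5 (key_index 10))))))).

Definition c_count (mode : nat) : cmd :=
  CLet (ecall e_exponent [:: EVar 0])
  (CLet (EBin Add (earr 3 (ENum 2)) (ENum 2))
  (CLet (ecall e_pow [:: succ (EVar 1); EVar 0])
  (CFor (ecall e_pow [:: ENum 4; EBin Mul (EVar 0) (EVar 0)]) (c_labelling mode)))).

Definition frame (b : nat) (m0 m : nat -> nat) : Prop :=
  (forall a, a < b -> m a = m0 a) /\ forall j i, j < 4 -> m (adr b j i) = m0 (adr b j i).

Lemma frame_upd b m0 m j i v : frame b m0 m -> 4 <= j -> j < 8 ->
  frame b m0 (upd m (adr b j i) v).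
Proof.
move=> [h1 h2] j4 j8; split=> [a ab|j' i' hj]; first by rewrite upd_low ?h1.
by rewrite upd_adr //; [case: eqP => [e|_]; [lia|apply: h2]|lia].
Qed.

Lemma frame_cell n b m0 m x j : frame b m0 m -> cell n b m x j = cell n b m0 x j.
Proof. by case=> _ h; apply: h. Qed.

Lemma frame_nbr n b m0 m : frame b m0 m -> nbr n b m = nbr n b m0.
Proof.
move=> h; apply: functional_extensionality => x; apply: functional_extensionality => j.
by rewrite /nbr !(frame_cell n _ _ h).
Qed.

Lemma frame_outs n b m0 m x : frame b m0 m -> outs n b m x = outs n b m0 x.
Proof. by move=> h; rewrite /outs (frame_cell n _ _ h); apply: eq_map => j; apply: frame_cell. Qed.

Lemma frame_oriented n b m0 m : frame b m0 m -> oriented n b m = oriented n b m0.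
Proof.
move=> h; apply: functional_extensionality => x; apply: functional_extensionality => y.
by rewrite /oriented (frame_outs n _ h).
Qed.

Section Half.

Variables (M X k n b g r B lam code0 code1 s : nat) (m0 : nat -> nat).

Local Notation P := (n.+1 ^ k).
Local Notation del := (deleted k (arc_of k lam)).
Local Notation T := (n ^ r * B ^ k).

Hypothesis M_ge : 256 <= M.
Hypothesis kX : k * k + k + 2 <= X.
Hypothesis M_k : k * k + k + 2 <= M.
Hypothesis M_4 : 4 ^ (k * k) <= M.
Hypothesis M_adr : b + 8 * (n.+1 * n.+2) + 8 <= M.
Hypothesis M_big : b + 8 * (2 * 4 ^ (k * k) * P) + 8 <= M.
Hypothesis M_T : n ^ r * B ^ k <= M.
Hypothesis M_B : B ^ k <= M.
Hypothesis M_nk : n ^ r <= M.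
Hypothesis rX : r <= X.
Hypothesis lam_lt : lam < 4 ^ (k * k).
Hypothesis n_gt0 : 0 < n.
Hypothesis k_gt0 : 0 < k.
Hypothesis B_gt0 : 0 < B.
Hypothesis outs_lt : forall x y, x < n -> y \in outs n b m0 x -> y < n.
Hypothesis cell_le_n : forall x, x < n -> cell n b m0 x 0 <= n.
Hypothesis cell_le_X : forall x, x < n -> cell n b m0 x 0 <= X.

Let env := [:: k; n; b; g; r; B; P; lam; del; code0; code1; s].

Let lam2 : 2 * lam + 2 <= 2 * 4 ^ (k * k).
Proof. by have := lam_lt; lia. Qed.

Let M_P : P <= M.
Proof.
apply: leq_trans M_big; have h : 1 * P <= 2 * 4 ^ (k * k) * P.
  by rewrite leq_mul2r; apply/orP; right; have := lam2; lia.
lia.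
Qed.

Definition mark_at (side c : nat) : nat := (lam * 2 + side) * P + c.

Lemma mark_at_le side c : side < 2 -> c < P -> b + 8 * mark_at side c + 8 <= M.
Proof.
move=> s2 cP; apply: leq_trans M_big; rewrite leq_add2r leq_add2l leq_mul2l /=.
apply: (@leq_trans ((2 * lam + 2) * P)); last by rewrite leq_mul2r lam2 orbT.
rewrite /mark_at mulnDl; have : (lam * 2 + side) * P <= (2 * lam + 1) * P.
  by rewrite leq_mul2r; apply/orP; right; lia.
rewrite mulnDl; lia.
Qed.

Section Loop.

Variables (side ja : nat) (etgt einc : expr) (tgt inc : nat -> nat) (m1 : nat -> nat).

Hypothesis side2 : side < 2.
Hypothesis ja_range : (4 < ja) && (ja < 8).

Local Notation nb := (nbr n b m0).
Local Notation code i := (gen k n (arc_of k lam) nb side (digit n (i %/ B ^ k)) (digit B (i %% B ^ k))).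
Local Notation ok c := (consistent k n (label k lam) (sat (oriented n b m0)) c).

Definition seen (t c : nat) : bool := has (fun i => ok (code i) && (code i == c)) (iota 0 t).

Definition half_state (t : nat) (m : nat -> nat) : Prop :=
  [/\ frame b m0 m,
      forall i, m (adr b 4 i) =
        if (mark_at side 0 <= i < mark_at side P) && seen t (i - mark_at side 0) then 1 else m1 (adr b 4 i),
      forall i, m (adr b ja i) = m1 (adr b ja i) + \sum_(c < P | seen t c && (tgt c == i)) inc c &
      forall j i, 4 < j -> j < 8 -> j != ja -> m (adr b j i) = m1 (adr b j i)].

Hypothesis unmarked : forall i, mark_at side 0 <= i -> i < mark_at side P -> m1 (adr b 4 i) = 0.
Hypothesis tgt_bound : forall c, c < P -> b + 8 * tgt c + 8 <= M.
Hypothesis sum_bound : forall c, c < P -> m1 (adr b ja (tgt c)) + \sum_(c' < P) inc c' <= M.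
Hypothesis frame1 : frame b m0 m1.
Hypothesis ev_tgt : forall m i a be c, frame b m0 m -> c < P ->
  evals M X m (env ++ [:: i; a; be; c]) etgt (tgt c).
Hypothesis ev_inc : forall m i a be c, frame b m0 m ->
  (forall j i, 4 < j -> j < 8 -> j != ja -> m (adr b j i) = m1 (adr b j i)) -> c < P ->
  evals M X m (env ++ [:: i; a; be; c]) einc (inc c).

Let code_lt i : code i < P.
Proof. by apply: gen_lt => [x j xn|j]; [apply: nbr_lt|apply: digit_lt]. Qed.

Let seenS t c : seen t.+1 c = seen t c || (ok (code t) && (code t == c)).
Proof. by rewrite /seen -addn1 iotaD has_cat /= orbF. Qed.

Lemma try_hoare t : t < T ->
  hoare M (rcons env t) (half_state t) (c_try side ja etgt einc)
    (cweight X (c_try side ja etgt einc)) (half_state t.+1).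
Proof.
move=> tT; have Bk0 : 0 < B ^ k by rewrite expn_gt0 B_gt0.
have tM : t <= M by apply: leq_trans (ltnW tT) M_T.
have nkP : n ^ k <= P by rewrite leq_exp2r.
have nkM : n ^ k <= M by apply: leq_trans nkP M_P.
have lamM : lam <= M by apply: leq_trans (ltnW lam_lt) M_4.
set a := t %/ B ^ k; set be := t %% B ^ k; set c := code t.
have beM : be <= M by apply: leq_trans M_B; apply: ltnW; apply: ltn_pmod.
have aM : a <= M by apply: leq_trans (leq_div _ _) tM.
have cP : c < P by apply: code_lt.
have cM : c <= M by apply: leq_trans (ltnW cP) M_P.
have kX' : k <= X by lia.
have M0 : 0 < M by lia.
have evp m env' : nth 0 env' 5 = B -> nth 0 env' 0 = k ->
    evals M X m env' (ecall e_pow [:: EVar 5; EVar 0]) (B ^ k).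
  move=> h5 h0; apply: (ev_call (vs := [:: B; k])); last by apply: evals_pow.
  by eapply EvCons; [rewrite -h5; ev|eapply EvCons; [rewrite -h0; ev|ev]].
apply: (@hoare_let M X M0 _ _ _ _ _ _ a) => [m _ _|].
  by rewrite /a; apply: EvBin; [exact: (EvVar _ _ _ (rcons env t) 12)|exact: evp|].
apply: (@hoare_let M X M0 _ _ _ _ _ _ be) => [m _ _|].
  apply: (ev_call (vs := [:: t; B ^ k])); last exact: evals_mod.
  eapply EvCons; first exact: (EvVar _ _ _ (rcons (rcons env t) a) 12).
  by eapply EvCons; [exact: evp|ev].
have frames m : half_state t m -> [/\ frame b m0 m, nbr n b m = nb & oriented n b m = oriented n b m0].
  by case=> fr _ _ _; split; [|exact: frame_nbr|exact: frame_oriented].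
have cells m : frame b m0 m -> [/\ (forall x y, x < n -> y \in outs n b m x -> y < n),
    (forall x, x < n -> cell n b m x 0 <= n) & (forall x, x < n -> cell n b m x 0 <= X)].
  move=> fr; split=> [x y|x|x]; rewrite ?(frame_outs n _ fr) ?(frame_cell n _ _ fr).
  - exact: outs_lt.
  - exact: cell_le_n.
  - exact: cell_le_X.
apply: (@hoare_let M X M0 _ _ _ _ _ _ c) => [m bm hm|].
  have [fr en eo] := frames m hm; have [g1 g2 g3] := cells m fr.
  apply: (ev_call (vs := [:: k; n; b; lam; del; side; B; a; be])).
    by rewrite /env /=; ev.
  rewrite /c -en; apply: evals_gen => //; lia.
rewrite /env /=; set envc := [:: k, n, b, g, r, B, P, lam & _].
have evmark m : evals M X m envc (mark_index side) (mark_at side c).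
  have h := mark_at_le side2 cP; rewrite /mark_at in h *.
  have h1 : lam * 2 + side <= (lam * 2 + side) * P by rewrite leq_pmulr // expn_gt0.
  by rewrite /mark_index; ev; rewrite /=; lia.
apply: (@hoare_if M X M0 _ _ _ (fun=> ok c)) => [m bm hm|m bm hm o0|].
- have [fr en eo] := frames m hm; have [g1 g2 g3] := cells m fr.
  apply: (ev_call (vs := [:: k; n; b; lam; c])); first by rewrite /envc; ev.
  by rewrite -eo; apply: evals_consistent => //; lia.
- have e c' : seen t.+1 c' = seen t c' by rewrite seenS -/c; case: (ok c) o0; rewrite ?orbF.
  case: hm => h1 h2 h3 h4; split=> // i; rewrite ?h2 ?e // h3.
  by under [in RHS]eq_bigl => c' do rewrite e.
pose mk (m : nat -> nat) := m (adr b 4 (mark_at side c)).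
have evm4 m : evals M X m envc (earr 4 (mark_index side)) (mk m).
  by apply: ev_arr; [by []|by []|exact: evmark|exact: mark_at_le].
have in_range : mark_at side 0 <= mark_at side c < mark_at side P.
  by rewrite /mark_at leq_add2l ltn_add2l cP.
have mk_seen m : half_state t m -> mk m = seen t c.
  case=> _ h2 _ _; rewrite /mk h2 in_range.
  have -> : mark_at side c - mark_at side 0 = c by rewrite /mark_at addn0 addKn.
  case: (seen t c) => //=; case/andP: in_range => r1 r2; exact: unmarked.
apply: (@hoare_if M X M0 _ _ _ (fun m => if mk m != 0 then 0 else 1)) => [m bm [hm _]|m bm [hm oc] k0|].
- by rewrite /not_; apply: ev_cond; [exact: evm4|move=> _; ev|move=> _; ev].
- have sc : seen t c by move: k0; rewrite mk_seen //; case: (seen t c).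
  have e c' : seen t.+1 c' = seen t c'.
    by rewrite seenS -/c; case: (c =P c') => [<-|]; rewrite ?sc ?andbF ?orbF.
  case: hm => h1 h2 h3 h4; split=> // i; rewrite ?h2 ?e // h3.
  by under [in RHS]eq_bigl => c' do rewrite e.
apply: hoare_pre => m bm _ [[hm oc] k1].
have okc : ok c by case: (ok c) oc.
have nsc : seen t c = false.
  by apply/negbTE; move: k1; rewrite mk_seen //; case: (seen t c).
have e c' : seen t.+1 c' = seen t c' || (c == c') by rewrite seenS -/c okc.
have [h1 h2 h3 h4] := hm; case/andP: ja_range => ja4 ja8.
set m2 := upd m (adr b 4 (mark_at side c)) 1.
apply: (@hoare_seq _ _ _ (eq m2)).
  apply: (@hoare_store M X M0) => _ _ <-; exists (adr b 4 (mark_at side c)), 1; split=> //.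
  - by apply: ev_adr; [by []|by []|exact: evmark|exact: mark_at_le].
  - by ev.
have fr2 : frame b m0 m2 by apply: frame_upd.
have h42 j i : 4 < j -> j < 8 -> m2 (adr b j i) = m (adr b j i).
  by move=> j4 j8; rewrite /m2 upd_adr //; case: eqP => [e'|//]; lia.
have et : evals M X m2 envc etgt (tgt c) by apply: (@ev_tgt m2 t a be).
have ei : evals M X m2 envc einc (inc c).
  by apply: (@ev_inc m2 t a be) => // j i j4 j8 jj; rewrite h42 // h4.
(* The only newly seen code is [c]. *)
have sumE i : \sum_(c' < P | seen t.+1 c' && (tgt c' == i)) inc c' =
    \sum_(c' < P | seen t c' && (tgt c' == i)) inc c' + (if tgt c == i then inc c else 0).
  rewrite (bigID (fun c' : 'I_P => c == c')) /= addnC; congr (_ + _).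
    apply: eq_bigl => c'; rewrite e; case: (c =P c') => [<-|_]; rewrite ?orbF ?andbT //.
    by rewrite nsc /= andbF.
  case: ifP => ti.
    rewrite (big_pred1 (Ordinal cP)) // => c'; rewrite /= e.
    case: (c =P c') => [cc|ne]; first by rewrite -cc ti orbT /= -val_eqE /= -cc eqxx.
    by rewrite andbF -val_eqE /=; apply/esym/eqP => e'; apply: ne.
  by rewrite big1 // => c' /andP[/andP[_ /eqP tc] /eqP cc]; rewrite cc tc eqxx in ti.
have sum_le : m1 (adr b ja (tgt c)) +
    \sum_(c' < P | seen t.+1 c' && (tgt c' == tgt c)) inc c' <= M.
  apply: leq_trans (sum_bound cP); rewrite leq_add2l [X in X <= _]big_mkcond /=.
  by apply: leq_sum => c' _; case: ifP.
apply: (@hoare_store M X M0) => _ _ <-.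
exists (adr b ja (tgt c)), (m (adr b ja (tgt c)) + inc c); split.
- by apply: ev_adr; [by []|by []|exact: et|exact: tgt_bound].
- rewrite -h42 //; apply: EvBin => //.
    by apply: ev_arr; [by []|by []|exact: et|exact: tgt_bound].
  by rewrite /= h42 // h3; by move: sum_le; rewrite sumE eqxx addnA.
split.
- by apply: frame_upd => //; lia.
- move=> i; rewrite upd_adr //; case: eqP => [e'|_]; first by lia.
  rewrite /= /m2 upd_adr //= h2 e; case: (i =P mark_at side c) => [->|ne].
    by rewrite in_range /= {3}/mark_at /mark_at addn0 addKn eqxx orbT.
  case: (boolP (mark_at side 0 <= i < mark_at side P)) => //= /andP[i1 i2].
  have -> : (c == i - mark_at side 0) = false; last by rewrite orbF.
  apply/eqP => ec; apply: ne; rewrite -(subnKC i1) -ec.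
  by rewrite /mark_at addn0.
- move=> i; rewrite upd_adr // eqxx /= sumE eq_sym; case: eqP => [->|_].
    by rewrite h3 addnA.
  by rewrite h42 // h3 addn0.
- move=> j i j4 j8 jj; rewrite upd_adr // (negPf jj) /= h42 //; exact: h4.
Qed.

Lemma half_hoare :
  hoare M env (eq m1) (c_half side ja etgt einc)
    (cweight X (c_half side ja etgt einc) * T.+1) (half_state T).
Proof.
have M0 : 0 < M by lia.
eapply hoare_conseq with (P' := half_state 0) (Q' := half_state T).
- apply: (@hoare_for M X M0 _ half_state _ _ T (fun=> cweight X (c_try side ja etgt einc))) => [m _ _|t tT].
    apply: EvBin; last exact: M_T.
      by apply: (ev_call (vs := [:: n; r])); [rewrite /env; ev|apply: evals_pow].
    apply: (ev_call (vs := [:: B; k])); [rewrite /env; ev|apply: evals_pow => //; lia].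
  exact: try_hoare.
- rewrite sum_nat_const card_ord.
  have cw A D S : A + 2 + S * (D + 4) <= (A + 2 + (D + 4)) * S.+1.
    by rewrite mulnS mulnDl [S * _]mulnC; lia.
  exact: cw.
- move=> m _ _ <-; split=> // i; first by rewrite /seen /= andbF.
  by rewrite big_pred0 ?addn0.
- by [].
Qed.

End Loop.

End Half.

Section Labelling.

Variables (M X k n b g r B mode : nat) (m0 : nat -> nat) (LH : nat -> seq nat).

Local Notation P := (n.+1 ^ k).
Local Notation T := (n ^ r * B ^ k).
Local Notation L := (4 ^ (k * k)).

Hypothesis M_ge : 256 <= M.
Hypothesis kX : k * k + k + 2 <= X.
Hypothesis kkX : k ^ k <= X.
Hypothesis M_k : 4 * k * k + 4 * k + 2 <= M.
Hypothesis M_kk : k ^ k <= M.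
Hypothesis M_4 : L <= M.
Hypothesis M_pos : list_pos 1 LH k + k + 1 <= M.
Hypothesis pos_b : list_pos 1 LH k <= b.
Hypothesis M_adr : b + 8 * (n.+1 * n.+2) + 8 <= M.
Hypothesis M_big : b + 8 * (2 * L * P) + 8 <= M.
Hypothesis M_T : n ^ r * B ^ k <= M.
Hypothesis M_B : B ^ k <= M.
Hypothesis M_nk : n ^ r <= M.
Hypothesis M_sum : L * P * P <= M.
Hypothesis rX : r <= X.
Hypothesis rE : r = exponent k LH.
Hypothesis n_gt0 : 0 < n.
Hypothesis k_gt0 : 0 < k.
Hypothesis outs_lt : forall x y, x < n -> y \in outs n b m0 x -> y < n.
Hypothesis cell_le_n : forall x, x < n -> cell n b m0 x 0 <= n.
Hypothesis cell_le_X : forall x, x < n -> cell n b m0 x 0 <= X.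
Hypothesis cell_lt_B : forall x, x < n -> cell n b m0 x 0 < B.
Hypothesis LH_lt : forall u v, v \in LH u -> v < k.
Hypothesis LH_uniq : forall u, uniq (LH u).
Hypothesis m_size : forall u, u < k -> m0 (list_pos 1 LH u) = size (LH u).
Hypothesis m_nth : forall u j, u < k -> j < size (LH u) ->
  m0 (list_pos 1 LH u + 1 + j) = nth 0 (LH u) j.

Definition num_solutions (lam : nat) : nat :=
  #|[set phi : {ffun 'I_k -> 'I_n} | solution (label k lam) (sat (oriented n b m0)) phi]|.

(** The blocks of later labellings are still zero. The bound on the totals keeps them below [M]; it
    is stated for every sign, since entry 0 is written as well. *)
Definition lam_state (t : nat) (m : nat -> nat) : Prop :=
  [/\ frame b m0 m,
      forall i, t * 2 * P <= i -> m (adr b 4 i) = 0,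
      forall i, t * P <= i -> m (adr b 5 i) = 0,
      forall s, m (adr b 6 s) <= t * P * P &
      forall s, 0 < s -> m (adr b 6 s) =
        \sum_(lam < t | coef_code k LH mode lam == s) num_solutions lam].

Let env := [:: k; n; b; g; r; B; P].

(** The nonzero sign bounds the roots of a side by [r], and this is what lets the loop up to [T]
    meet every valid half. *)
Lemma seen_half lam side c : coef_code k LH mode lam != 0 -> c < P ->
  seen k n b B lam m0 side T c =
  half_ok k n (defined k n b lam m0 B) (label k lam) (sat (oriented n b m0)) side c.
Proof.
move=> s0 cP; have c0 : coef k (edge LH) mode lam != 0%R.
  rewrite -coef_codeE; move: s0; have := coef_code_le k LH mode lam (k * k).
  rewrite -/(coef_code k LH mode lam).
  by case: (coef_code k LH mode lam) => [|[|[|]]].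
apply/hasP/idP => [[i _ /andP[okc /eqP <-]]|h].
  exact: (code_at_half n_gt0 outs_lt (r := r) okc).
have [|i iT e] := half_code_at (r := r) n_gt0 outs_lt cell_lt_B cP _ h.
  move=> v vk /andP[/eqP dv _]; rewrite rE.
  exact: (roots_few n_gt0 cell_lt_B c0 vk dv).
exists i; first by rewrite mem_iota.
rewrite -/(code_at k n b lam m0 B r side i) e eqxx andbT.
by case/andP: h.
Qed.

Lemma labelling_hoare lam : lam < L ->
  hoare M (rcons env lam) (lam_state lam) (c_labelling mode)
    (cweight X (c_labelling mode) * T.+1) (lam_state lam.+1).
Proof.
move=> lamL; have M0 : 0 < M by lia.
have k2 : k * k + k + 2 <= M by lia.
have B_gt0 : 0 < B by have := cell_lt_B n_gt0; lia.
have P_gt0 : 0 < P by rewrite expn_gt0.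
have P_M : P <= M by apply: leq_trans M_sum; apply: leq_pmull; rewrite muln_gt0 P_gt0 expn_gt0.
have nkP : n ^ k <= P by rewrite leq_exp2r.
have nkM : n ^ k <= M := leq_trans nkP P_M.
have lamM : lam <= M := leq_trans (ltnW lamL) M_4.
have lam2 : lam.+1 * P <= L * P by rewrite leq_mul2r lamL orbT.
set c0 := pattern k n b lam m0 B 0; set c1 := pattern k n b lam m0 B 1.
set s := coef_code k LH mode lam.
set del := deleted k (arc_of k lam).
have cells m : frame b m0 m -> [/\ (forall x y, x < n -> y \in outs n b m x -> y < n),
    (forall x, x < n -> cell n b m x 0 <= n) & (forall x, x < n -> cell n b m x 0 <= X)].
  move=> fr; split=> [x y|x|x]; rewrite ?(frame_outs n _ fr) ?(frame_cell n _ _ fr).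
  - exact: outs_lt.
  - exact: cell_le_n.
  - exact: cell_le_X.
have pat_lt side : pattern k n b lam m0 B side < P.
  by apply: gen_lt => [x j xn|j]; [apply: nbr_lt|apply: digit_lt].
have evpat m env' side : frame b m0 m -> nth 0 env' 0 = k -> nth 0 env' 1 = n -> nth 0 env' 2 = b ->
    nth 0 env' 5 = B -> nth 0 env' 7 = lam -> nth 0 env' 8 = del -> side < 2 ->
    evals M X m env' (ecall e_gen [:: EVar 0; EVar 1; EVar 2; EVar 7; EVar 8; ENum side; EVar 5; ENum 0; ENum 0])
      (pattern k n b lam m0 B side).
  move=> fr h0 h1 h2 h5 h7 h8 s2; have [g1 g2 g3] := cells m fr.
  apply: (ev_call (vs := [:: k; n; b; lam; del; side; B; 0; 0])).
    eapply EvCons; first by rewrite -h0; ev.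
    eapply EvCons; first by rewrite -h1; ev.
    eapply EvCons; first by rewrite -h2; ev.
    eapply EvCons; first by rewrite -h7; ev.
    eapply EvCons; first by rewrite -h8; ev.
    eapply EvCons; first by ev.
    eapply EvCons; first by rewrite -h5; ev.
    by ev.
  by rewrite /pattern -(frame_nbr n fr); apply: evals_gen.
eapply hoare_conseq with (P' := lam_state lam) (Q' := lam_state lam.+1); [| |by []|by []].
apply: (@hoare_let M X M0 _ _ _ _ _ _ del) => [m _ _|].
  by apply: (ev_call (vs := [:: k; lam])); [rewrite /env /=; ev|apply: (@evals_deleted M X k n b lam)].
apply: (@hoare_let M X M0 _ _ _ _ _ _ c0) => [m _ [fr _ _ _ _]|].
  by apply: evpat.
apply: (@hoare_let M X M0 _ _ _ _ _ _ c1) => [m _ [fr _ _ _ _]|].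
  by apply: evpat.
apply: (@hoare_let M X M0 _ _ _ _ _ _ s) => [m _ [[fr _] _ _ _ _]|].
  apply: (ev_call (vs := [:: k; lam])); first by rewrite /env /=; ev.
  have pos_lt u : u < k -> list_pos 1 LH u + size (LH u) < b.
    move=> uk; apply: leq_trans pos_b; apply: leq_trans (list_pos_mono 1 LH uk).
    by rewrite list_posS; lia.
  apply: evals_coef => // [u uk|u j uk ju].
    by rewrite fr ?m_size //; have := pos_lt u uk; lia.
  by rewrite fr ?m_nth //; have := pos_lt u uk; lia.
rewrite /env /=; apply: hoare_pre => m1 bm1 _ [fr1 z4 z5 le6 eq6].
pose R side v := digit n.+1 (pattern k n b lam m0 B side) v != 0.
pose tgt1 c := lam * P + restrict n.+1 k (R 0) c.
have key_lt p c : restrict n.+1 k p c < P by apply: restrict_lt.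
have idx_lt p c : lam * P + restrict n.+1 k p c < L * P.
  by apply: leq_trans lam2; rewrite mulSn addnC ltn_add2r.
have idx_le p c : b + 8 * (lam * P + restrict n.+1 k p c) + 8 <= M.
  by apply: leq_trans M_big; have := idx_lt p c; lia.
have evkey m i a be c other side : frame b m0 m -> c < P -> side < 2 ->
    nth 0 [:: k; n; b; g; r; B; P; lam; del; c0; c1; s; i; a; be; c] other = pattern k n b lam m0 B side ->
    evals M X m [:: k; n; b; g; r; B; P; lam; del; c0; c1; s; i; a; be; c] (key_index other)
      (lam * P + restrict n.+1 k (R side) c).
  move=> fr cP s2 ho; have h := idx_lt (R side) c; have h' := idx_le (R side) c.
  apply: EvBin; [by ev; rewrite /=; lia| |by rewrite /=; lia].
  apply: (ev_call (vs := [:: k; n; c; pattern k n b lam m0 B side])).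
    by do 3!(eapply EvCons; first by ev); eapply EvCons; [rewrite -ho; ev|ev].
  by apply: (@evals_restrict M X k n b lam) => //; [apply: leq_trans (ltnW cP) P_M|apply: leq_trans (ltnW (pat_lt _)) P_M].
have h1 : hoare M [:: k; n; b; g; r; B; P; lam; del; c0; c1; s] (eq m1)
    (c_half 1 5 (key_index 9) (ENum 1)) (cweight X (c_half 1 5 (key_index 9) (ENum 1)) * T.+1)
    (half_state k n b B lam m0 1 5 tgt1 (fun=> 1) m1 T).
  apply: half_hoare => //.
  - move=> i i1 i2; apply: z4; apply: leq_trans i1; rewrite /mark_at addn0.
    by rewrite leq_mul2r leq_addr orbT.
  - by move=> c cP; apply: idx_le.
  - move=> c cP; rewrite z5; last by rewrite leq_addr.
    by rewrite sum_nat_const card_ord muln1.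
  - by move=> m i a be c fr cP; apply: (@evkey m i a be c 9 0).
  - by move=> m i a be c *; ev.
apply: (@hoare_seq _ _ _ _ _ _ _ _ _ h1).
apply: hoare_pre => m2 bm2 _ [fr2 z42 e5 oth2].
pose inc0 c := m2 (adr b 5 (lam * P + restrict n.+1 k (R 1) c)).
have incE c : inc0 c = #|[set c' : 'I_P | seen k n b B lam m0 1 T c' &
    restrict n.+1 k (R 0) c' == restrict n.+1 k (R 1) c]|.
  rewrite /inc0 e5 z5 ?leq_addr // add0n sum1dep_card.
  by apply: eq_card => c'; rewrite !inE /tgt1 eqn_add2l.
have inc_le c : inc0 c <= P by rewrite incE -[X in _ <= X]card_ord max_card.
have h0 : hoare M [:: k; n; b; g; r; B; P; lam; del; c0; c1; s] (eq m2)
    (c_half 0 6 (EVar 11) (earr 5 (key_index 10)))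
    (cweight X (c_half 0 6 (EVar 11) (earr 5 (key_index 10))) * T.+1)
    (half_state k n b B lam m0 0 6 (fun=> s) inc0 m2 T).
  apply: half_hoare => //.
  - move=> i i1 i2; rewrite z42 ifN; last first.
      apply/nandP; left; apply/nandP; left; rewrite -ltnNge; apply: leq_trans i2 _.
      by rewrite /mark_at !addn0 mulnDl mul1n.
    by apply: z4; apply: leq_trans i1; rewrite /mark_at !addn0.
  - move=> c cP; apply: leq_trans M_big; rewrite leq_add2r leq_add2l leq_mul2l /=.
    apply: (@leq_trans 2); first exact: coef_code_le.
    by rewrite -mulnA leq_pmulr // muln_gt0 P_gt0 expn_gt0.
  - move=> c cP; rewrite oth2 //.
    apply: leq_trans M_sum; apply: (@leq_trans (lam.+1 * P * P)); last by rewrite leq_mul2r lam2 orbT.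
    rewrite -mulnA mulSn mulnA addnC; apply: leq_add; last exact: le6.
    apply: (@leq_trans (\sum_(c' < P) P)); first exact: leq_sum.
    by rewrite sum_nat_const card_ord.
  - by move=> m i a be c fr cP; ev.
  - move=> m i a be c fr oth cP; rewrite /inc0 -oth //.
    by apply: ev_arr; [by []|by []|apply: (@evkey m i a be c 10 1)|apply: idx_le].
apply: (hoare_conseq h0 (leqnn _)) => [m _ _ <- //|m3 bm3 [fr3 z43 e6 oth3]].
have le_inc s' : \sum_(c < P | seen k n b B lam m0 0 T c && (s == s')) inc0 c <= P * P.
  apply: (@leq_trans (\sum_(c < P | seen k n b B lam m0 0 T c && (s == s')) P)).
    exact: leq_sum.
  by rewrite sum_nat_const leq_mul2r; apply/orP; right; rewrite -[X in _ <= X]card_ord max_card.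
(* Addresses from the block of the next labelling on lie beyond the marks that [lam] may set on
   either side. *)
have out side i : lam.+1 * 2 * P <= i -> side < 2 ->
    (mark_at k n lam side 0 <= i < mark_at k n lam side P) = false.
  move=> li s2; apply/negbTE/nandP; right; rewrite -leqNgt; apply: leq_trans li.
  have -> : mark_at k n lam side P = (lam * 2 + side).+1 * P by rewrite mulSn addnC.
  by rewrite leq_mul2r; apply/orP; right; lia.
split=> //.
- move=> i li; rewrite z43 out // z42 out //; apply: z4; apply: leq_trans li.
  by rewrite !leq_mul2r ltnW ?orbT.
- move=> i li; rewrite oth3 // e5 z5 ?add0n.
    rewrite big_pred0 // => c; apply/negbTE/nandP; right; apply/eqP => e.
    by move: li; rewrite -e leqNgt /tgt1 mulSn addnC ltn_add2r key_lt.
  by apply: leq_trans li; rewrite leq_mul2r ltnW ?orbT.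
- move=> s'; rewrite e6 oth2 // -mulnA mulSn mulnA addnC.
  by apply: leq_add; [exact: le_inc|exact: le6].
- move=> s' s'0; rewrite e6 oth2 // eq6 // [RHS]big_mkcond big_ord_recr /= -big_mkcond /=.
  congr (_ + _); rewrite -/s; case: eqP => [ss|_]; last by rewrite big_pred0 // => c; rewrite andbF.
  have s0 : s != 0 by lia.
  rewrite /num_solutions (join_halves (k := k) n (R := defined k n b lam m0 B)) //.
  + apply: eq_big => [c|c _]; first by rewrite andbT seen_half.
    rewrite incE; apply: eq_card => c'; rewrite !inE seen_half //.
  + by move=> v vk; apply: defined_cover.
  + by move=> u v uv vk lv; apply: (@defined_pair k n b lam m0 B).
have cw a a1 a2 a3 a4 a5 S : a + (a1 + (a2 + (a3 + (a4 * S.+1 + a5 * S.+1)))) <=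
    (a + (a1 + (a2 + (a3 + (a4 + a5))))) * S.+1.
  by rewrite !mulnDl !leq_add // leq_pmulr.
exact: cw.
Qed.

End Labelling.

Section Count.

Variables (M X k n b g mode : nat) (m0 : nat -> nat) (LH : nat -> seq nat).

Local Notation r := (exponent k LH).
Local Notation B := (threshold b m0 + 2).
Local Notation P := (n.+1 ^ k).
Local Notation T := (n ^ r * B ^ k).
Local Notation L := (4 ^ (k * k)).
Local Notation D := (oriented n b m0).

Hypothesis M_ge : 256 <= M.
Hypothesis kX : k * k + k + 2 <= X.
Hypothesis kkX : k ^ k <= X.
Hypothesis M_k : 4 * k * k + 4 * k + 2 <= M.
Hypothesis M_kk : k ^ k <= M.
Hypothesis M_4 : L <= M.
Hypothesis M_pos : list_pos 1 LH k + k + 1 <= M.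
Hypothesis pos_b : list_pos 1 LH k <= b.
Hypothesis M_adr : b + 8 * (n.+1 * n.+2) + 8 <= M.
Hypothesis M_big : b + 8 * (2 * L * P) + 8 <= M.
Hypothesis M_T : T <= M.
Hypothesis M_sum : L * P * P <= M.
Hypothesis B_X : B <= X.
Hypothesis n_gt0 : 0 < n.
Hypothesis k_gt0 : 0 < k.
Hypothesis outs_lt : forall x y, x < n -> y \in outs n b m0 x -> y < n.
Hypothesis cell_le_n : forall x, x < n -> cell n b m0 x 0 <= n.
Hypothesis cell_lt_B : forall x, x < n -> cell n b m0 x 0 < B.
Hypothesis zero : forall j i, 4 <= j -> j < 8 -> m0 (adr b j i) = 0.
Hypothesis D_excl : forall x y, ~~ (D x y && D y x).
Hypothesis D_irr : forall x, ~~ D x x.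
Hypothesis LH_lt : forall u v, v \in LH u -> v < k.
Hypothesis LH_uniq : forall u, uniq (LH u).
Hypothesis m_size : forall u, u < k -> m0 (list_pos 1 LH u) = size (LH u).
Hypothesis m_nth : forall u j, u < k -> j < size (LH u) ->
  m0 (list_pos 1 LH u + 1 + j) = nth 0 (LH u) j.

Lemma exponent_le : r <= k.+1.
Proof. by rewrite (leq_trans (count_size _ _)) // size_iota addn1. Qed.

(** Collecting the labellings of sign 1 and of sign -1 separately turns inclusion-exclusion into an
    equation between natural numbers, so the truncated subtraction of the machine is exact. *)
Lemma signed_count m : lam_state k n b mode m0 LH L m ->
  m (adr b 6 1) = m (adr b 6 2) +
    #|[set phi : {ffun 'I_k -> 'I_n} | target (edge LH) D mode phi]|.
Proof.
case=> _ _ _ _ eq6; rewrite !eq6 //.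
suff h : ((\sum_(lam < L | coef_code k LH mode lam == 1) num_solutions k n b m0 lam)%:Z =
    (\sum_(lam < L | coef_code k LH mode lam == 2) num_solutions k n b m0 lam)%:Z +
    #|[set phi : {ffun 'I_k -> 'I_n} | target (edge LH) D mode phi]|%:Z)%R.
  by apply/eqP; rewrite -eqz_nat PoszD h.
rewrite -(inclusion_exclusion k n (edge LH) mode D_excl D_irr).
rewrite [\sum_(lam < L | _ == 1) _]big_mkcond [\sum_(lam < L | _ == 2) _]big_mkcond /=.
rewrite !(big_morph Posz PoszD (erefl _)) -big_split /=.
apply: eq_bigr => lam _; rewrite -coef_codeE /num_solutions.
have := coef_code_le k LH mode lam (k * k); rewrite -/(coef_code k LH mode lam).
case: (coef_code k LH mode lam) => [|[|[|//]]] _ /=;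
  by rewrite ?GRing.mul0r ?GRing.mul1r ?GRing.mulN1r ?GRing.addr0 ?GRing.add0r ?GRing.addrN.
Qed.

Lemma count_hoare :
  hoare M [:: k; n; b; g] (eq m0) (c_count mode)
    (cweight X (c_count mode) * (L * T.+1).+1)
    (fun m => frame b m0 m /\ m (adr b 6 1) = m (adr b 6 2) +
      #|[set phi : {ffun 'I_k -> 'I_n} | target (edge LH) D mode phi]|).
Proof.
have M0 : 0 < M by lia.
have P_gt0 : 0 < P by rewrite expn_gt0.
have L_gt0 : 0 < L by rewrite expn_gt0.
have T_gt0 : 0 < T by rewrite muln_gt0 !expn_gt0 n_gt0 addn2.
have P_M : P <= M by apply: leq_trans M_sum; apply: leq_pmull; rewrite muln_gt0 L_gt0 P_gt0.
have nr_M : n ^ r <= M by apply: leq_trans M_T; apply: leq_pmulr; rewrite expn_gt0 addn2.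
have Bk_M : B ^ k <= M by apply: leq_trans M_T; apply: leq_pmull; rewrite expn_gt0 n_gt0.
have rX : r <= X by apply: leq_trans exponent_le _; lia.
have cell_le_X x : x < n -> cell n b m0 x 0 <= X.
  by move=> xn; apply: leq_trans B_X; apply: ltnW; apply: cell_lt_B.
eapply hoare_conseq with (P' := eq m0) (Q' := lam_state k n b mode m0 LH L); [|shelve|by []|by move=> m bm hm; split; [case: hm|apply: signed_count]].
apply: (@hoare_let M X M0 _ _ _ _ _ _ r) => [m _ <-|].
  by apply: (ev_call (vs := [:: k])); [ev|apply: (evals_exponent (LH := LH))].
apply: (@hoare_let M X M0 _ _ _ _ _ _ B) => [m _ <-|].
  rewrite /threshold; apply: EvBin; [|by ev|].
    by apply: ev_arr; [by []|by []|ev|lia].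
  by rewrite /=; apply: leq_trans Bk_M; rewrite -[X in X <= _]expn1 leq_pexp2l // addn2.
apply: (@hoare_let M X M0 _ _ _ _ _ _ P) => [m _ <-|].
  apply: (ev_call (vs := [:: n.+1; k])); last by apply: evals_pow => //; lia.
  have n1 : n.+1 <= n.+1 * n.+2 by rewrite leq_pmulr.
  have n1M : n + 1 <= M by lia.
  by rewrite /=; eapply EvCons; [apply: (ev_eq (v := n + 1)); [rewrite /succ; ev|rewrite addn1]|ev].
rewrite /=; apply: (hoare_conseq (P' := lam_state k n b mode m0 LH 0)); [|exact: leqnn| |].
- apply: (@hoare_for M X M0 _ (lam_state k n b mode m0 LH) _ _ L
    (fun=> cweight X (c_labelling mode) * T.+1)) => [m _ _|lam lamL].
    apply: (ev_call (vs := [:: 4; k * k])); first by ev; lia.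
    by apply: evals_pow => //; lia.
  by apply: labelling_hoare.
- move=> m _ _ <-; split=> // [i _|i _|s|s s0]; rewrite ?zero //.
  by rewrite big_ord0.
- by [].
Unshelve.
rewrite /= sum_nat_const card_ord.
have cw a1 a2 a3 a4 x l t : 0 < t -> a1 + (a2 + (a3 + (a4 + 2 + l * (x * t + 4)))) <=
    (a1 + (a2 + (a3 + (a4 + 2 + (x + 4))))) * (l * t).+1.
  move=> t0; rewrite !mulnDl -!addnA !leq_add ?leq_pmulr // mulnDr leq_add //.
    by rewrite mulnCA leq_mul2l leqnSn orbT.
  by rewrite mulnC leq_mul2l /= leqW // leq_pmulr.
exact: cw.
Qed.

End Count.

(** * The complete program *)

Definition e_size : expr := EGet (ecall e_pattern_pos [:: EVar 0]).
(** [(k + n + 2) ^ 2] exceeds the length of the input, which is at most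
    [k * (k + 1) + n * (n + 1) + 2], so the working memory starts where all cells are still zero. *)
Definition e_base : expr :=
  EBin Mul (EBin Add (EVar 0) (EBin Add (EVar 1) (ENum 2)))
           (EBin Add (EVar 0) (EBin Add (EVar 1) (ENum 2))).

(** Nothing is computed for an empty pattern or host: [e_result] gives 1 when [k] is 0, and for
    nonempty patterns the untouched totals give 0 when [n] is 0. *)
Definition c_main (mode : nat) : cmd :=
  CLet (EGet (ENum 0)) (CIf (EVar 0)
  (CLet e_size (CIf (EVar 1)
  (CLet e_base
  (CLet (succ (ecall e_pattern_pos [:: EVar 0]))
  (CSeq c_positions (CSeq c_peel (c_count mode)))))))).

Definition e_result (mode : nat) : expr :=
  ELet (EGet (ENum 0)) (ECond (EVar 0)
    (ELet e_size (ELet e_base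
      (EBin Div (EBin Defs.Sub (earr 6 (ENum 1)) (earr 6 (ENum 2)))
         (if mode is 0 then ENum 1 else ecall e_aut [:: EVar 0]))))
    (ENum 1)).

Section Program.

Variables (M X k n d mode : nat) (inp : nat -> nat) (LH NL : nat -> seq nat).

Local Notation r := (exponent k LH).
Local Notation b := ((k + (n + 2)) * (k + (n + 2))).
Local Notation g := (list_pos 1 LH k + 1).
Local Notation P := (n.+1 ^ k).
Local Notation T := (n ^ r * (4 * d + 2) ^ k).
Local Notation L := (4 ^ (k * k)).

Hypothesis M_ge : 256 <= M.
Hypothesis kX : k * k + k + 2 <= X.
Hypothesis kkX : k ^ k <= X.
Hypothesis M_k : 4 * k * k + 4 * k + 2 <= M.
Hypothesis M_kk : k ^ k <= M.
Hypothesis M_4 : L <= M.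
Hypothesis M_pos : list_pos 1 LH k + k + 1 <= M.
Hypothesis M_n : 4 * n + 1 <= M.
Hypothesis M_adr : b + 8 * (n.+1 * n.+2) + 8 <= M.
Hypothesis M_big : b + 8 * (2 * L * P) + 8 <= M.
Hypothesis M_T : T <= M.
Hypothesis M_sum : L * P * P <= M.
Hypothesis d_X : 4 * d + 2 <= X.
Hypothesis LH_lt : forall u v, v \in LH u -> v < k.
Hypothesis LH_uniq : forall u, uniq (LH u).
Hypothesis NL_lt : forall x y, y \in NL x -> y < n.
Hypothesis NL_uniq : forall x, uniq (NL x).
Hypothesis NL_irr : forall x, x \notin NL x.
Hypothesis NL_sym : forall x y, x < n -> y < n -> (x \in NL y) = (y \in NL x).
Hypothesis d_le : d <= n.
Hypothesis sparse : forall p : pred nat,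
  \sum_(x < n | p x) count p (NL x) <= 2 * d * count p (iota 0 n).
Hypothesis inp_k : inp 0 = k.
Hypothesis inp_H_size : forall u, u < k -> inp (list_pos 1 LH u) = size (LH u).
Hypothesis inp_H_nth : forall u j, u < k -> j < size (LH u) ->
  inp (list_pos 1 LH u + 1 + j) = nth 0 (LH u) j.
Hypothesis inp_n : inp (list_pos 1 LH k) = n.
Hypothesis inp_size : forall x, x < n -> inp (list_pos g NL x) = size (NL x).
Hypothesis inp_nth : forall x j, x < n -> j < size (NL x) ->
  inp (list_pos g NL x + 1 + j) = nth 0 (NL x) j.
Hypothesis inp_zero : forall a, b <= a -> inp a = 0.
Hypothesis pos_b : list_pos g NL n <= b.

Let adjacent (x y : nat) : bool := y \in NL x.

Definition answer : nat :=
  #|[set phi : {ffun 'I_k -> 'I_n} | target (edge LH) adjacent mode phi]|.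

Definition main_size : nat := n.+1 + peel_size n d + (L * T.+1).+1.

Definition finished (m : nat -> nat) : Prop :=
  (forall a, a < b -> m a = inp a) /\ (0 < k -> m (adr b 6 1) = m (adr b 6 2) + answer).

Lemma target_oriented m (phi : {ffun 'I_k -> 'I_n}) :
  peel_ok n b g inp NL m -> remaining b m = 0 ->
  target (edge LH) (oriented n b m) mode phi = target (edge LH) adjacent mode phi.
Proof.
move=> ok rem; apply: eq_forallb => u; apply: eq_forallb => v; congr (_ ==> _).
rewrite /pair_target -(oriented_adj NL_sym ok rem) // /adjacent NL_sym ?orbb //.
Qed.

Let pos_lt_b u : u <= k -> list_pos 1 LH u < b.
Proof.
move=> uk; have := list_pos_mono 1 LH uk; have := list_pos_mono g NL (leq0n n).
rewrite {1}/list_pos big_geq // addn0; lia.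
Qed.

Lemma low_pattern m : (forall a, a < b -> m a = inp a) ->
  [/\ m 0 = k, m (list_pos 1 LH k) = n,
      forall u, u < k -> m (list_pos 1 LH u) = size (LH u) &
      forall u j, u < k -> j < size (LH u) -> m (list_pos 1 LH u + 1 + j) = nth 0 (LH u) j].
Proof.
move=> low; split=> [||u uk|u j uk ju].
- by rewrite low ?inp_k //; lia.
- by rewrite low ?pos_lt_b.
- by rewrite low ?inp_H_size // pos_lt_b // ltnW.
- rewrite low ?inp_H_nth //; have := pos_lt_b uk; rewrite list_posS; lia.
Qed.

Lemma evals_pos m env : 0 < k -> (forall a, a < b -> m a = inp a) -> nth 0 env 0 = k ->
  evals M X m env (ecall e_pattern_pos [:: EVar 0]) (list_pos 1 LH k).
Proof.
move=> k_gt0 low e0; have [_ _ h _] := low_pattern low.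
apply: (ev_call (vs := [:: k])); first by eapply EvCons; [rewrite -e0; ev|ev].
by apply: (evals_pattern_pos (LH := LH) (k := k)).
Qed.

Lemma evals_size m env : 0 < k -> (forall a, a < b -> m a = inp a) -> nth 0 env 0 = k ->
  evals M X m env e_size n.
Proof.
move=> k_gt0 low e0; have [_ <- _ _] := low_pattern low.
by eapply EvGet; apply: evals_pos.
Qed.

Lemma evals_base m env : nth 0 env 0 = k -> nth 0 env 1 = n -> evals M X m env e_base b.
Proof.
move=> e0 e1; have bM : b <= M by lia.
have sM : k + (n + 2) <= M by apply: leq_trans bM; rewrite leq_pmulr // addnA addn2.
have es : evals M X m env (EBin Add (EVar 0) (EBin Add (EVar 1) (ENum 2))) (k + (n + 2)).
  apply: (ev_eq (v := nth 0 env 0 + (nth 0 env 1 + 2))); last by rewrite e0 e1.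
  by ev; rewrite ?e0 ?e1 /=; lia.
by apply: EvBin.
Qed.

Lemma main_hoare :
  hoare M [::] (eq inp) (c_main mode) (cweight X (c_main mode) * main_size) finished.
Proof.
have M0 : 0 < M by lia.
eapply hoare_conseq with (P' := eq inp) (Q' := finished); [|shelve|by []|by []].
apply: (@hoare_let M X M0 _ _ _ _ _ _ k) => [m _ <-|].
  by rewrite -inp_k; ev.
apply: (@hoare_if M X M0 _ _ _ (fun=> k)) => [m _ _|m _ <- k0|]; first by ev.
  by split=> //; rewrite k0.
apply: hoare_pre => m _ _ [<- k1] {m}; have k_gt0 : 0 < k by lia.
apply: (@hoare_let M X M0 _ _ _ _ _ _ n) => [m _ <-|].
  exact: evals_size.
apply: (@hoare_if M X M0 _ _ _ (fun=> n)) => [m _ _|m _ <- n0|]; first by ev.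
  split=> // _; rewrite !inp_zero ?addn0; last by rewrite /adr; lia.
  - apply/esym/eqP; rewrite cards_eq0 -subset0; apply/subsetP => phi _.
    by have := ltn_ord (phi (Ordinal k_gt0)); rewrite [X in _ < X]n0.
  - by rewrite /adr; lia.
apply: hoare_pre => m _ _ [<- n1] {m}; have n_gt0 : 0 < n by lia.
apply: (@hoare_let M X M0 _ _ _ _ _ _ b) => [m _ <-|]; first exact: evals_base.
apply: (@hoare_let M X M0 _ _ _ _ _ _ g) => [m _ <-|].
  apply: (ev_eq (v := op_sem Add (list_pos 1 LH k) 1)) => //.
  by apply: EvBin; [exact: evals_pos|ev|rewrite /=; lia].
rewrite /=.
have gM : g <= M by lia.
have kM : k <= M by lia.
apply: (@hoare_seq _ _ _ (fun m => positioned n b g inp NL m /\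
     (forall j i, 0 < j -> j < 8 -> m (adr b j i) = 0))).
  eapply hoare_conseq with (Q' := fun m => positioned n b g inp NL m /\
     (forall j i, 0 < j -> j < 8 -> m (adr b j i) = 0)); [|exact: leqnn| |by []].
    by apply: (positions_hoare X (d := d)).
  by move=> m _ _ <-; split=> // a ab; apply: inp_zero.
apply: (@hoare_seq _ _ _ (fun m => [/\ peel_ok n b g inp NL m, threshold b m <= 4 * d &
    remaining b m = 0])).
  by apply: (peel_hoare X).
apply: hoare_pre => m1 _ _ [ok th rem].
have low a : a < b -> m1 a = inp a by apply: po_in; apply: po_base ok.
have [m_k m_n m_size m_nth] := low_pattern low.
(* The counting phase branches by the threshold actually reached, which is at most [4 * d]. *)
have BT : n ^ r * (threshold b m1 + 2) ^ k <= T.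
  by rewrite leq_mul2l; apply/orP; right; rewrite leq_exp2r //; lia.
have h : hoare M [:: k; n; b; g] (eq m1) (c_count mode)
    (cweight X (c_count mode) * (L * (n ^ r * (threshold b m1 + 2) ^ k).+1).+1)
    (fun m => frame b m1 m /\ m (adr b 6 1) = m (adr b 6 2) +
      #|[set phi : {ffun 'I_k -> 'I_n} | target (edge LH) (oriented n b m1) mode phi]|).
  apply: count_hoare => //.
  - by apply: ltnW; apply: pos_lt_b.
  - exact: leq_trans BT M_T.
  - by apply: leq_trans d_X; rewrite leq_add2r.
  - by move=> x y xn yo; apply: (oriented_lt NL_lt ok rem (x := x)); rewrite /oriented xn.
  - by move=> x xn; apply: (po_cntn ok xn); apply: all_peeled ok rem xn.
  - by move=> x xn; have := cell_le ok rem xn; lia.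
  - by move=> j i j4 j8; rewrite (po_zero (po_base ok)).
  - by move=> x y; apply: oriented_excl ok rem.
  - by move=> x; have := oriented_excl x x ok rem; rewrite andbb.
apply: (hoare_conseq (C := cweight X (c_count mode) * (L * T.+1).+1) h) => [|m _ _ -> //|m _ [[fr _] e]].
  by rewrite leq_mul2l ltnS leq_mul2l ltnS BT !orbT.
split=> [a ab|_]; first by rewrite fr ?low.
rewrite e; congr (_ + _); apply: eq_card => phi; rewrite !inE.
exact: target_oriented ok rem.
Unshelve.
rewrite /main_size /=.
have cw a1 a2 a3 a4 a5 a6 p q c x y z : 0 < z ->
    a1 + (a2 + ((a3 + (a4 + ((a5 + (a6 + (p * x + (q * y + c * z)))) + 2))) + 2)) <=
    (a1 + (a2 + ((a3 + (a4 + ((a5 + (a6 + (p + (q + c)))) + 2))) + 2))) * (x + y + z).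
  move=> z0; have [s0 xs ys zs] : [/\ 0 < x + y + z, x <= x + y + z, y <= x + y + z & z <= x + y + z].
    by split; lia.
  by rewrite !(mulnDl _ _ (x + y + z)) !leq_add ?leq_pmulr // leq_mul2l ?xs ?ys ?zs orbT.
exact: cw.
Qed.

Lemma result_evals m : bounded M m -> finished m ->
  evals M X m [::] (e_result mode)
    (if k != 0 then answer %/ (if mode is 0 then 1 else auts k LH) else 1).
Proof.
move=> bm [low fin]; have [m_k m_n m_size m_nth] := low_pattern low.
apply: (@EvLet _ _ _ _ _ _ k); first by apply: (ev_eq (v := m 0)); [ev|].
apply: ev_cond; [by ev|move=> /= k1|by move=> _; ev].
have k_gt0 : 0 < k by lia.
apply: (@EvLet _ _ _ _ _ _ n); first exact: evals_size.
apply: (@EvLet _ _ _ _ _ _ b); first exact: evals_base.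
have arr s : s < 3 -> evals M X m [:: k; n; b] (earr 6 (ENum s)) (m (adr b 6 s)).
  by move=> s3; apply: ev_arr; [by []|by []|ev|lia].
apply: (ev_eq (v := op_sem Div (op_sem Defs.Sub (m (adr b 6 1)) (m (adr b 6 2)))
    (if mode is 0 then 1 else auts k LH))).
  apply: EvBin; [by apply: EvBin; [exact: arr|exact: arr|]| |by []].
  case: mode => [|md]; first by ev.
  apply: (ev_call (vs := [:: k])); first by ev.
  exact: evals_aut.
by rewrite /= fin // addKn.
Qed.

End Program.

(** * The encoded input *)

Definition blocks (NL : nat -> seq nat) (n : nat) : seq nat :=
  flatten [seq size (NL x) :: NL x | x <- iota 0 n].

Lemma blocksS NL n : blocks NL n.+1 = blocks NL n ++ size (NL n) :: NL n.
Proof. by rewrite /blocks -addn1 iotaD map_cat flatten_cat /= cats0. Qed.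

Lemma list_pos_blocks g NL n : list_pos g NL n = g + size (blocks NL n).
Proof.
rewrite /list_pos; congr (_ + _); elim: n => [|n IH]; first by rewrite big_geq.
by rewrite blocksS size_cat big_nat_recr //= IH.
Qed.

Lemma nth_blocks pre NL n rest x j : x < n -> j <= size (NL x) ->
  nth 0 (pre ++ blocks NL n ++ rest) (list_pos (size pre) NL x + j) =
  nth 0 (size (NL x) :: NL x) j.
Proof.
move=> xn jx; rewrite list_pos_blocks nth_cat -addnA ltnNge leq_addr /= addKn.
elim: n rest xn => // n IH rest; rewrite ltnS leq_eqVlt blocksS -catA => /orP[/eqP xn|xn]; last exact: IH.
by rewrite -xn nth_cat ltnNge leq_addr /= addKn -cat_cons nth_cat /= ltnS jx.
Qed.

(** A total function on numbers, empty beyond the range, as the program sees plain addresses. *)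
Definition nat_lists (n : nat) (L : 'I_n -> seq 'I_n) (x : nat) : seq nat :=
  if insub x is Some i then [seq val y | y <- L i] else [::].

Lemma nat_lists_val n (L : 'I_n -> seq 'I_n) (x : 'I_n) : nat_lists L x = [seq val y | y <- L x].
Proof. by rewrite /nat_lists valK. Qed.

Lemma encode_blocks n (L : 'I_n -> seq 'I_n) : encode_lists L = n :: blocks (nat_lists L) n.
Proof.
rewrite /encode_lists /blocks -val_enum_ord -map_comp; congr (_ :: flatten _).
by apply: eq_map => x /=; rewrite nat_lists_val size_map.
Qed.

Lemma nat_lists_lt n (L : 'I_n -> seq 'I_n) x y : y \in nat_lists L x -> y < n.
Proof. by rewrite /nat_lists; case: insub => [i|//] /mapP[z _ ->]; apply: ltn_ord. Qed.

Section Lists.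

Variables (n : nat) (G : sgraph 'I_n) (L : 'I_n -> seq 'I_n).
Hypothesis adjL : adjacency_lists G L.

Lemma nat_lists_uniq x : uniq (nat_lists L x).
Proof.
rewrite /nat_lists; case: insub => [i|//]; rewrite map_inj_uniq; last exact: val_inj.
by case: (adjL i).
Qed.

Lemma nat_lists_adj (x y : 'I_n) : (val y \in nat_lists L x) = G x y.
Proof. by rewrite nat_lists_val mem_map; [case: (adjL x)|exact: val_inj]. Qed.

Lemma nat_lists_irr x : x \notin nat_lists L x.
Proof.
apply/negP => h; have xn := nat_lists_lt h.
by move: h; rewrite -[x]/(val (Ordinal xn)) nat_lists_adj adj_irrefl.
Qed.

Lemma nat_lists_sym x y : x < n -> y < n -> (x \in nat_lists L y) = (y \in nat_lists L x).
Proof.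
move=> xn yn; rewrite -[x]/(val (Ordinal xn)) -[y]/(val (Ordinal yn)) !nat_lists_adj.
exact: adj_sym.
Qed.

Lemma count_nat_lists (p : pred nat) (x : 'I_n) :
  count p (nat_lists L x) = \sum_(y < n | p y) G x y.
Proof.
have [u h] := adjL x.
rewrite nat_lists_val count_map -size_filter -(card_uniqP (filter_uniq _ u)) -sum1_card.
rewrite big_mkcond [RHS]big_mkcond /=; apply: eq_bigr => y _.
by rewrite mem_filter h /=; case: (p y); case: (G x y).
Qed.

(** Out-degrees never exceed [n], and the degeneracy is minimal. *)
Lemma degeneracy_le d : is_degeneracy G d -> d <= n.
Proof.
case=> -[D [h1 h2 h3]] min; apply: min; exists D; split=> // x.
by rewrite /outdegree -[X in _ <= X](card_ord n) max_card.
Qed.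

(** Every edge inside [p] is counted at both of its ends. The orientation charges it to its tail,
    and no vertex is the tail of more than [d] edges. *)
Lemma degenerate_sparse d (p : pred nat) : degenerate G d ->
  \sum_(x < n | p x) count p (nat_lists L x) <= 2 * d * count p (iota 0 n).
Proof.
case=> D [orient _ out].
have -> : count p (iota 0 n) = \sum_(x < n | p x) 1.
  by rewrite -sum1_count -(big_mkord p (fun=> 1)) /index_iota subn0.
rewrite -mulnA big_distrr /= mul2n -addnn.
apply: (@leq_trans (\sum_(x < n | p x) \sum_(y < n | p y) (D x y + D y x))).
  apply: leq_sum => x _; rewrite count_nat_lists; apply: leq_sum => y _.
  by have [-> _] := orient x y; case: (D x y); case: (D y x).
rewrite (eq_bigr _ (fun x _ => big_split _ _ _ _ _)) big_split /= [X in _ + X <= _]exchange_big /=.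
have h : \sum_(x < n | p x) \sum_(y < n | p y) D x y <= \sum_(x < n | p x) d * 1.
  apply: leq_sum => x _; rewrite muln1; apply: leq_trans (out x).
  rewrite /outdegree -sum1_card big_mkcond [X in _ <= X]big_mkcond /=.
  by apply: leq_sum => y _; rewrite inE; case: (p y); case: (D x y).
exact: leq_add.
Qed.

End Lists.

(** * Meaning of the computed numbers *)

Section Meaning.

Variables (k n : nat) (H : sgraph 'I_k) (G : sgraph 'I_n).
Variables (LH : 'I_k -> seq 'I_k) (LG : 'I_n -> seq 'I_n).
Hypothesis adjH : adjacency_lists H LH.
Hypothesis adjG : adjacency_lists G LG.

Let pair_ok (mode : nat) (u v : 'I_k) (x y : 'I_n) : bool :=
  if H u v then G x y
  else match mode with 0 => true | 1 => x != y | _ => (x != y) && ~~ G x y end.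

(** The program constrains only pairs [u < v]; the condition on a pair is symmetric, so all pairs of
    distinct vertices may be used. *)
Lemma answer_target mode : answer k n mode (nat_lists LH) (nat_lists LG) =
  #|[set phi : {ffun 'I_k -> 'I_n} |
      [forall u, forall v, (u != v) ==> pair_ok mode u v (phi u) (phi v)]]|.
Proof.
apply: eq_card => phi; rewrite !inE /target.
have E (u v : 'I_k) x y : pair_target (edge (nat_lists LH))
    (fun x y => y \in nat_lists LG x) mode u v (val x) (val y) = pair_ok mode u v x y.
  by rewrite /pair_target /edge !(nat_lists_adj adjH, nat_lists_adj adjG) [G y x]adj_sym orbb.
have ok_sym u v x y : pair_ok mode u v x y = pair_ok mode v u y x.
  by rewrite /pair_ok adj_sym [G x y]adj_sym [x == y]eq_sym.
apply/forallP/forallP => h u; apply/forallP => v; apply/implyP => uv.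
  have /forallP/(_ v) := h u; have /forallP/(_ u) := h v; rewrite !E [pair_ok _ v u _ _]ok_sym.
  by move: uv; rewrite -val_eqE neq_ltn => /orP[->|->].
have /forallP/(_ v)/implyP := h u; rewrite E; apply.
by rewrite -val_eqE neq_ltn uv.
Qed.

Lemma answer_hom : answer k n 0 (nat_lists LH) (nat_lists LG) = hom H G.
Proof.
rewrite answer_target; apply: eq_card => phi; rewrite !inE.
apply: eq_forallb => u; apply: eq_forallb => v; rewrite /pair_ok.
by case: (u =P v) => [->|_]; [rewrite adj_irrefl|case: (H u v)].
Qed.

Lemma answer_sub : answer k n 1 (nat_lists LH) (nat_lists LG) = num_aut H * sub H G.
Proof.
rewrite -card_sub answer_target; apply: eq_card => phi; rewrite !inE.
apply/forallP/andP => [h|[/injectiveP inj /forallP h] u].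
  have ok u v : u != v -> pair_ok 1 u v (phi u) (phi v).
    by move=> uv; have /forallP/(_ v)/implyP := h u; apply.
  split.
    apply/injectiveP => u v e; apply/eqP; apply: contraT => /ok.
    by rewrite /pair_ok e adj_irrefl eqxx; case: (H u v).
  apply/forallP => u; apply/forallP => v; apply/implyP => huv.
  have := ok u v; rewrite /pair_ok huv; apply.
  by apply: contraTneq huv => ->; rewrite adj_irrefl.
apply/forallP => v; apply/implyP => uv; rewrite /pair_ok; case: ifP => [|_].
  by have /forallP/(_ v)/implyP := h u.
by apply: contra_neq uv; apply: inj.
Qed.

Lemma answer_ind : answer k n 2 (nat_lists LH) (nat_lists LG) = num_aut H * ind H G.
Proof.
rewrite -card_ind answer_target; apply: eq_card => phi; rewrite !inE.
apply/forallP/andP => [h|[/injectiveP inj /forallP h] u].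
  have ok u v : u != v -> pair_ok 2 u v (phi u) (phi v).
    by move=> uv; have /forallP/(_ v)/implyP := h u; apply.
  split.
    apply/injectiveP => u v e; apply/eqP; apply: contraT => /ok.
    by rewrite /pair_ok e adj_irrefl eqxx; case: (H u v).
  apply/forallP => u; apply/forallP => v; have [->|/ok] := eqVneq u v; first by rewrite !adj_irrefl.
  by rewrite /pair_ok; case: (H u v) => [->//|/andP[_ /negPf ->]].
apply/forallP => v; apply/implyP => uv; rewrite /pair_ok.
have /forallP/(_ v)/eqP -> := h u; case: ifP => // /negbT ->; rewrite andbT.
by apply: contra_neq uv; apply: inj.
Qed.

(** Base-[k] digits put the numbers below [k ^ k] in bijection with the maps from ['I_k] to
    itself. *)
Lemma auts_num_aut : 0 < k -> auts k (nat_lists LH) = num_aut H.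
Proof.
move=> k_gt0.
pose dec (c : 'I_(k ^ k)) := [ffun v : 'I_k => Ordinal (digit_lt c v k_gt0)].
have dec_inj : injective dec.
  move=> c c' /ffunP e; apply: val_inj; apply: (digit_inj k_gt0 (ltn_ord c) (ltn_ord c')) => v vk.
  by have := e (Ordinal vk); rewrite !ffunE => /(congr1 val).
pose good c := all (fun u => all (aut_ok k (nat_lists LH) c u) (iota 0 k)) (iota 0 k).
have goodE (c : 'I_(k ^ k)) : good c = embeds H H (dec c).
  rewrite /embeds; apply/all_iotaP/andP => [h|[/injectiveP inj /forallP h] u].
    have ok (u v : 'I_k) : aut_ok k (nat_lists LH) c u v by apply/all_iotaP: v; apply: h.
    split.
      apply/injectiveP => u v /(congr1 val); rewrite !ffunE /= => e; apply: val_inj.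
      by have /andP[_ /implyP] := ok u v; rewrite e eqxx => /(_ isT)/eqP.
    apply/forallP => u; apply/forallP => v; rewrite -!(nat_lists_adj adjH) !ffunE /=.
    by have /andP[] := ok u v.
  apply/all_iotaP => v; have /forallP/(_ v) := h u.
  rewrite -!(nat_lists_adj adjH) !ffunE /= => e; apply/andP; split=> //.
  apply/implyP => /eqP e'; rewrite (inj u v) //.
  by rewrite !ffunE; apply: val_inj.
rewrite /auts /num_aut -/good.
transitivity #|[set c : 'I_(k ^ k) | good c]|.
  by rewrite -sum1dep_card -(big_mkord good (fun=> 1)) /index_iota subn0 sum1_count.
rewrite -(card_imset _ dec_inj); apply: eq_card => s; rewrite [in RHS]inE.
apply/imsetP/idP => [[c]|hs]; first by rewrite inE goodE => gc ->.
pose g v : nat := if insub v is Some i then val (s i) else 0.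
have [v vk|c ck hc] := digit_exists (B := k) (k := k) (g := g).
  by rewrite /g; case: insub => [i|//]; apply: ltn_ord.
have e : s = dec (Ordinal ck).
  by apply/ffunP => v; apply: val_inj; rewrite ffunE /= hc // /g valK.
by exists (Ordinal ck); rewrite // inE goodE -e.
Qed.

(** Each removed edge is represented by its one ordered pair [u < v], the form in which the program
    counts non-edges. *)
Lemma missing_card (F : {set {set 'I_k}}) : F \subset edges (complete 'I_k) ->
  (forall u v, H u v = (u != v) && ([set u; v] \notin F)) ->
  missing k (nat_lists LH) = #|F|.
Proof.
move=> FK HE.
pose A := [set p : 'I_k * 'I_k | (p.1 < p.2) && ([set p.1; p.2] \in F)].
have -> : F = [set [set p.1; p.2] | p in A].
  apply/setP => e; apply/idP/imsetP => [eF|[p]]; last by rewrite inE => /andP[_ pF] ->.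
  have /(subsetP FK) := eF; rewrite inE => /existsP[u /existsP[v /andP[uv /eqP ee]]].
  have : u != v by []; rewrite -val_eqE neq_ltn => /orP[{}uv|{}uv].
    by exists (u, v); rewrite // inE uv -ee.
  by exists (v, u); rewrite ?inE /= ?uv setUC -ee.
rewrite card_in_imset; last first.
  move=> [u v] [u' v']; rewrite !inE /= => /andP[uv _] /andP[uv' _] /setP e.
  have := e u; have := e v; rewrite !inE !eqxx !orbT /=.
  move=> /esym/orP[/eqP e1|/eqP e1] /esym/orP[/eqP e2|/eqP e2];
    move: uv uv'; rewrite ?e1 ?e2 //; try (by rewrite ltnn).
  by move=> h1 h2; have := ltn_trans h1 h2; rewrite ltnn.
rewrite -sum1dep_card big_mkcond -(pair_bigA _ (fun u v : 'I_k =>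
  if (u < v) && ([set u; v] \in F) then 1 else 0)) /= /missing big_mkord.
apply: eq_bigr => u _; rewrite big_mkord; apply: eq_bigr => v _.
rewrite /edge (nat_lists_adj adjH) HE; case: ltnP => //= uv.
by rewrite negb_and negbK -val_eqE (ltn_eqF uv) /=; case: (_ \in F).
Qed.

End Meaning.

Import Order.TTheory GRing.Theory Num.Theory.

(** * Time bounds *)

(** With [s = sqrt (eps / 2)], a value [j >= 1/2 + s] would give
    [j * (2 * j + 1) > 2 * s ^ 2 = eps]. So [j] lies strictly below [1/2 + s], hence strictly below
    its ceiling. *)
Lemma lt_clique_exponent j eps : j * (j + j + 1) <= eps -> j < clique_exponent eps.
Proof.
move=> h; rewrite /clique_exponent; set x := (_ + _)%R.
have jx : (j%:R < x :> Rdefinitions.R)%R.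
  have h' : (j%:R * (j%:R + j%:R + 1) <= eps%:R :> Rdefinitions.R)%R.
    by rewrite [leLHS](_ : _ = (j * (j + j + 1))%:R)%R ?ler_nat // natrM !natrD.
  rewrite /x; set e := (eps%:R / 2%:R)%R; set s := Num.sqrt e.
  have s0 : (0 <= s)%R by apply: sqrtr_ge0.
  have ss : (s ^+ 2 = e)%R by rewrite sqr_sqrtr // divr_ge0.
  rewrite ltNge; apply/negP => xj.
  have j0 : (0 <= j%:R :> Rdefinitions.R)%R by [].
  have e2 : (e * 2%:R = eps%:R)%R by rewrite /e mulfVK // pnatr_eq0.
  nra.
(* The ceiling exceeds [j >= 0], so taking [absz] does not change it. *)
have : (j%:Z < Num.ceil x)%R.
  by rewrite -(ltr_int Rdefinitions.R); apply: lt_le_trans jx (ceil_ge x).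
by case: (Num.ceil x).
Qed.

Lemma exponent_le_clique k LH : exponent k LH <= clique_exponent (missing k LH).
Proof.
rewrite /exponent; set c := clique_exponent _.
apply: (@leq_trans (count (fun j => j < c) (iota 0 (k + 1)))).
  by apply: sub_count => j; apply: lt_clique_exponent.
elim: (k + 1) => [//|m IH]; rewrite -addn1 iotaD count_cat /= addn0 add0n.
case: ltnP => mc; last by rewrite addn0.
by apply: leq_trans mc; rewrite addn1 ltnS (leq_trans (count_size _ _)) // size_iota.
Qed.

Lemma leq_expl a c e : a <= c -> a ^ e <= c ^ e.
Proof. by case: e => // e; rewrite leq_exp2r. Qed.

Lemma list_pos_le g NL n m : (forall x, size (NL x) <= m) -> list_pos g NL n <= g + n * m.+1.
Proof.
move=> h; rewrite leq_add2l -[n in n * _]subn0 -sum_nat_const_nat.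
by apply: leq_sum => x _; apply: h.
Qed.

Lemma blocks_le NL n m a : (forall x, size (NL x) <= m) -> (forall x y, y \in NL x -> y <= m) ->
  a \in blocks NL n -> a <= m.
Proof.
move=> hs hy; elim: n => [//|n IH]; rewrite blocksS mem_cat inE.
by case/orP => [/IH//|/orP[/eqP->//|/hy]].
Qed.

(** [f] will be a constant times a power of this number. The exponent leaves room for the
    [4 ^ (k * k)] labellings and for [degree_bound]. *)
Definition pattern_bound (d k : nat) : nat := (d + k + 2) ^ ((k + 2) * (k + 2)).
(** The fourth power of this number will be [M]. Its logarithm is [O(k ^ 2 * log (n d k))], so the
    price of an instruction disappears in the soft factor. *)
Definition graph_bound (n d k : nat) : nat := (n.+2 * d.+2 * k.+2) ^ ((k + 2) * (k + 2)).
(** This will be [X]: every iteration inside an expression has its length bounded in [d] and [k], by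
    [k * k + k + 2], by [k ^ k] for the automorphisms, or by [4 * d + 2] for an out-list. *)
Definition degree_bound (d k : nat) : nat := (d + k + 2) ^ (k + 3).

Section Sizes.

Variables (n d k : nat).

Local Notation y := (n.+2 * d.+2 * k.+2).
Local Notation V := (graph_bound n d k).

Lemma graph_bound_pow a e : a <= y -> e <= (k + 2) * (k + 2) -> a ^ e <= V.
Proof.
move=> ay ek; apply: leq_trans (leq_pexp2l _ ek); last by rewrite ?muln_gt0.
exact: leq_expl.
Qed.

Let y_ge8 : 8 <= y.
Proof. by apply: (@leq_mul 4 2); first apply: (@leq_mul 2 2). Qed.

Let V_ge : 4096 <= V.
Proof.
apply: leq_trans (graph_bound_pow (a := y) (e := 4) _ _); [|by []|by nia].
by rewrite -[4096]/(8 ^ 4) leq_exp2r.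
Qed.

Let n_y : n + 2 <= y.
Proof. by rewrite addn2 -mulnA leq_pmulr // muln_gt0. Qed.

Let k_y : k + 2 <= y.
Proof. by rewrite addn2 leq_pmull. Qed.

Let nk_y : k + (n + 2) <= y.
Proof.
apply: (@leq_trans (n.+2 * 2 * k.+2)); first by nia.
by rewrite leq_mul // leq_mul.
Qed.

Let d_y : 4 * d + 2 <= y.
Proof.
apply: (@leq_trans (2 * d.+2 * 2)); first by lia.
by rewrite leq_mul // leq_mul.
Qed.

Let low_y a : a <= y -> a <= V.
Proof. by move=> ay; rewrite -[a]expn1 graph_bound_pow //; nia. Qed.

Let sq_y a b : a <= y -> b <= y -> a * b <= V.
Proof.
move=> ay b_y; apply: (@leq_trans (y ^ 2)); first by rewrite -mulnn leq_mul.
by rewrite graph_bound_pow //; nia.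
Qed.

(** Each quantity is a combination of products of at most three numbers below [V], with small
    constants; the fourth factor [V], at least 4096, absorbs the constants. *)
Lemma graph_bound_large r : r <= k.+1 ->
  let M := V ^ 4 in let b := (k + (n + 2)) * (k + (n + 2)) in
  let L := 4 ^ (k * k) in let P := n.+1 ^ k in
  [/\ 256 <= M, 4 * k * k + 4 * k + 2 <= M, k ^ k <= M & L <= M] /\
  [/\ 1 + k * k.+1 + k + 1 <= M, 4 * n + 1 <= M,
      b + 8 * (n.+1 * n.+2) + 8 <= M & b + 8 * (2 * L * P) + 8 <= M] /\
  n ^ r * (4 * d + 2) ^ k <= M /\ L * P * P <= M.
Proof.
move=> rk M b L P.
have MV : M = V * (V * (V * V)) by rewrite /M !expnS expn0 muln1.
have mono a c : a <= c -> V * a <= V * c by move=> h; rewrite leq_mul2l h orbT.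
have v2 : 4096 * V <= V * V by rewrite leq_mul2r V_ge orbT.
have v3 : 4096 * (V * V) <= V * (V * V) by rewrite leq_mul2r V_ge orbT.
have v4 : 4096 * (V * (V * V)) <= M by rewrite MV leq_mul2r V_ge orbT.
have bV : b <= V by apply: sq_y.
have nV : n.+1 * n.+2 <= V by apply: sq_y; lia.
have kkV : k * k <= V by apply: sq_y; lia.
have kV : k <= V by apply: low_y; lia.
have kpV : k ^ k <= V by apply: graph_bound_pow; [lia|nia].
have LV : L <= V by apply: graph_bound_pow; [lia|nia].
have PV : P <= V by apply: graph_bound_pow; [lia|nia].
have rV : n ^ r <= V by apply: graph_bound_pow; [lia|nia].
have dV : (4 * d + 2) ^ k <= V by apply: graph_bound_pow; [lia|nia].
have LP : L * P <= V * V by apply: leq_mul.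
have LPP : L * P * P <= V * (V * V) by rewrite mulnA; apply: leq_mul.
have T_le : n ^ r * (4 * d + 2) ^ k <= V * V by apply: leq_mul.
do !split; lia.
Qed.

End Sizes.

Lemma degree_bound_large d k :
  [/\ k * k + k + 2 <= degree_bound d k, k ^ k <= degree_bound d k & 4 * d + 2 <= degree_bound d k].
Proof.
rewrite /degree_bound; set z := d + k + 2; have z2 : 2 <= z by lia.
have p3 : z * z * z <= z ^ (k + 3).
  by apply: leq_trans (leq_pexp2l _ (leq_addl k 3)); [rewrite !expnS expn0 muln1 mulnA|lia].
split.
- by apply: leq_trans p3; rewrite /z; nia.
- apply: (@leq_trans (z ^ k)); last by apply: leq_pexp2l; lia.
  by apply: leq_expl; rewrite /z; lia.
- by apply: leq_trans p3; rewrite /z; nia.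
Qed.

Lemma program_correct mode n d k (G : sgraph 'I_n) (H : sgraph 'I_k) LG LH :
  is_degeneracy G d -> adjacency_lists G LG -> adjacency_lists H LH ->
  computes_within (whole (c_main mode) (e_result mode)) (encode_lists LH ++ encode_lists LG)
    (if k != 0 then answer k n mode (nat_lists LH) (nat_lists LG) %/
        (if mode is 0 then 1 else auts k (nat_lists LH)) else 1)
    ((cweight (degree_bound d k) (c_main mode) * main_size k n d (nat_lists LH) +
        ecost (degree_bound d k) (e_result mode)) *
     unit_cost (graph_bound n d k ^ 4)).
Proof.
move=> degG adjG adjH; have [G_deg _] := degG.
set LHn := nat_lists LH; set LGn := nat_lists LG.
have LH_lt u v : v \in LHn u -> v < k by apply: nat_lists_lt.
have LH_uniq := nat_lists_uniq adjH.
have LG_lt x y : y \in LGn x -> y < n by apply: nat_lists_lt.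
have LG_uniq := nat_lists_uniq adjG.
have LH_size := size_NL LH_lt LH_uniq; have LG_size := size_NL LG_lt LG_uniq.
have [[M1 M2 M3 M4] [[M5 M6 M7 M8] [M9 M10]]] := graph_bound_large n d (exponent_le k LHn).
have [X1 X2 X3] := degree_bound_large d k.
set M := graph_bound n d k ^ 4 in M1 M2 M3 M4 M5 M6 M7 M8 M9 M10 *.
set X := degree_bound d k in X1 X2 X3 *.
have posH := list_pos_le 1 k LH_size.
set input := encode_lists LH ++ encode_lists LG.
have inputE : input = [:: k] ++ blocks LHn k ++ n :: blocks LGn n.
  by rewrite /input !encode_blocks.
set g := list_pos 1 LHn k + 1.
have inputE' : input = (k :: blocks LHn k ++ [:: n]) ++ blocks LGn n ++ [::].
  by rewrite inputE cats0 /= -catA.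
have gE : g = size (k :: blocks LHn k ++ [:: n]).
  by rewrite /g list_pos_blocks /= size_cat.
have M_gt0 : 0 < M by lia.
have M_pos : list_pos 1 LHn k + k + 1 <= M by lia.
have pos_b : list_pos g LGn n <= (k + (n + 2)) * (k + (n + 2)).
  apply: leq_trans (list_pos_le g n LG_size) _; rewrite /g.
  by apply: (@leq_trans (1 + k * k.+1 + 1 + n * n.+1)); [lia|nia].
have input_M a : nth 0 input a <= M.
  case: (ltnP a (size input)) => ai; last by rewrite nth_default.
  have := mem_nth 0 ai; rewrite {2}inputE mem_cat mem_seq1 mem_cat inE.
  have bigH a' : a' \in blocks LHn k -> a' <= k.
    by move=> h; apply: (blocks_le LH_size _ h) => x z zx; apply: ltnW; apply: LH_lt zx.
  have bigG a' : a' \in blocks LGn n -> a' <= n.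
    by move=> h; apply: (blocks_le LG_size _ h) => x z zx; apply: ltnW; apply: LG_lt zx.
  have [kM nM] : k <= M /\ n <= M by lia.
  by case/orP => [/eqP->//|/orP[/bigH h|/orP[/eqP->//|/bigG h]]]; apply: leq_trans h _.
have inp_k : nth 0 input 0 = k by rewrite inputE.
have inp_H_size u : u < k -> nth 0 input (list_pos 1 LHn u) = size (LHn u).
  by move=> uk; rewrite inputE -[list_pos _ _ _]addn0 (nth_blocks [:: k]).
have inp_H_nth u j : u < k -> j < size (LHn u) ->
    nth 0 input (list_pos 1 LHn u + 1 + j) = nth 0 (LHn u) j.
  by move=> uk ju; rewrite inputE -addnA add1n (nth_blocks [:: k]).
have inp_n : nth 0 input (list_pos 1 LHn k) = n.
  by rewrite inputE' list_pos_blocks nth_cat /= size_cat /= addn1 ltnS leqnn nth_cat ltnn subnn.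
have inp_size x : x < n -> nth 0 input (list_pos g LGn x) = size (LGn x).
  by move=> xn; rewrite inputE' gE -[list_pos _ _ _]addn0 nth_blocks.
have inp_nth x j : x < n -> j < size (LGn x) ->
    nth 0 input (list_pos g LGn x + 1 + j) = nth 0 (LGn x) j.
  by move=> xn jx; rewrite inputE' gE -addnA add1n nth_blocks.
have inp_zero a : (k + (n + 2)) * (k + (n + 2)) <= a -> nth 0 input a = 0.
  move=> ba; rewrite nth_default // inputE' cats0 size_cat -gE -list_pos_blocks.
  exact: leq_trans pos_b ba.
apply: (@whole_computes M X _ _ _ _ input (finished k n mode (nth 0 input) LHn LGn)) => //.
  apply: main_hoare => //.
  - exact: nat_lists_irr adjG.
  - exact: nat_lists_sym adjG.
  - exact: degeneracy_le degG.
  - by move=> p; exact: (degenerate_sparse adjG p G_deg).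
move=> m bm fin; apply: (result_evals (d := d) (inp := nth 0 input) (NL := LGn)) => //.
exact: degeneracy_le degG.
Qed.

Section Time.

Variables (n d k : nat).

Local Notation y := (n.+2 * d.+2 * k.+2).
Local Notation l := (trunc_log 2 y).
Local Notation z := (d + k + 2).
Local Notation W := (pattern_bound d k).
Local Notation N := (maxn 1 n).

Lemma log_ge3 : 3 <= l.
Proof.
apply: trunc_log_max => //; apply: (@leq_mul 4 2) => //.
by apply: (@leq_mul 2 2).
Qed.

Lemma bitlen_graph : bitlen n <= 2 * l.
Proof.
have h : trunc_log 2 n <= l.
  by apply: leq_trunc_log; rewrite -mulnA; apply: leq_trans (leq_pmulr _ _); [lia|rewrite muln_gt0].
by rewrite /bitlen; have := log_ge3; lia.
Qed.

Lemma unit_cost_graph : unit_cost (graph_bound n d k ^ 4) <= 64 * k.+1 ^ 2 * l.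
Proof.
rewrite /unit_cost /bitlen /graph_bound -expnM; set q := _ * 4.
have h : trunc_log 2 (y ^ q) <= l.+1 * q.
  apply: (@leq_trans (trunc_log 2 (2 ^ (l.+1 * q)))); last by rewrite trunc_expnK.
  apply: leq_trunc_log; rewrite expnM leq_exp2r; last by rewrite /q; lia.
  by apply: ltnW; apply: trunc_log_ltn.
have l3 := log_ge3.
(* Here [k + 2 <= 2 * (k + 1)] is squared and multiplied by 4. A further factor 4, from [unit_cost]
   and from rounding the logarithm, gives 64. *)
have q0 : q <= 16 * k.+1 ^ 2 by rewrite /q expnS expn1; nia.
have q1 : 0 < q by rewrite /q; lia.
have h1 : l.+1 * q + 1 <= 2 * l * q by nia.
apply: (@leq_trans (2 * (2 * l * q))); first by rewrite leq_mul2l; lia.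
by nia.
Qed.

Lemma pattern_bound_ge : [/\ 1 <= W, d.+1 * d.+1 <= W, (degree_bound d k).+1 <= W,
  4 ^ (k * k) <= W ^ 2 & (4 * d + 2) ^ k <= W ^ 3].
Proof.
have z2 : 2 <= z by lia.
have zW e : e <= (k + 2) * (k + 2) -> z ^ e <= W by move=> h; apply: leq_pexp2l; lia.
have expW a e : a <= z ^ e -> a ^ k <= W ^ e.
  move=> h; apply: (@leq_trans ((z ^ e) ^ k)); first exact: leq_expl.
  by rewrite -expnM mulnC expnM; apply: leq_expl; apply: zW; nia.
split.
- by rewrite expn_gt0; lia.
- by apply: leq_trans (zW 2 _); [rewrite !expnS expn0; nia|nia].
- apply: leq_trans (zW (k + 4) _); last by nia.
  rewrite /degree_bound (addnS k 3) expnS.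
  have : 0 < z ^ (k + 3) by rewrite expn_gt0; lia.
  by nia.
- apply: (@leq_trans (z ^ (2 * (k * k)))).
    by rewrite -[4]/(2 ^ 2) -expnM; apply: leq_expl.
  by rewrite mulnC expnM; apply: leq_expl; apply: zW; nia.
- by apply: expW; rewrite !expnS expn0; nia.
Qed.

Lemma peel_size_le : peel_size n d <= 30 * (d.+1 * d.+1) * l * N.
Proof.
have l3 := log_ge3; have bl := bitlen_graph.
have nN : n.+1 <= 2 * N by lia.
have N1 : 1 <= N by lia.
have nN' : n <= N by lia.
have hp : pass_size n d <= 2 * d.+1 * N.
  by rewrite /pass_size mulnSr !mulnDl; have : 2 * d * n <= 2 * d * N; [rewrite leq_mul2l nN' orbT|lia].
have hr : round_size n d <= 6 * d.+1 * l * N.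
  rewrite /round_size; have := leq_mul bl hp; nia.
have hq : (4 * d).+1 * round_size n d <= 4 * d.+1 * (6 * d.+1 * l * N) by apply: leq_mul; lia.
have lN : N <= d.+1 * d.+1 * l * N by apply: leq_pmull; rewrite !muln_gt0; lia.
have e : 4 * d.+1 * (6 * d.+1 * l * N) = 24 * (d.+1 * d.+1 * l * N) by nia.
have -> : 30 * (d.+1 * d.+1) * l * N = 30 * (d.+1 * d.+1 * l * N) by nia.
by rewrite /peel_size; move: hq lN; rewrite e; lia.
Qed.

(** Peeling is linear in [N] up to one logarithm, so it fits below [N ^ ce] because [ce] is
    positive. The constant is 2 for locating the lists, 30 for peeling and 3 for counting. *)
Lemma main_size_le LH ce : exponent k LH <= ce -> 0 < ce ->
  main_size k n d LH <= 35 * W ^ 5 * l * N ^ ce.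
Proof.
move=> rce ce0; have [W1 dW _ LW DW] := pattern_bound_ge.
have l3 := log_ge3; have N1 : 1 <= N by lia.
have nce : n ^ exponent k LH <= N ^ ce.
  by apply: (@leq_trans (N ^ exponent k LH)); [apply: leq_expl; lia|apply: leq_pexp2l].
have Nce : N <= N ^ ce by rewrite -[X in X <= _]expn1 leq_pexp2l.
have LD : 4 ^ (k * k) * (4 * d + 2) ^ k <= W ^ 5 by rewrite (expnD W 2 3); apply: leq_mul.
have L5 : 4 ^ (k * k) <= W ^ 5 by apply: leq_trans LW _; apply: leq_pexp2l.
have W5 : W <= W ^ 5 by rewrite -[X in X <= _]expn1 leq_pexp2l.
set q := l * N ^ ce; have q1 : N ^ ce <= q by apply: leq_pmull; lia.
have q0 : 0 < q by apply: leq_trans q1; rewrite expn_gt0; lia.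
have Wq : q <= W ^ 5 * q by apply: leq_pmull; lia.
have main : 4 ^ (k * k) * (n ^ exponent k LH * (4 * d + 2) ^ k).+1 <= 2 * (W ^ 5 * q).
  rewrite mulnS mulnCA mul2n -addnn; apply: leq_add.
    by apply: leq_trans L5 _; apply: leq_pmulr.
  by rewrite mulnC; apply: leq_mul LD (leq_trans nce q1).
have peel : peel_size n d <= 30 * (W ^ 5 * q).
  apply: leq_trans peel_size_le _.
  have -> : 30 * (d.+1 * d.+1) * l * N = 30 * (d.+1 * d.+1 * (l * N)) by rewrite !mulnA.
  rewrite leq_mul2l /=; apply: leq_mul; first exact: leq_trans dW W5.
  by rewrite leq_mul2l Nce orbT.
have -> : 35 * W ^ 5 * l * N ^ ce = 35 * (W ^ 5 * q) by rewrite /q !mulnA.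
by rewrite /main_size; lia.
Qed.

End Time.

(** One logarithm comes from the peeling passes and one from the unit cost. The factor
    [64 * k.+1 ^ 2] of the latter suggests 64 for the soft factor, whose exponents are then more
    than sufficient. *)
Lemma running_time mode : exists A E, forall n d k LH ce,
  exponent k LH <= ce -> 0 < ce ->
  (cweight (degree_bound d k) (c_main mode) * main_size k n d LH +
     ecost (degree_bound d k) (e_result mode)) * unit_cost (graph_bound n d k ^ 4) <=
  A * pattern_bound d k ^ E * (soft_factor 64 n d k * maxn 1 n ^ ce).
Proof.
have [a1 [b1 h1]] := cweight_poly (c_main mode).
have [a2 [b2 h2]] := ecost_poly (e_result mode).
exists (35 * a1 + a2), (b1 + b2 + 5) => n d k LH ce rce ce0.
have l3 := log_ge3 n d k; set l := trunc_log _ _ in l3 *.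
have [W1 _ XW _ _] := pattern_bound_ge d k; set W := pattern_bound d k in W1 XW *.
set N := maxn 1 n; set S := N ^ ce; set X := degree_bound d k in XW *.
have S1 : 0 < S by rewrite expn_gt0; lia.
have lS : 0 < l * S by rewrite muln_gt0 S1; lia.
have ms : main_size k n d LH <= 35 * W ^ 5 * (l * S) by rewrite mulnA; apply: main_size_le.
have c1 : cweight X (c_main mode) <= a1 * W ^ b1.
  by apply: leq_trans (h1 X) _; rewrite leq_mul2l leq_expl ?orbT.
have c2 : ecost X (e_result mode) <= a2 * W ^ b2.
  by apply: leq_trans (h2 X) _; rewrite leq_mul2l leq_expl ?orbT.
have p1 : a1 * W ^ b1 * (35 * W ^ 5 * (l * S)) <= 35 * a1 * W ^ (b1 + b2 + 5) * (l * S).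
  have -> : a1 * W ^ b1 * (35 * W ^ 5 * (l * S)) = 35 * a1 * (W ^ b1 * W ^ 5) * (l * S) by nia.
  by rewrite -expnD leq_mul2r leq_mul2l leq_pexp2l ?orbT //; lia.
have p2 : a2 * W ^ b2 <= a2 * W ^ (b1 + b2 + 5) * (l * S).
  rewrite -[X in X <= _]muln1; apply: leq_mul => //.
  by rewrite leq_mul2l leq_pexp2l ?orbT //; lia.
have total : cweight X (c_main mode) * main_size k n d LH + ecost X (e_result mode) <=
    (35 * a1 + a2) * W ^ (b1 + b2 + 5) * (l * S).
  rewrite (mulnDl (35 * a1)) (mulnDl (35 * a1 * _)); apply: leq_add; last exact: leq_trans c2 p2.
  exact: leq_trans (leq_mul c1 ms) p1.
have tail : l * S * (64 * k.+1 ^ 2 * l) <= soft_factor 64 n d k * S.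
  have -> : l * S * (64 * k.+1 ^ 2 * l) = 64 * k.+1 ^ 2 * l ^ 2 * S by rewrite (expnS l) expn1; nia.
  rewrite leq_mul2r; apply/orP; right; apply: leq_mul.
    by rewrite leq_mul2l leq_pexp2l.
  by apply: leq_pexp2l => //; lia.
apply: leq_trans (leq_mul total (unit_cost_graph n d k)) _.
by rewrite -[X in X <= _]mulnA; apply: leq_mul.
Qed.

(** * Computability of the factor depending on the parameters *)

Definition e_bound (A E : nat) : expr :=
  EBin Mul (ENum A) (ecall e_pow [:: ecall e_pow
    [:: EBin Add (EBin Add (EGet (ENum 0)) (EGet (ENum 1))) (ENum 2);
        EBin Mul (EBin Add (EGet (ENum 1)) (ENum 2)) (EBin Add (EGet (ENum 1)) (ENum 2))]; ENum E]).

(** The compiler is reused. Computability asks for no particular time, so [M] can be a plain sum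
    that dominates all intermediate values. *)
Lemma computable_bound A E : computable2 (fun d k => A * pattern_bound d k ^ E).
Proof.
exists (whole CSkip (e_bound A E)) => d k.
set W := pattern_bound d k.
pose M := 256 + A + d + k + 2 + (k + 2) * (k + 2) + W + W ^ E + A * W ^ E + E.
pose X := (k + 2) * (k + 2) + E.
suff [t _ ?] : computes_within (whole CSkip (e_bound A E)) [:: d; k] (A * W ^ E)
    ((1 + ecost X (e_bound A E)) * unit_cost M) by exists t.
apply: (@whole_computes M X _ _ _ _ _ (eq (nth 0 [:: d; k]))); first by rewrite /M; lia.
- by case=> [|[|a]] /=; rewrite /M ?nth_nil; lia.
- exact: hoare_skip.
move=> m _ <-; set inp := nth 0 [:: d; k].
have g0 : evals M X inp [::] (EGet (ENum 0)) d.
  by apply: (@EvGet _ _ _ _ _ 0); ev; rewrite /M; lia.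
have g1 : evals M X inp [::] (EGet (ENum 1)) k.
  by apply: (@EvGet _ _ _ _ _ 1); ev; rewrite /M; lia.
have k2 : evals M X inp [::] (EBin Add (EGet (ENum 1)) (ENum 2)) (k + 2).
  by apply: EvBin; [exact: g1|ev; rewrite /M; lia|rewrite /= /M; lia].
apply: EvBin; [by ev; rewrite /M; lia| |by rewrite /= -/W /M; lia].
apply: (ev_call (vs := [:: W; E])); last by apply: evals_pow; rewrite /M /X; lia.
eapply EvCons; last by ev; rewrite /M; lia.
apply: (ev_call (vs := [:: d + k + 2; (k + 2) * (k + 2)])); last first.
  by apply: evals_pow; rewrite -?[_ ^ _]/W /M /X; lia.
eapply EvCons.
  apply: EvBin; [apply: EvBin; [exact: g0|exact: g1|]|ev|]; rewrite /= /M; lia.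
eapply EvCons; last by ev.
by apply: EvBin; rewrite //= /M; lia.
Qed.

Lemma answer_empty n mode LH NL : answer 0 n mode LH NL = 1.
Proof.
have -> : 1 = #|{ffun 'I_0 -> 'I_n}| by rewrite card_ffun !card_ord expn0.
rewrite -cardsT; apply: eq_card => phi; rewrite !inE.
by apply/forallP => -[].
Qed.

(** For [k = 0] the machine returns 1. The answer is then 1 too, and [num * count = 1] forces
    [count] to be 1. *)
Lemma quotient_value k LH (n : nat) mode NL num count :
  answer k n mode LH NL = num * count -> 0 < num ->
  (0 < k -> (if mode is 0 then 1 else auts k LH) = num) ->
  (if k != 0 then answer k n mode LH NL %/ (if mode is 0 then 1 else auts k LH) else 1) = count.
Proof.
move=> e num0 num_eq; case: posnP => [k0|k_gt0].
  by move: e; rewrite k0 answer_empty => /esym/eqP; rewrite muln_eq1 => /andP[_ /eqP].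
by rewrite num_eq // e mulKn.
Qed.

(* The pattern H is part of the input.  [maxn 1 n] differs from n only for the
   graph without vertices. *)
Theorem theorem1p4 :
  exists f : nat -> nat -> nat, computable2 f /\
  exists (Phom Psub Pind : prog) (c : nat),
  forall (n d k eps : nat) (G : sgraph 'I_n) (F : {set {set 'I_k}})
         (LG : 'I_n -> seq 'I_n) (LH : 'I_k -> seq 'I_k),
    is_degeneracy G d ->
    F \subset edges (complete 'I_k) -> #|F| = eps ->
    let H := remove_edges (complete 'I_k) F in
    adjacency_lists G LG -> adjacency_lists H LH ->
    let input := encode_lists LH ++ encode_lists LG in
    let T := f d k * (soft_factor c n d k * maxn 1 n ^ clique_exponent eps) in
    [/\ computes_within Phom input (hom H G) T,
        computes_within Psub input (sub H G) T
      & computes_within Pind input (ind H G) T].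
Proof.
have [A0 [E0 time0]] := running_time 0.
have [A1 [E1 time1]] := running_time 1.
have [A2 [E2 time2]] := running_time 2.
(* One [f] has to serve the three programs, so their constants and exponents are added. *)
exists (fun d k => (A0 + A1 + A2) * pattern_bound d k ^ (E0 + E1 + E2)).
split; first exact: computable_bound.
exists (whole (c_main 0) (e_result 0)), (whole (c_main 1) (e_result 1)),
  (whole (c_main 2) (e_result 2)), 64.
move=> n d k eps G F LG LH degG FK Feps H adjG adjH input T.
have rce : exponent k (nat_lists LH) <= clique_exponent eps.
  by rewrite -Feps -(missing_card adjH FK) //; apply: exponent_le_clique.
(* The case [j = 0]: the exponent is at least 1, which pays for the nearly linear peeling phase. *)
have ce0 : 0 < clique_exponent eps by apply: lt_clique_exponent.
have [W1 _ _ _ _] := pattern_bound_ge d k.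
have le_T A E : A <= A0 + A1 + A2 -> E <= E0 + E1 + E2 ->
    A * pattern_bound d k ^ E * (soft_factor 64 n d k * maxn 1 n ^ clique_exponent eps) <= T.
  by move=> hA hE; rewrite leq_mul2r leq_mul ?orbT // leq_pexp2l.
have within mode v A E :
    (if k != 0 then answer k n mode (nat_lists LH) (nat_lists LG) %/
        (if mode is 0 then 1 else auts k (nat_lists LH)) else 1) = v ->
    A <= A0 + A1 + A2 -> E <= E0 + E1 + E2 ->
    (cweight (degree_bound d k) (c_main mode) * main_size k n d (nat_lists LH) +
       ecost (degree_bound d k) (e_result mode)) * unit_cost (graph_bound n d k ^ 4) <=
      A * pattern_bound d k ^ E * (soft_factor 64 n d k * maxn 1 n ^ clique_exponent eps) ->
    computes_within (whole (c_main mode) (e_result mode)) input v T.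
  move=> <- hA hE time; have [t ht run] := program_correct mode degG adjG adjH.
  by exists t => //; apply: leq_trans ht (leq_trans time (le_T _ _ hA hE)).
split.
- apply: within (time0 _ _ _ _ _ rce ce0); [|lia|lia].
  by apply: (quotient_value (num := 1)) => //; rewrite mul1n; apply: answer_hom.
- apply: within (time1 _ _ _ _ _ rce ce0); [|lia|lia].
  apply: quotient_value (answer_sub adjH adjG) (num_aut_gt0 H) _.
  exact: auts_num_aut.
- apply: within (time2 _ _ _ _ _ rce ce0); [|lia|lia].
  apply: quotient_value (answer_ind adjH adjG) (num_aut_gt0 H) _.
  exact: auts_num_aut.
Qed.
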